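(* Let $k$ be a field, $r\ge3$, and let $\psi:\mathbb P^1_k\to\mathbb P^{r-1}_k$ be the morphism defined by homogeneous $f_1,\ldots,f_r\in k[x,y]$ of degree $d\ge1$ without common factor. Let $\mu_1,\ldots,\mu_{r-1}$ be the integers such that the minimal graded free resolution of $I=(f_1,\ldots,f_r)$ is $0\to\bigoplus_{i=1}^{r-1}R(-d-\mu_i)\to R(-d)^r\to I\to0$, let $\mathcal C\subseteq\mathbb P^{r-1}_k$ be the image curve and $I_{\mathcal C}\subseteq A=k[T_1,\ldots,T_r]$ its homogeneous defining ideal. If $\psi$ is birational onto its image, then $\sum_{i=1}^{r-1}\mu_i=d$ and $$\mathrm{reg}(I_{\mathcal C})\le\max_{i\neq j}\{\mu_i+\mu_j\}.$$ In particular, if moreover $f_1,\ldots,f_r$ are linearly independent over $k$ (i.e. $\mathcal C$ lies in no hyperplane), then $\mathrm{reg}(A/I_{\mathcal C})\le\deg(\mathcal C)-\mathrm{codim}(\mathcal C)$.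
   Context: $\mathrm{reg}$ denotes Castelnuovo–Mumford regularity of a finitely generated graded $A$-module $M$: $\mathrm{reg}(M)=\max_i\{a^i(M)+i\}$, where $a^i(M)$ is the largest degree in which $H^i_{(T_1,\ldots,T_r)}(M)$ is nonzero ($-\infty$ if it vanishes); equivalently $\max_j\{b_j(M)-j\}$ with $b_j(M)$ the largest degree of a minimal $j$-th syzygy. *)

(* Defs.v *)
From HB Require Import structures.
From mathcomp Require Import all_boot all_order all_algebra.
From mathcomp Require Import mpoly.
Set Implicit Arguments. Unset Strict Implicit. Unset Printing Implicit Defensive.
Import Order.TTheory GRing.Theory Num.Theory.
Local Open Scope ring_scope.

Definition homogZ (k : fieldType) (n : nat) (p : {mpoly k[n]}) (e : int) : Prop :=
  match e with
  | Posz m => p \is m.-homog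
  | Negz _ => p = 0
  end.

(* Koszul complex K(T_1,..,T_r) over A = k[T_1..T_r]; a chain of homological
   degree i is a family c indexed by the i-subsets S of {0..r-1}.
   (d c)_S = sum_{l notin S} (-1)^{#{m in S | m < l}} T_l c_{S u {l}}. *)
Definition ksign (k : fieldType) (r : nat) (S : {set 'I_r}) (l : 'I_r) : {mpoly k[r]} :=
  (-1) ^+ #|[set m in S | (m < l)%N]|.

Definition kdiff (k : fieldType) (r : nat) (c : {set 'I_r} -> {mpoly k[r]})
  (S : {set 'I_r}) : {mpoly k[r]} :=
  \sum_(l < r | l \notin S) ksign k S l * 'X_l * c (l |: S).

(* For homogeneous ideals W <= U of A, M = U/W.  H_i(K(T; M))_j <> 0,
   i.e. Tor_i^A(M, k)_j <> 0. *)
Definition koszulH_nonzero (k : fieldType) (r : nat)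
  (U W : {mpoly k[r]} -> Prop) (i : nat) (j : int) : Prop :=
  exists c : {set 'I_r} -> {mpoly k[r]},
    (forall S : {set 'I_r}, #|S| = i -> U (c S) /\ homogZ (c S) (j - i%:Z)) /\
    (forall S : {set 'I_r}, (#|S|).+1 = i -> W (kdiff c S)) /\
    ~ (exists b : {set 'I_r} -> {mpoly k[r]},
         (forall S : {set 'I_r}, #|S| = i.+1 -> U (b S) /\ homogZ (b S) (j - i%:Z - 1)) /\
         (forall S : {set 'I_r}, #|S| = i -> W (c S - kdiff b S))).

(* reg(U/W) <= m, with reg(M) = max_i { b_i(M) - i }, b_i(M) = top degree of Tor_i(M,k). *)
Definition reg_le (k : fieldType) (r : nat) (U W : {mpoly k[r]} -> Prop) (m : int) : Prop :=
  forall (i : nat) (j : int), koszulH_nonzero U W i j -> j - i%:Z <= m.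

Definition zero_ideal (k : fieldType) (r : nat) (p : {mpoly k[r]}) : Prop := p = 0.
Definition unit_ideal (k : fieldType) (r : nat) (p : {mpoly k[r]}) : Prop := True.

Definition curve_ideal (k : fieldType) (r : nat) (f : 'I_r -> {mpoly k[2]})
  (p : {mpoly k[r]}) : Prop :=
  p \mPo [tuple f l | l < r] = 0.

Definition no_common_factor (k : fieldType) (r : nat) (f : 'I_r -> {mpoly k[2]}) : Prop :=
  forall g : {mpoly k[2]}, (forall l, exists h, f l = g * h) -> (msize g <= 1)%N.

(* psi is birational onto its image: k(C) = k(f_i/f_j) contains t = x/y,
   i.e. x/y = P(f)/Q(f) with P, Q homogeneous of the same degree, Q(f) <> 0. *)
Definition birational (k : fieldType) (r : nat) (f : 'I_r -> {mpoly k[2]}) : Prop :=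
  exists (e : nat) (P Q : {mpoly k[r]}),
    P \is e.-homog /\ Q \is e.-homog /\
    Q \mPo [tuple f l | l < r] != 0 /\
    'X_(inord 0) * (Q \mPo [tuple f l | l < r]) =
    'X_(inord 1) * (P \mPo [tuple f l | l < r]).

(* The syzygy module of (f_1..f_r) is free with homogeneous basis s_1..s_{r-1},
   s_i of degree mu_i, i.e. 0 -> (+)_i R(-d-mu_i) -> R(-d)^r -> I -> 0 is a
   graded free resolution of I = (f_1..f_r). *)
Definition resolution_degrees (k : fieldType) (r : nat) (f : 'I_r -> {mpoly k[2]})
  (mu : 'I_(r-1) -> nat) : Prop :=
  exists s : 'I_(r-1) -> 'I_r -> {mpoly k[2]},
    (forall i l, s i l \is (mu i).-homog) /\
    (forall i, \sum_(l < r) s i l * f l = 0) /\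
    (forall g : 'I_r -> {mpoly k[2]}, \sum_(l < r) g l * f l = 0 ->
       exists a : 'I_(r-1) -> {mpoly k[2]}, forall l, g l = \sum_(i < r-1) a i * s i l) /\
    (forall a : 'I_(r-1) -> {mpoly k[2]},
       (forall l, \sum_(i < r-1) a i * s i l = 0) -> forall i, a i = 0).

Definition lin_indep (k : fieldType) (r : nat) (f : 'I_r -> {mpoly k[2]}) : Prop :=
  forall c : 'I_r -> k, \sum_(l < r) c l *: f l = 0 -> forall l, c l = 0.

Definition indep_mod (k : fieldType) (r : nat) (I : {mpoly k[r]} -> Prop) (e : nat)
  (p : 'I_e -> {mpoly k[r]}) : Prop :=
  forall c : 'I_e -> k, I (\sum_(i < e) c i *: p i) -> forall i, c i = 0.

Definition hilb_fun (k : fieldType) (r : nat) (I : {mpoly k[r]} -> Prop) (n e : nat) : Prop :=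
  (exists p : 'I_e -> {mpoly k[r]}, (forall i, p i \is n.-homog) /\ indep_mod I p) /\
  (forall q : 'I_e.+1 -> {mpoly k[r]}, (forall i, q i \is n.-homog) -> ~ indep_mod I q).

(* deg C = D : the Hilbert polynomial of A/I_C is D*n + c0 (C a curve). *)
Definition curve_degree (k : fieldType) (r : nat) (I : {mpoly k[r]} -> Prop) (D : nat) : Prop :=
  exists (n0 : nat) (c0 : int), forall n : nat, (n0 <= n)%N ->
    exists e : nat, hilb_fun I n e /\ e%:Z = D%:Z * n%:Z + c0.

(* Main.v *)
(* Work on the chart y = 1, so that forms of degree m become polynomials of size at most m + 1, and
   let N_t be the space of values p(f) for p in A_t, i.e. the degree t part of A/I_C. Put
   q = max (mu_i + mu_j).

   Regularity is read off Koszul homology: everything follows once cycles with coefficients in N_u,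
   u >= q, are boundaries. After extending k to k(t) and changing coordinates, let h be one of the
   f_l, of size d + 1. On all forms the Koszul complex of f is exact by a homotopy with a form
   coprime to h, and the homotopy of h corrects the result into N_(u-1), provided that
   (I) h b in N_u implies b in N_(u-1) and (S) every form is in h R + N_u, in the relevant degrees.
   Both are statements about the ideal J of maximal minors of the matrix Phi of linear forms whose
   columns are the coefficient vectors of the x^a L_i, where L_i = sum_l s_il(x) T_l. Indeed J lies
   in I_C, and the Eagon-Northcott complexes of Phi, exact in positive degrees modulo sets of
   variables since their homology is nilpotent, show that in degrees at least q the ideal J and the
   variables T_0, T_1 generate A, and T_1 is injective modulo J and T_0. Birationality enters through
   some c with c and x c in N_e, hence c^m times any form of degree m in N_(e m).

   The base change is undone coefficientwise by a k-linear retraction of k(t) onto k. The degrees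
   mu_i add up to d since f is proportional to the maximal minors of the syzygy matrix, and the
   degree of the curve is d since n d - C <= dim N_n <= n d + 1. *)

Require Import Defs.
From HB Require Import structures.
From Stdlib Require Import FunctionalExtensionality.
From mathcomp Require Import all_boot all_order all_algebra.
From mathcomp Require Import mpoly.
From mathcomp Require Import perm.
From mathcomp Require Import ring zify.
Set Implicit Arguments. Unset Strict Implicit. Unset Printing Implicit Defensive.
Import Order.TTheory GRing.Theory Num.Theory.
Local Open Scope ring_scope.

(** * Koszul operators *)

(** The matrix Phi has q rows because polynomials of degree below q in x are followed through their
    q coefficients. Two things fix q: elements of degree below q in the ideal of the L_i must come
    from the x^a L_i of degree below q, which is a condition on the sums mu_i + mu_j; and the
    maximal minors have degree q, to which a complex with linear maps adds nothing. The ideal J may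
    be smaller than I_C. What it yields is information modulo T_0: every form of degree at least q
    whose value is divisible by h turns out to lie in J + (T_0), and since J evaluates to 0 the
    quotient by h can then be read off. Two general linear forms are needed because the coordinate
    ring of a curve acquires finite length only modulo two of them; their choice is the only use of
    an infinite field. The characteristic is arbitrary, hence alternating families come with a
    vanishing diagonal besides antisymmetry. *)

Section AlternatingSums.
Variables (R : comNzRingType) (w : nat).

(** Transposing the indices would only show that the sum equals its opposite, which says nothing in
    characteristic 2. The relation [lt] selects one of (i, j), (j, i), so that two halves cancel. *)
Lemma sum_alternating (I : finType) (P : pred I) (G : I -> I -> R)
    (lt : rel I) :
  (forall i j, P i -> P j -> i != j -> lt i j = ~~ lt j i) ->
  (forall i, P i -> G i i = 0) ->
  (forall i j, P i -> P j -> i != j -> G i j = - G j i) ->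
  \sum_(i | P i) \sum_(j | P j) G i j = 0.
Proof.
move=> ltC G0 GN.
pose S b := \sum_(i | P i) \sum_(j | P j && (j != i) && (lt i j == b)) G i j.
have -> : \sum_(i | P i) \sum_(j | P j) G i j = S true + S false.
  rewrite -big_split /=; apply: eq_bigr => i Pi.
  rewrite (bigD1 i) //= G0 // add0r.
  rewrite (bigID (fun j => lt i j)) /=; congr (_ + _).
    by apply: eq_bigl => j; rewrite eqb_id.
  by apply: eq_bigl => j; rewrite eqbF_neg.
suff -> : S false = - S true by rewrite subrr.
rewrite /S.
rewrite (exchange_big_dep P) /=; last by move=> i j _ /andP[/andP[Pj _] _].
rewrite -sumrN; apply: eq_bigr => j Pj; rewrite -sumrN.
apply: eq_big => [i | i /andP[Pi /andP[/andP[_ ne] _]]]; last by apply: GN; rewrite // eq_sym.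
case Pi: (P i) => //=; rewrite Pj /= eq_sym; case: eqVneq => //= ne.
by rewrite ltC ?Pi //; case: (lt j i).
Qed.

End AlternatingSums.

Section KoszulOperators.
Variables (R : comNzRingType) (w : nat).
Implicit Types (t u : 'I_w -> R) (c : {set 'I_w} -> R) (S : {set 'I_w}).

Definition ksg S (i : 'I_w) : R := (-1) ^+ #|[set m in S | (m < i)%N]|.

Definition contract t c S : R := \sum_(i < w | i \notin S) ksg S i * t i * c (i |: S).

Definition wedge u c S : R := \sum_(i < w | i \in S) ksg S i * u i * c (S :\ i).

Lemma ksgU S i j : i \notin S -> ksg (i |: S) j = (-1) ^+ (i < j)%N * ksg S j.
Proof.
move=> iS; rewrite /ksg -exprD; congr (_ ^+ _).
case: (ltnP i j) => ij /=.
  rewrite (_ : [set m in i |: S | (m < j)%N] = i |: [set m in S | (m < j)%N]).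
    by rewrite cardsU1 !inE (negbTE iS).
  by apply/setP=> m; rewrite !inE; case: eqVneq => [->|] //=; rewrite ij.
rewrite add0n; apply: eq_card => m; rewrite !inE.
by case: eqVneq => [->|] //=; rewrite ltnNge ij andbF.
Qed.

Lemma ksgD1 S i j : i \in S -> ksg (S :\ i) j = (-1) ^+ (i < j)%N * ksg S j.
Proof.
move=> iS; rewrite -{2}(setD1K iS) ksgU ?inE ?eqxx // mulrA -exprD addnn.
by rewrite -signr_odd odd_double mul1r.
Qed.

Lemma ksgK S i : ksg S i * ksg S i = 1.
Proof. by rewrite /ksg -exprD addnn -signr_odd odd_double. Qed.

Lemma ksgU1 S i : i \notin S -> ksg (i |: S) i = ksg S i.
Proof. by move=> iS; rewrite ksgU // ltnn mul1r. Qed.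

Lemma ksgD11 S i : i \in S -> ksg (S :\ i) i = ksg S i.
Proof. by move=> iS; rewrite ksgD1 // ltnn mul1r. Qed.

(** The Clifford relation. Removing the index just inserted gives t_i u_i c S, for i outside S in
    the first summand and inside S in the second; all other terms cancel in pairs by sign. The
    homotopies below come from it. *)
Lemma wedge_contract t u c S :
  contract t (wedge u c) S + wedge u (contract t c) S =
  (\sum_i t i * u i) * c S.
Proof.
rewrite /contract /wedge.
have -> : \sum_(i | i \notin S) ksg S i * t i *
    (\sum_(j | j \in i |: S) ksg (i |: S) j * u j * c ((i |: S) :\ j)) =
    \sum_(i | i \notin S) t i * u i * c S +
    \sum_(i | i \notin S) \sum_(j | j \in S)
      ksg S i * ksg (i |: S) j * t i * u j * c ((i |: S) :\ j).
  rewrite -big_split /=; apply: eq_bigr => i iS.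
  rewrite (bigD1 i) ?setU11 //= mulrDr; congr (_ + _).
    by rewrite ksgU1 // setU1K // -[RHS]mul1r -(ksgK S i); ring.
  rewrite mulr_sumr; apply: eq_big => [j | j jS]; last by ring.
  by rewrite !inE; case: eqVneq => [->|] //=; rewrite ?(negbTE iS) ?andbT.
have -> : \sum_(j | j \in S) ksg S j * u j *
    (\sum_(i | i \notin S :\ j) ksg (S :\ j) i * t i * c (i |: S :\ j)) =
    \sum_(j | j \in S) t j * u j * c S +
    \sum_(j | j \in S) \sum_(i | i \notin S)
      ksg S j * ksg (S :\ j) i * t i * u j * c (i |: S :\ j).
  rewrite -big_split /=; apply: eq_bigr => j jS.
  rewrite (bigD1 j) ?inE ?eqxx //= mulrDr; congr (_ + _).
    rewrite ksgD11 // setD1K //.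
    by rewrite -[RHS]mul1r -(ksgK S j); ring.
  rewrite mulr_sumr; apply: eq_big => [i | i iS]; last by ring.
  by rewrite !inE; case: eqVneq => [->|] //=; rewrite ?jS ?andbT ?andbF.
rewrite addrACA [X in _ + X = _](_ : _ = 0).
  rewrite addr0 mulr_suml [RHS](bigID (fun i => i \notin S)) /=; congr (_ + _).
  by apply: eq_bigl => i; rewrite negbK.
rewrite [X in _ + X]exchange_big /= -big_split /= big1 // => i iS.
rewrite -big_split /= big1 // => j jS.
have ij : i != j by apply: contraNneq iS => ->.
have -> : i |: S :\ j = (i |: S) :\ j.
  by apply/setP=> m; rewrite !inE; case: (eqVneq m i) => [->|] //=; rewrite ij.
rewrite ksgU // ksgD1 //.
case: (ltngtP i j) => [lt|lt|/val_inj e]; last by rewrite e eqxx in ij.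
  by rewrite expr1 expr0; ring.
by rewrite expr1 expr0; ring.
Qed.

Lemma contract_anticomm t t' c S :
  contract t (contract t' c) S = - contract t' (contract t c) S.
Proof.
have E s s' : contract s (contract s' c) S =
    \sum_(i | i \notin S) \sum_(j | (j \notin S) && (j != i))
      ksg S i * ksg (i |: S) j * s i * s' j * c (j |: (i |: S)).
  apply: eq_bigr => i iS; rewrite mulr_sumr; apply: eq_big => [j|j _]; last by ring.
  by rewrite !inE negb_or andbC.
rewrite !E -sumrN.
rewrite (exchange_big_dep (fun j => j \notin S)) /=; last by move=> i j _ /andP[].
apply: eq_bigr => i iS; rewrite -sumrN; apply: eq_big => [j|j /andP[jS /andP[_ ij]]].
  by rewrite iS eq_sym.
rewrite !ksgU // setUCA.
case: (ltngtP i j) => [lt|lt|/val_inj e]; last by rewrite e eqxx in ij.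
  by rewrite expr1 expr0; ring.
by rewrite expr1 expr0; ring.
Qed.

(** [contract_anticomm] with t' = t would only give twice the claim, hence the separate pairing of
    terms. *)
Lemma contract_contract t c S : contract t (contract t c) S = 0.
Proof.
rewrite /contract.
transitivity (\sum_(i | i \notin S) \sum_(j | j \notin S)
    if j == i then 0 else ksg S i * ksg (i |: S) j * t i * t j * c (j |: (i |: S))).
  apply: eq_bigr => i iS; rewrite mulr_sumr [RHS](bigD1 i) //= eqxx add0r.
  apply: eq_big => [j|j]; first by rewrite !inE negb_or andbC.
  by rewrite !inE negb_or => /andP[/negbTE -> _]; ring.
apply: (@sum_alternating _ _ _ _ (fun i j : 'I_w => (i < j)%N)) => [i j _ _ ij|i _|i j iS jS ij].
- by rewrite -leqNgt ltn_neqAle ij.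
- by rewrite eqxx.
rewrite eq_sym (negbTE ij) !ksgU // setUCA.
case: (ltngtP i j) => [lt|lt|/val_inj e]; last by rewrite e eqxx in ij.
  by rewrite expr1 expr0; ring.
by rewrite expr1 expr0; ring.
Qed.

End KoszulOperators.

Section KoszulLinearity.
Variables (R : comNzRingType) (w : nat).
Implicit Types (t u : 'I_w -> R) (c : {set 'I_w} -> R) (S : {set 'I_w}).

Lemma eq_contract t c c' : c =1 c' -> contract t c =1 contract t c'.
Proof. by move=> e S; apply: eq_bigr => i _; rewrite e. Qed.

Lemma eq_wedge u c c' : c =1 c' -> wedge u c =1 wedge u c'.
Proof. by move=> e S; apply: eq_bigr => i _; rewrite e. Qed.

Lemma contract0 t S : contract t (fun=> 0) S = 0.
Proof. by apply: big1 => i _; rewrite mulr0. Qed.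

Lemma wedge0 u S : wedge u (fun=> 0) S = 0.
Proof. by apply: big1 => i _; rewrite mulr0. Qed.

Lemma contractZ t a c S : contract t (fun S => a * c S) S = a * contract t c S.
Proof. by rewrite mulr_sumr; apply: eq_bigr => i _; ring. Qed.

Lemma wedgeZ u a c S : wedge u (fun S => a * c S) S = a * wedge u c S.
Proof. by rewrite mulr_sumr; apply: eq_bigr => i _; ring. Qed.

Lemma contractB t c c' S :
  contract t (fun S => c S - c' S) S = contract t c S - contract t c' S.
Proof. by rewrite -sumrB; apply: eq_bigr => i _; ring. Qed.

Lemma contractD t c c' S :
  contract t (fun S => c S + c' S) S = contract t c S + contract t c' S.
Proof. by rewrite -big_split; apply: eq_bigr => i _ /=; ring. Qed.

Lemma contract_sum t (I : finType) (P : pred I) (F : I -> {set 'I_w} -> R) S :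
  contract t (fun S => \sum_(i | P i) F i S) S = \sum_(i | P i) contract t (F i) S.
Proof.
rewrite exchange_big /=; apply: eq_bigr => i _.
by rewrite mulr_sumr; apply: eq_bigr => j _; ring.
Qed.

Lemma wedge_sum u (I : finType) (P : pred I) (F : I -> {set 'I_w} -> R) S :
  wedge u (fun S => \sum_(i | P i) F i S) S = \sum_(i | P i) wedge u (F i) S.
Proof.
rewrite exchange_big /=; apply: eq_bigr => i _.
by rewrite mulr_sumr; apply: eq_bigr => j _; ring.
Qed.

Lemma contract_sum_coef (I : finType) (P : pred I) (a : I -> R) (t : I -> 'I_w -> R) c S :
  contract (fun i => \sum_(k | P k) a k * t k i) c S =
  \sum_(k | P k) a k * contract (t k) c S.
Proof.
under [RHS]eq_bigr do rewrite mulr_sumr.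
rewrite [RHS]exchange_big /=; apply: eq_bigr => i _.
by rewrite mulr_sumr mulr_suml; apply: eq_bigr => j _; ring.
Qed.

End KoszulLinearity.

(** * Eagon-Northcott complexes *)

Section EagonNorthcott.
Variables (R : comNzRingType) (q w : nat) (Phi : 'I_q -> 'I_w -> R).
Implicit Types (x y : {set 'I_w} -> R) (S : {set 'I_w}) (s : seq 'I_q).
Implicit Types (c : 'X_{1..q} -> {set 'I_w} -> R) (a : 'X_{1..q}).

(* A chain of level n of the Eagon-Northcott complex of the q x w matrix Phi is a family c a S with
   |S| = q + n and a of degree n, the exponent of a divided power; from level 0, theta along all
   rows maps onto the ideal of maximal minors. *)
Definition enD c a S : R := \sum_(k < q) contract (Phi k) (c (a + U_(k))%MM) S.

Definition theta s x : {set 'I_w} -> R := foldr (fun k y => contract (Phi k) y) x s.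

Lemma eq_theta s x y : x =1 y -> theta s x =1 theta s y.
Proof. by move=> e; elim: s => //= k s IH; apply: eq_contract. Qed.

Lemma enDB c c' a S :
  enD (fun a S => c a S - c' a S) a S = enD c a S - enD c' a S.
Proof. by rewrite -sumrB; apply: eq_bigr => k _; rewrite contractB. Qed.

Lemma enDD c c' a S :
  enD (fun a S => c a S + c' a S) a S = enD c a S + enD c' a S.
Proof. by rewrite -big_split; apply: eq_bigr => k _; rewrite contractD. Qed.

Lemma enDZ b c a S : enD (fun a S => b * c a S) a S = b * enD c a S.
Proof. by rewrite mulr_sumr; apply: eq_bigr => k _; rewrite contractZ. Qed.

Lemma thetaD s x y S : theta s (fun S => x S + y S) S = theta s x S + theta s y S.
Proof.
elim: s S => //= k s IH S; rewrite -contractD.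
by apply: eq_contract => S'; rewrite IH.
Qed.

Lemma thetaZ s b x S : theta s (fun S => b * x S) S = b * theta s x S.
Proof.
elim: s S => //= k s IH S; rewrite -contractZ.
by apply: eq_contract => S'; rewrite IH.
Qed.

Lemma theta_sum (I : finType) (P : pred I) s (F : I -> {set 'I_w} -> R) S :
  theta s (fun S => \sum_(i | P i) F i S) S = \sum_(i | P i) theta s (F i) S.
Proof.
elim: s S => //= k s IH S; rewrite -contract_sum.
by apply: eq_contract => S'; rewrite IH.
Qed.

Lemma contract_theta s k x : k \in s -> contract (Phi k) (theta s x) =1 fun=> 0.
Proof.
elim: s => //= l s IH; rewrite inE => /predU1P[->|ks] S.
  exact: contract_contract.
rewrite contract_anticomm (eq_contract _ (IH ks)) contract0; exact: oppr0.
Qed.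

Lemma theta_contract k s x : k \in s -> theta s (contract (Phi k) x) =1 fun=> 0.
Proof.
elim: s => //= l s IH; rewrite inE => /predU1P[->|ks] S; last first.
  by rewrite (eq_contract _ (IH ks)) contract0.
have E : theta s (contract (Phi l) x) =1
    fun S => (-1) ^+ size s * contract (Phi l) (theta s x) S.
  elim: s {IH} => [|j s IH] /= S'; first by rewrite mul1r.
  by rewrite (eq_contract _ IH) contractZ contract_anticomm exprS; ring.
by rewrite (eq_contract _ E) contractZ contract_contract mulr0.
Qed.

Lemma theta_enD c a S : theta (enum 'I_q) (enD c a) S = 0.
Proof.
rewrite theta_sum big1 // => k _.
by rewrite theta_contract // mem_enum.
Qed.

Lemma enD_enD c a S : enD (enD c) a S = 0.
Proof.
rewrite /enD; under eq_bigr do rewrite contract_sum.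
apply: (@sum_alternating _ _ _ _ (fun i j : 'I_q => (i < j)%N)) => [i j _ _ ij|i _|i j _ _ ij].
- by rewrite -leqNgt ltn_neqAle ij.
- exact: contract_contract.
by rewrite contract_anticomm; congr (- contract _ (contract _ (c _)) _); rewrite -!addmA [(U_(i) + _)%MM]addmC.
Qed.

Section Nilpotency.
Variables (Psi : 'I_q -> 'I_w -> R) (F : R).
Hypothesis PhiPsi : forall k l, \sum_i Phi k i * Psi l i = F *+ (k == l).

Let clifford k l x S : contract (Phi k) (wedge (Psi l) x) S =
  F *+ (k == l) * x S - wedge (Psi l) (contract (Phi k) x) S.
Proof. by rewrite -PhiPsi -wedge_contract; ring. Qed.

(** A homotopy in the direction of row k, built from a right inverse Psi of Phi up to the factor F.
    What it misses is [proj0 k], which is concentrated on exponents with a k = 0. *)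
Definition raise k c a : {set 'I_w} -> R :=
  if (0 < a k)%N then wedge (Psi k) (c (a - U_(k))%MM) else fun=> 0.

Definition proj0 k c a : {set 'I_w} -> R :=
  if (0 < a k)%N then fun=> 0 else wedge (Psi k) (contract (Phi k) (c a)).

(** For l = k the Clifford relation produces F c; for l <> k it produces only a sign, and these
    terms cancel against [raise k (enD c)]. When a k = 0 that summand is absent and the wedge of the
    contraction of c a remains. *)
Lemma raise_homotopy k c a S :
  enD (raise k c) a S + raise k (enD c) a S = F * c a S - proj0 k c a S.
Proof.
rewrite /raise /proj0.
have Ek : (0 < (a + U_(k))%MM k)%N by rewrite mnmDE mnmE eqxx addn1.
rewrite {1}/enD (bigD1 k) //= Ek addmK clifford eqxx mulr1n.
have El l : l != k -> (a + U_(l))%MM k = a k.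
  by move=> lk; rewrite mnmDE mnmE (negbTE lk) addn0.
case: ifP => ak; last first.
  rewrite big1 => [|l lk]; last by rewrite El // ak contract0.
  by rewrite !addr0.
rewrite subr0 -[RHS]addr0 -!addrA; congr (_ + _).
rewrite /enD wedge_sum [X in _ + (_ + X)](bigD1 k) //= submK; last first.
  by rewrite lep1mP -lt0n.
rewrite addrCA [X in _ + X]addrA addNr add0r -big_split /= big1 // => l lk.
rewrite El // ak clifford (negbTE lk) mulr0n mul0r sub0r.
rewrite (_ : (a - U_(k) + U_(l) = a + U_(l) - U_(k))%MM) ?addNr //.
by rewrite addmC addmBA ?lep1mP -?lt0n // addmC.
Qed.

Definition projs s c : 'X_{1..q} -> {set 'I_w} -> R := foldr proj0 c s.

Lemma enD_proj0 k c : (forall a S, enD c a S = 0) ->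
  forall a S, enD (proj0 k c) a S = 0.
Proof.
move=> dc a S.
have E a' S' : proj0 k c a' S' = F * c a' S' - enD (raise k c) a' S'.
  have := raise_homotopy k c a' S'.
  have -> : raise k (enD c) a' S' = 0.
    rewrite /raise; case: ifP => // _; rewrite -(wedge0 (Psi k) S').
    by apply: eq_wedge => S''; rewrite dc.
  by rewrite addr0 => ->; ring.
rewrite (_ : proj0 k c = fun a S => F * c a S - enD (raise k c) a S); last first.
  by apply: functional_extensionality => a'; apply: functional_extensionality => S'.
by rewrite enDB enDZ dc enD_enD mulr0 subr0.
Qed.

Lemma projs_homotopy s c : (forall a S, enD c a S = 0) ->
  (forall a S, enD (projs s c) a S = 0) /\
  exists b, forall a S, F ^+ size s * c a S - projs s c a S = enD b a S.
Proof.
move=> dc; elim: s => [|k s [dp [b Hb]]] /=.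
  split=> //; exists (fun _ _ => 0) => a S.
  by rewrite mul1r subrr; apply/esym/big1 => k _; rewrite contract0.
split; first exact: enD_proj0.
exists (fun a S => F * b a S + raise k (projs s c) a S) => a S.
rewrite enDD enDZ -Hb; have := raise_homotopy k (projs s c) a S.
have -> : raise k (enD (projs s c)) a S = 0.
  rewrite /raise; case: ifP => // _; rewrite -(wedge0 (Psi k) S).
  by apply: eq_wedge => S''; rewrite dp.
by rewrite addr0 exprS => ->; ring.
Qed.

Lemma projs_eq0 s c a S l : l \in s -> (0 < a l)%N -> projs s c a S = 0.
Proof.
elim: s a S => //= k s IH a S; rewrite inE /proj0 => /predU1P[<- -> //|ls] al.
case: ifP => // _; rewrite -(wedge0 (Psi k) S); apply: eq_wedge => S'.
by rewrite -(contract0 (Phi k) S'); apply: eq_contract => S''; apply: IH.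
Qed.

Lemma contract_wedges k s x S : k \notin s ->
  contract (Phi k) (foldr (fun l y => wedge (Psi l) y) x s) S =
  (-1) ^+ size s * foldr (fun l y => wedge (Psi l) y) (contract (Phi k) x) s S.
Proof.
elim: s S => [|l s IH] S /=; first by rewrite mul1r.
rewrite inE negb_or => /andP[kl ks].
rewrite clifford (negbTE kl) mulr0n mul0r sub0r (@eq_wedge _ _ _ _ _ (fun S => IH S ks)).
by rewrite wedgeZ exprS; ring.
Qed.

(** Moving each contraction inside past the wedges with the other rows collects the contractions
    into [theta]. Hence the composite projection vanishes on the kernel of [theta]. *)
Lemma projs_theta s c : uniq s -> exists e, forall S,
  projs s c 0%MM S =
  e * foldr (fun l y => wedge (Psi l) y) (theta s (c 0%MM)) s S.
Proof.
elim: s => [|k s IH] /=; first by exists 1 => S; rewrite mul1r.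
case/andP=> ks /IH[e He].
exists (e * (-1) ^+ size s) => S; rewrite /proj0 mnm0E ltnn.
rewrite -mulrA -2!wedgeZ; apply: eq_wedge => S'.
by rewrite (eq_contract _ He) contractZ contract_wedges.
Qed.

(** Projecting along every row leaves only the exponent 0, where a chain of positive level is
    zero. *)
Lemma enD_nilpotent c n : (0 < n)%N -> (forall a S, mdeg a != n -> c a S = 0) ->
  (forall a S, enD c a S = 0) ->
  exists b, forall a S, F ^+ q * c a S = enD b a S.
Proof.
move=> n0 cn dc; have [_ [b Hb]] := projs_homotopy (enum 'I_q) dc.
exists b => a S; rewrite -Hb size_enum_ord.
suff -> : projs (enum 'I_q) c a S = 0 by rewrite subr0.
have [->|a0] := eqVneq a 0%MM.
  elim: (enum 'I_q) S => [|k s IH] S /=; first by rewrite cn // mdeg0 eq_sym -lt0n.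
  rewrite /proj0 mnm0E ltnn -(wedge0 (Psi k) S); apply: eq_wedge => S'.
  by rewrite -(contract0 (Phi k) S'); apply: eq_contract.
have /existsP[l al] : [exists l, a l != 0%N].
  apply: contraR a0 => /existsPn h; apply/eqP/mnmP => i; rewrite mnm0E.
  by apply/eqP; have := h i; rewrite negbK.
by apply: (@projs_eq0 _ _ _ _ l); rewrite ?mem_enum // lt0n.
Qed.

Lemma theta_nilpotent c : (forall a S, mdeg a != 0%N -> c a S = 0) ->
  (forall S, theta (enum 'I_q) (c 0%MM) S = 0) ->
  exists b, forall S, F ^+ q * c 0%MM S = enD b 0%MM S.
Proof.
move=> c0 dc.
have dc0 a S : enD c a S = 0.
  apply: big1 => k _; rewrite -(contract0 (Phi k) S); apply: eq_contract => S'.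
  by rewrite c0 // mdegD mdeg1 addn1.
have [_ [b Hb]] := projs_homotopy (enum 'I_q) dc0.
exists b => S; rewrite -Hb size_enum_ord.
have [e ->] := projs_theta c (enum_uniq 'I_q).
rewrite (_ : foldr _ _ _ S = 0) ?mulr0 ?subr0 //.
elim: (X in foldr _ _ X) S => [|k s IH] S //=.
by rewrite -(wedge0 (Psi k) S); apply: eq_wedge.
Qed.

End Nilpotency.

Section Triangular.
Variables (Psi : 'I_q -> 'I_w -> R) (g : 'I_q -> 'I_q -> R).
Hypothesis PhiPsi : forall k l, \sum_i Phi k i * Psi l i = g k l.
Hypothesis g_triangular : forall k l : 'I_q, (l < k)%N -> g k l = 0.

Definition wedges s : {set 'I_w} -> R :=
  foldl (fun x k => wedge (Psi k) x) (fun S => (S == set0)%:R) s.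

Lemma contract_wedges0 k s S : all (fun l => g k l == 0) s ->
  contract (Phi k) (wedges s) S = 0.
Proof.
elim/last_ind: s S => [|s l IH] S.
  move=> _; apply: big1 => i _; rewrite /wedges /= (_ : (i |: S == set0) = false) ?mulr0 //.
  by apply/negbTE/set0Pn; exists i; rewrite setU11.
rewrite all_rcons => /andP[/eqP gkl gs].
have := wedge_contract (Phi k) (Psi l) (wedges s) S.
rewrite PhiPsi gkl mul0r /wedges foldl_rcons /= -/(wedges s).
rewrite (eq_wedge _ (fun S => IH S gs)) wedge0 addr0; exact.
Qed.

(** A Cauchy-Binet argument without determinants: the last row of Phi meets the wedge with the last
    row of Psi first and gives g k k, while its pairings with the earlier rows vanish. Thus the
    product of the diagonal lies in the ideal of maximal minors. *)
Lemma theta_wedges : theta (enum 'I_q) (wedges (enum 'I_q)) set0 = \prod_k g k k.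
Proof.
rewrite -[RHS]big_enum /=.
have : sorted (fun k l : 'I_q => (k < l)%N) (enum 'I_q).
  have := iota_ltn_sorted 0 q; rewrite -val_enum_ord.
  by rewrite sorted_map; apply.
elim/last_ind: (enum 'I_q) => [|s k IH] ss.
  by rewrite big_nil /wedges /= eqxx.
have /andP[ks ss'] : all (fun l : 'I_q => (l < k)%N) s && sorted (fun k l : 'I_q => (k < l)%N) s.
  have tr : transitive (fun k l : 'I_q => (k < l)%N) by move=> ? ? ?; apply: ltn_trans.
  move: ss; rewrite !sorted_pairwise // -cats1 pairwise_cat /= andbT => /andP[h ->].
  by rewrite andbT; move: h; rewrite allrel1r.
rewrite big_rcons /= -IH // mulrC /theta foldr_rcons.
rewrite -[RHS]thetaZ; apply: eq_theta => S.
rewrite /wedges foldl_rcons -/(wedges s).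
have := wedge_contract (Phi k) (Psi k) (wedges s) S.
rewrite PhiPsi; rewrite (@eq_wedge _ _ _ (contract _ _) (fun=> 0)) ?wedge0 ?addr0 //.
move=> S'; apply: contract_wedges0; apply: sub_all ks => l lk.
by rewrite g_triangular.
Qed.

End Triangular.
End EagonNorthcott.

(** * Killing variables *)

Section MPolyMorphisms.
Variables (K : fieldType) (r : nat).
Local Notation A := {mpoly K[r]}.

Lemma mpoly_rmorphism_ext (S : comNzRingType) (f g : {rmorphism A -> S}) :
  (forall c, f c%:MP = g c%:MP) -> (forall i, f 'X_i = g 'X_i) -> f =1 g.
Proof.
move=> fgC fgX p; rewrite [p]mpolyE !rmorph_sum; apply: eq_bigr => m _.
rewrite -mul_mpolyC !rmorphM fgC mpolyXE_id !rmorph_prod; congr (_ * _).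
by apply: eq_bigr => i _; rewrite !rmorphXn /= fgX.
Qed.

Lemma dhomogX_U (i : 'I_r) : ('X_i : A) \is 1.-homog.
Proof. by rewrite dhomogX /= mdeg1. Qed.

Lemma graded_pihomog (r' d e : nat) (T : A -> {mpoly K[r']}) (p : A) :
  T 0 = 0 -> {morph T : x y / x + y} ->
  (forall n p', p' \is n.-homog -> T p' \is (e + n).-homog) ->
  pihomog mdeg (e + d) (T p) = T (pihomog mdeg d p).
Proof.
move=> T0 TD HT; set N := maxn d.+1 (mmeasure mdeg p); set rhs := RHS.
rewrite (@pihomog_partitionE _ _ mdeg N p) ?leq_maxr // (big_morph T TD T0) raddf_sum /=.
rewrite (bigD1 (Ordinal (leq_maxl d.+1 (mmeasure mdeg p)))) //=.
rewrite pihomog_dE ?HT ?pihomogP // big1 ?addr0 // => j jd {rhs}.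
rewrite (@pihomog_ne0 _ _ _ (e + j)) ?HT ?pihomogP //.
by rewrite eqn_add2l; apply: contraNneq jd => jd; apply/eqP/val_inj.
Qed.

Lemma pihomogM e d (p q : A) : p \is e.-homog ->
  pihomog mdeg (e + d) (p * q) = p * pihomog mdeg d q.
Proof.
move=> hp; apply: (@graded_pihomog _ _ _ ( *%R p)) => [|x y|n p' hp'].
- exact: mulr0.
- exact: mulrDr.
exact: dhomogM.
Qed.

Lemma dhomog_comp r' (e d : nat) (t : r.-tuple {mpoly K[r']}) (p : A) :
  (forall i, tnth t i \is e.-homog) -> p \is d.-homog -> p \mPo t \is (e * d).-homog.
Proof.
move=> ht hp; rewrite comp_mpolyEX big_seq; apply: rpred_sum => m mp.
apply: rpredZ.
have /= <- := dhomog_mf hp mp.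
rewrite comp_mpolyX mdegE big_distrr /=.
elim: (index_enum _) => [|i s IH]; first by rewrite !big_nil dhomog1.
by rewrite !big_cons; apply: dhomogM => //; apply: dhomogMn.
Qed.

End MPolyMorphisms.

Section KillVariables.
Variables (K : fieldType) (r : nat).
Local Notation A := {mpoly K[r]}.
Implicit Types (X Y : {set 'I_r}) (p : A).

(** Congruence modulo the variables in X becomes the equation [kill X p = 0]; the quotient ring is
    realised inside A as the image of an idempotent substitution. *)
Definition kill X : A -> A :=
  comp_mpoly [tuple if i \in X then 0 else 'X_i | i < r].

HB.instance Definition _ X := GRing.RMorphism.on (kill X).

Lemma killX X i : kill X 'X_i = if i \in X then 0 else 'X_i.
Proof. by rewrite /kill comp_mpolyXU -tnth_nth tnth_mktuple. Qed.

Lemma killC X c : kill X c%:MP = c%:MP.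
Proof. exact: comp_mpolyC. Qed.

Lemma kill_kill X Y p : kill X (kill Y p) = kill (X :|: Y) p.
Proof.
apply: (@mpoly_rmorphism_ext _ _ _ (GRing.RMorphism.clone _ _ (kill X \o kill Y) _) (kill (X :|: Y))).
  by move=> c /=; rewrite !killC.
move=> i /=; rewrite !killX inE; case: (i \in Y); rewrite ?orbT ?rmorph0 ?orbF //.
by rewrite killX.
Qed.

Lemma kill_homog X d p : p \is d.-homog -> kill X p \is d.-homog.
Proof.
move=> hp; rewrite -[d]mul1n; apply: dhomog_comp => // i.
by rewrite tnth_mktuple; case: ifP => _; [apply: dhomog0 | apply: dhomogX_U].
Qed.

Lemma kill_pihomog X d p : kill X (pihomog mdeg d p) = pihomog mdeg d (kill X p).
Proof.
rewrite -(@graded_pihomog _ _ _ d 0) ?rmorph0 // => [x y|n p'].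
  exact: rmorphD.
exact: kill_homog.
Qed.

Lemma killT d p : (0 < d)%N -> p \is d.-homog -> kill [set: 'I_r] p = 0.
Proof.
move=> d0 hp; rewrite /kill comp_mpolyEX big_seq big1 // => m mp.
have /= md := dhomog_mf hp mp.
have [i mi] : exists i, m i != 0%N.
  apply/existsP; move: d0; rewrite -md; apply: contraTT => /existsPn h.
  rewrite -leqNgt leqn0 mdegE; apply/eqP/big1 => i _.
  by apply/eqP; have := h i; rewrite negbK.
rewrite comp_mpolyX (bigD1 i) //= tnth_mktuple inE expr0n (negbTE mi) mul0r.
exact: scaler0.
Qed.

Lemma kill1_split i p : exists g, p = kill [set i] p + 'X_i * g.
Proof.
elim/mpolyind: p => [|c m p _ _ [g Hg]]; first by exists 0; rewrite rmorph0 mulr0 addr0.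
have [h Hh] : exists h, 'X_[m] = kill [set i] 'X_[m] + 'X_i * h.
  have [mi|mi] := eqVneq (m i) 0%N.
    exists 0; rewrite mulr0 addr0 /kill comp_mpolyX [LHS]mpolyXE_id.
    apply: eq_bigr => j _; rewrite tnth_mktuple inE.
    by case: eqVneq => [->|//]; rewrite mi !expr0.
  exists 'X_[m - U_(i)].
  have -> : 'X_[m] = 'X_i * 'X_[m - U_(i)] :> A.
    by rewrite -mpolyXD addmC submK ?lep1mP.
  by rewrite rmorphM /= killX inE eqxx mul0r add0r.
exists (c *: h + g); rewrite rmorphD /= {1}Hg {1}Hh.
by rewrite -!mul_mpolyC rmorphM /= killC; ring.
Qed.

Lemma kill0 p : kill set0 p = p.
Proof.
apply: (@mpoly_rmorphism_ext _ _ _ (kill set0) (GRing.RMorphism.clone _ _ idfun _)) => [c|i] /=.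
  exact: killC.
by rewrite killX inE.
Qed.

Lemma killU1_divides i X p : kill (i |: X) p = 0 -> exists g, kill X (p - 'X_i * g) = 0.
Proof.
rewrite -kill_kill; have [g Hg] := kill1_split i (kill X p) => E.
exists g; move: Hg; rewrite E add0r => Hg.
have := congr1 (kill X) Hg; rewrite kill_kill setUid => {}Hg.
by rewrite rmorphB /= Hg subrr.
Qed.

Lemma kill_sub X Y p : X \subset Y -> kill X p = 0 -> kill Y p = 0.
Proof. by move=> XY h; rewrite -(setUidPl XY) -kill_kill h rmorph0. Qed.

Lemma Xneq0 i : 'X_i != 0 :> A.
Proof.
apply/eqP => /(congr1 (mcoeff U_(i))) /eqP.
by rewrite mcoeffX eqxx mcoeff0 oner_eq0.
Qed.

Lemma kill_reg i X p : i \notin X -> kill X ('X_i * p) = 0 -> kill X p = 0.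
Proof.
move=> iX; rewrite rmorphM /= killX (negbTE iX) => /eqP.
by rewrite mulf_eq0 (negbTE (Xneq0 i)) /= => /eqP.
Qed.

Lemma dhomogXM i d (p : A) : p \is d.-homog -> 'X_i * p \is d.+1.-homog.
Proof. by move=> hp; apply: (dhomogM (dhomogX_U _ i) hp). Qed.

Lemma pihomogM1 d (p q : A) : p \is 1.-homog ->
  pihomog mdeg d.+1 (p * q) = p * pihomog mdeg d q.
Proof. by move=> hp; apply: (pihomogM _ _ hp). Qed.

Lemma pihomogX i d p : pihomog mdeg d.+1 ('X_i * p) = 'X_i * pihomog mdeg d p.
Proof. exact: pihomogM1 (dhomogX_U _ _). Qed.

End KillVariables.

Section KoszulRmorphism.
Variables (R R' : comNzRingType) (w : nat) (h : {rmorphism R -> R'}).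

Lemma rmorph_contract (t : 'I_w -> R) c S :
  h (contract t c S) = contract (h \o t) (h \o c) S.
Proof.
rewrite rmorph_sum; apply: eq_bigr => i _ /=.
by rewrite !rmorphM rmorphXn rmorphN1.
Qed.

Lemma rmorph_wedge (t : 'I_w -> R) c S :
  h (wedge t c S) = wedge (h \o t) (h \o c) S.
Proof.
rewrite rmorph_sum; apply: eq_bigr => i _ /=.
by rewrite !rmorphM rmorphXn rmorphN1.
Qed.

Lemma rmorph_enD q (Phi : 'I_q -> 'I_w -> R) c a S :
  h (enD Phi c a S) = enD (fun k => h \o Phi k) (fun a => h \o c a) a S.
Proof. by rewrite rmorph_sum; apply: eq_bigr => k _; rewrite rmorph_contract. Qed.

Lemma rmorph_theta q (Phi : 'I_q -> 'I_w -> R) s x S :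
  h (theta Phi s x S) = theta (fun k => h \o Phi k) s (h \o x) S.
Proof.
elim: s S => //= k s IH S; rewrite rmorph_contract.
by apply: eq_contract => S'; rewrite -IH.
Qed.

Lemma rmorph_wedges q (Psi : 'I_q -> 'I_w -> R) s S :
  h (wedges Psi s S) = wedges (fun k => h \o Psi k) s S.
Proof.
elim/last_ind: s S => [|s k IH] S; first by rewrite /wedges /= rmorph_nat.
rewrite /wedges !foldl_rcons -/(wedges _ _) rmorph_wedge.
by apply: eq_wedge => S' /=; rewrite IH.
Qed.

End KoszulRmorphism.

Section KoszulSupport.
Variables (R : comNzRingType) (w : nat).

Lemma contract_card (t : 'I_w -> R) (c c' : {set 'I_w} -> R) (S : {set 'I_w}) :
  (forall S' : {set 'I_w}, #|S'| = #|S|.+1 -> c S' = c' S') -> contract t c S = contract t c' S.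
Proof.
by move=> e; apply: eq_bigr => i iS; rewrite e // cardsU1 iS.
Qed.

Lemma theta_card q (Phi : 'I_q -> 'I_w -> R) s x y (S : {set 'I_w}) :
  (forall S' : {set 'I_w}, #|S'| = (#|S| + size s)%N -> x S' = y S') ->
  theta Phi s x S = theta Phi s y S.
Proof.
elim: s S => [|k s IH] S e; first by apply: e; rewrite addn0.
by apply: (@contract_card (Phi k)) => S' cS'; apply: IH => S'' cS''; apply: e; rewrite cS'' cS' /= addnS.
Qed.

End KoszulSupport.

(** * Exactness of linear Eagon-Northcott complexes *)

Section LinearEagonNorthcott.
Variables (K : fieldType) (r q w : nat).
Local Notation A := {mpoly K[r]}.
Variable Phi : 'I_q -> 'I_w -> A.
Hypothesis Phi_lin : forall k i, Phi k i \is 1.-homog.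
Implicit Types (X : {set 'I_r}) (S : {set 'I_w}).
Implicit Types (c b : 'X_{1..q} -> {set 'I_w} -> A) (x : {set 'I_w} -> A).

Lemma pihomog_contract k u x S :
  pihomog mdeg u.+1 (contract (Phi k) x S) =
  contract (Phi k) (fun S => pihomog mdeg u (x S)) S.
Proof.
rewrite raddf_sum; apply: eq_bigr => i _ /=.
have -> : ksg A S i * Phi k i * x (i |: S) = (Phi k i * (ksg A S i * x (i |: S))) by ring.
rewrite pihomogM1 //.
have [->|->] : ksg A S i = 1 \/ ksg A S i = -1.
  by rewrite /ksg -signr_odd; case: odd; [right | left].
  by rewrite !mul1r.
by rewrite !mulN1r raddfN /=; ring.
Qed.

Lemma pihomog_enD u b a S :
  pihomog mdeg u.+1 (enD Phi b a S) =
  enD Phi (fun a S => pihomog mdeg u (b a S)) a S.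
Proof. by rewrite raddf_sum; apply: eq_bigr => k _ /=; rewrite -pihomog_contract. Qed.

Lemma pihomog_theta u s x S :
  pihomog mdeg (size s + u) (theta Phi s x S) =
  theta Phi s (fun S => pihomog mdeg u (x S)) S.
Proof.
elim: s S => //= k s IH S; rewrite addSn pihomog_contract.
by apply: eq_contract => S'; rewrite IH.
Qed.

(** The general element of the ideal of maximal minors, x being its vector of coefficients. *)
Definition ideal_rep x : A := theta Phi (enum 'I_q) x set0.

Lemma enD_level n b b' a S :
  (forall a S, mdeg a = n.+1 -> #|S| = (q + n.+1)%N -> b a S = b' a S) ->
  mdeg a = n -> #|S| = (q + n)%N -> enD Phi b a S = enD Phi b' a S.
Proof.
move=> e an Sn; apply: eq_bigr => k _; apply: contract_card => S' cS'.
by apply: e; rewrite ?cS' ?Sn ?addnS // mdegD mdeg1 addn1 an.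
Qed.

Definition trunc n c a S : A :=
  if (mdeg a == n) && (#|S| == q + n)%N then c a S else 0.

Lemma truncE n c a S : mdeg a = n -> #|S| = (q + n)%N -> trunc n c a S = c a S.
Proof. by rewrite /trunc => -> ->; rewrite !eqxx. Qed.

(** The complex is augmented by the ideal of minors: cycles of level 0 are the syzygies of the
    minors modulo X. *)
Definition cycle_mod X n c : Prop :=
  if n is n'.+1 then
    forall a S, mdeg a = n' -> #|S| = (q + n')%N -> kill X (enD Phi c a S) = 0
  else kill X (ideal_rep (c 0%MM)) = 0.

(** Restricting to positive degree u lets the induction start at X = all variables, where forms of
    positive degree vanish. *)
Definition acyclic_mod X n : Prop := forall u c, (0 < u)%N ->
  (forall a S, mdeg a = n -> #|S| = (q + n)%N -> c a S \is u.-homog) ->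
  cycle_mod X n c ->
  exists b, forall a S, mdeg a = n -> #|S| = (q + n)%N ->
    kill X (c a S - enD Phi b a S) = 0.

Lemma choose_quotient i X (P : 'X_{1..q} -> {set 'I_w} -> Prop) (c : 'X_{1..q} -> {set 'I_w} -> A) :
  (forall a S, P a S -> kill (i |: X) (c a S) = 0) ->
  exists g, forall a S, P a S -> kill X (c a S - 'X_i * g a S) = 0.
Proof.
move=> h.
have H a S : exists g : A, (kill (i |: X) (c a S) == 0) ==>
    (kill X (c a S - 'X_i * g) == 0).
  have [/eqP|_] := boolP (_ == 0); last by exists 0.
  by case/killU1_divides => g Hg; exists g; rewrite Hg eqxx.
exists (fun a S => xchoose (H a S)) => a S PaS.
by have /implyP/(_ (introT eqP (h a S PaS)))/eqP := xchooseP (H a S).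
Qed.

(** The piece H_(n+1)(C/x_i C) -> H_n(C) -> H_n(C) of the long exact sequence of multiplication by
    x_i, where C is the complex modulo X: if the first term vanishes, x_i is injective. *)
Lemma enD_var_injective i X n u c b : i \notin X -> (0 < u)%N ->
  acyclic_mod (i |: X) n.+1 ->
  (forall a S, mdeg a = n -> #|S| = (q + n)%N -> c a S \is u.-homog) ->
  (forall a S, mdeg a = n -> #|S| = (q + n)%N ->
    kill X ('X_i * c a S - enD Phi b a S) = 0) ->
  exists b, forall a S, mdeg a = n -> #|S| = (q + n)%N ->
    kill X (c a S - enD Phi b a S) = 0.
Proof.
move=> iX u0 acyc hc hb.
(* Since Phi is linear, only the part of b of level n + 1 and degree u contributes to x_i c. *)
pose b' := trunc n.+1 (fun a S => pihomog mdeg u (b a S)).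
have hb' a S : mdeg a = n -> #|S| = (q + n)%N ->
    kill X ('X_i * c a S - enD Phi b' a S) = 0.
  move=> an Sn; rewrite (@enD_level n _ (fun a S => pihomog mdeg u (b a S))) //; last first.
    exact: truncE.
  have := congr1 (pihomog mdeg u.+1) (hb a S an Sn).
  rewrite pihomog0 -kill_pihomog pihomogB pihomogX pihomog_enD.
  by rewrite (pihomog_dE (hc a S an Sn)).
have [||b2 hb2] := acyc u b' u0.
- by move=> a S an Sn; rewrite /b' truncE //; apply: pihomogP.
- move=> a S an Sn; apply/eqP; rewrite -oppr_eq0 -rmorphN; apply/eqP.
  have := kill_sub (subsetUr [set i] X) (hb' a S an Sn).
  by rewrite rmorphB rmorphM /= killX setU11 mul0r sub0r -rmorphN.
have [b3 hb3] := @choose_quotient i X (fun a S => mdeg a = n.+1 /\ #|S| = (q + n.+1)%N)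
  (fun a S => b' a S - enD Phi b2 a S) (fun a S h => hb2 a S h.1 h.2).
exists b3 => a S an Sn; apply: (kill_reg iX).
have := hb' a S an Sn.
have -> : enD Phi b' a S =
    enD Phi (fun a S => (b' a S - enD Phi b2 a S - 'X_i * b3 a S) +
      (enD Phi b2 a S + 'X_i * b3 a S)) a S.
  by congr (enD _ _ _ _); do 2!apply: functional_extensionality => ?; ring.
rewrite enDD enDD enDZ enD_enD add0r => E.
have E0 : kill X (enD Phi (fun a S => b' a S - enD Phi b2 a S - 'X_i * b3 a S) a S) = 0.
  rewrite rmorph_enD; apply: big1 => k _; rewrite -(contract0 (kill X \o Phi k) S).
  apply: contract_card => S' cS' /=; apply: hb3; split.
    by rewrite mdegD mdeg1 addn1 an.
  by rewrite cS' Sn addnS.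
move: E; rewrite opprD addrA rmorphB rmorphB /= E0 subr0 -rmorphB /= => <-.
by rewrite mulrBr.
Qed.

Variable X0 : {set 'I_r}.
Hypothesis q_gt0 : (0 < q)%N.
Hypothesis var_right_inverse : forall i : 'I_r, exists Psi : 'I_q -> 'I_w -> A,
  forall k l, kill X0 (\sum_j Phi k j * Psi l j) = kill X0 ('X_i ^+ 2 *+ (k == l)).

Lemma kill_right_inverse X i : X0 \subset X -> exists Psi : 'I_q -> 'I_w -> A,
  forall k l, \sum_j (kill X \o Phi k) j * (kill X \o Psi l) j =
    (kill X 'X_i ^+ 2) *+ (k == l).
Proof.
move=> X0X; have [Psi HPsi] := var_right_inverse i; exists Psi => k l.
have /eqP := HPsi k l; rewrite -subr_eq0 -rmorphB => /eqP /(kill_sub X0X) /eqP.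
rewrite rmorphB subr_eq0 rmorphMn rmorphXn rmorph_sum => /eqP <-.
by apply: eq_bigr => j _; rewrite -rmorphM.
Qed.

Lemma theta_size_support (Phi' : 'I_q -> 'I_w -> A) x S :
  (forall S, #|S| != q -> x S = 0) -> S != set0 -> theta Phi' (enum 'I_q) x S = 0.
Proof.
move=> x0 S0; rewrite (@theta_card _ _ _ _ _ _ (fun=> 0)).
  rewrite -[RHS](mul0r (theta Phi' (enum 'I_q) (fun=> 0) S)) -thetaZ.
  by apply: eq_theta => S'; rewrite mul0r.
move=> S' cS'; apply: x0; rewrite cS' size_enum_ord -{2}[q]add0n eqn_add2r.
by rewrite cards_eq0.
Qed.

(** A power of x_i annihilates the homology, by nilpotency with F = x_i^2, while x_i acts
    injectively on it. *)
Lemma acyclic_step i X n : X0 \subset X -> i \notin X ->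
  acyclic_mod (i |: X) n.+1 -> acyclic_mod X n.
Proof.
move=> X0X iX acyc u c u0 hc dc.
have [Psi HPsi] := kill_right_inverse i X0X.
pose kPhi k := kill X \o Phi k.
pose kc a := kill X \o trunc n c a.
have [b Hb] : exists b, forall a S, mdeg a = n -> #|S| = (q + n)%N ->
    (kill X 'X_i ^+ 2) ^+ q * kc a S = enD kPhi b a S.
  case: n @kc dc {acyc hc} => [|n] kc dc.
    have [||b Hb] := @theta_nilpotent _ _ _ kPhi _ _ HPsi kc.
    - by move=> a S a0; rewrite /kc /= /trunc (negbTE a0) rmorph0.
    - move=> S; have [->|S0] := eqVneq S set0.
        rewrite -[RHS]dc.
        rewrite rmorph_theta; apply: theta_card => S' cS' /=.
        by rewrite /kc /= truncE ?mdeg0 // cS' cards0 size_enum_ord addn0.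
      apply: theta_size_support S0 => S' cS'.
      by rewrite /kc /= /trunc addn0 (negbTE cS') andbF rmorph0.
    exists b => a S a0 _.
    by have -> : a = 0%MM by apply/eqP; rewrite -mdeg_eq0 a0.
  have [//|||b Hb] := @enD_nilpotent _ _ _ kPhi _ _ HPsi kc n.+1.
  - by move=> a S an; rewrite /kc /= /trunc (negbTE an) rmorph0.
  - move=> a S; have -> : enD kPhi kc a S = kill X (enD Phi (trunc n.+1 c) a S).
      by rewrite rmorph_enD.
    have [/eqP an|an] := boolP (mdeg a == n); last first.
      rewrite (_ : enD _ _ _ _ = 0) ?rmorph0 //; apply: big1 => k _.
      rewrite -(contract0 (Phi k) S); apply: eq_contract => S'.
      by rewrite /trunc mdegD mdeg1 addn1 eqSS (negbTE an).
    have [/eqP Sn|Sn] := boolP (#|S| == q + n)%N; last first.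
      rewrite (_ : enD _ _ _ _ = 0) ?rmorph0 //; apply: big1 => k _.
      rewrite -(contract0 (Phi k) S); apply: contract_card => S' cS'.
      by rewrite /trunc cS' addnS eqSS (negbTE Sn) andbF.
    by rewrite (@enD_level n _ c) ?dc // => a' S' an' Sn'; rewrite truncE.
  by exists b => a S _ _; rewrite -Hb.
have {}Hb a S : mdeg a = n -> #|S| = (q + n)%N ->
    kill X ('X_i ^+ (2 * q) * c a S - enD Phi b a S) = 0.
  move=> an Sn; rewrite rmorphB rmorphM rmorphXn /= exprM.
  have := congr1 (kill X) (Hb a S an Sn).
  rewrite /kc /= truncE // rmorphM !rmorphXn /= !kill_kill !setUid => ->.
  rewrite !rmorph_enD (_ : (fun k => _) = fun k => kill X \o Phi k) ?subrr //.
  by do 2!apply: functional_extensionality => ?; rewrite /kPhi /= kill_kill setUid.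
elim: (2 * q)%N b Hb => [|j IH] b Hb.
  by exists b => a S an Sn; rewrite -[c a S]mul1r Hb.
have [|||b' Hb'] := @enD_var_injective i X n (j + u) (fun a S => 'X_i ^+ j * c a S) b iX _ acyc.
- by rewrite addn_gt0 u0 orbT.
- move=> a S an Sn; apply: dhomogM; last exact: hc.
  by rewrite -{2}[j]mul1n; apply: dhomogMn; apply: dhomogX_U.
- by move=> a S an Sn; rewrite mulrA -exprS Hb.
exact: IH Hb'.
Qed.

(** Induction on the number of variables outside X. Adding a variable to X raises the level, so the
    induction hypothesis is kept for all levels. *)
Lemma acyclic X n : X0 \subset X -> acyclic_mod X n.
Proof.
move: {2}#|~: X| (leqnn #|~: X|) => m; elim: m X n => [|m IH] X n cX X0X.
  have -> : X = setT.
    by apply/eqP; rewrite -subTset -setCS setCT subset0 -cards_eq0 -leqn0.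
  move=> u c u0 hc _; exists (fun _ _ => 0) => a S an Sn.
  rewrite (_ : enD _ _ _ _ = 0); last by apply: big1 => k _; rewrite contract0.
  by rewrite subr0 (killT u0) // hc.
have [XT|] := eqVneq X setT; first by apply: IH => //; rewrite XT setCT cards0.
rewrite eqEsubset subsetT /= => /subsetPn[i _ iX].
apply: (acyclic_step X0X iX); apply: IH; last exact: subset_trans X0X (subsetUr _ _).
rewrite -ltnS; apply: leq_trans cX; rewrite setCU.
by rewrite [X in (_ < X)%N](cardsD1 i) inE iX add1n ltnS setDE setIC.
Qed.

(** The analogue of [enD_var_injective] at the augmentation: exactness at level 0 modulo x_i makes
    x_i injective on A/J. The inclusion is asked of [i |: X], so that X = {T_0} is allowed with [X0]
    = {T_0, T_1}. *)
Lemma ideal_rep_var_injective i X t (p : A) x : i \notin X -> X0 \subset i |: X ->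
  (q <= t)%N -> p \is t.-homog -> kill X ('X_i * p - ideal_rep x) = 0 ->
  exists x', kill X (p - ideal_rep x') = 0.
Proof.
move=> iX X0X qt hp hx.
(* [theta] along q linear rows has degree q, so coefficients of degree t + 1 - q suffice; this is
   positive because q <= t. *)
pose y S := pihomog mdeg (t.+1 - q) (x S).
have ht : (q + (t.+1 - q))%N = t.+1 by rewrite subnKC // leqW.
have hy : kill X ('X_i * p - ideal_rep y) = 0.
  have := congr1 (pihomog mdeg t.+1) hx.
  rewrite pihomog0 -kill_pihomog pihomogB pihomogX (pihomog_dE hp).
  have := pihomog_theta (t.+1 - q) (enum 'I_q) x set0.
  by rewrite size_enum_ord ht => ->.
have [|||b hb] := @acyclic (i |: X) 0 X0X (t.+1 - q)%N (fun _ => y).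
- by rewrite subn_gt0 ltnS.
- by move=> *; apply: pihomogP.
- apply/eqP; rewrite -oppr_eq0 -rmorphN; apply/eqP.
  have := kill_sub (subsetUr [set i] X) hy.
  by rewrite rmorphB rmorphM /= killX setU11 mul0r sub0r -rmorphN.
have [g hg] := @choose_quotient i X (fun a S => mdeg a = 0%N /\ #|S| = (q + 0)%N)
  (fun a S => y S - enD Phi b a S) (fun a S h => hb a S h.1 h.2).
exists (g 0%MM); apply: (kill_reg iX).
move: hy; have -> : ideal_rep y = ideal_rep (fun S => (y S - enD Phi b 0%MM S - 'X_i * g 0%MM S) +
      (enD Phi b 0%MM S + 'X_i * g 0%MM S)).
  by congr ideal_rep; apply: functional_extensionality => ?; ring.
rewrite /ideal_rep thetaD [in X in _ + X]thetaD theta_enD add0r thetaZ.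
have E0 : kill X (theta Phi (enum 'I_q) (fun S => y S - enD Phi b 0%MM S - 'X_i * g 0%MM S) set0) = 0.
  rewrite rmorph_theta (@theta_card _ _ _ _ _ _ (fun S => 0 * 0)) => [|S' cS'].
    by rewrite thetaZ mul0r.
  rewrite /= mul0r; apply: hg; split; first exact: mdeg0.
  by rewrite cS' cards0 size_enum_ord addn0.
by rewrite opprD addrCA rmorphD rmorphN /= E0 oppr0 add0r -mulrBr.
Qed.

(** A right inverse up to x_i^2 puts x_i^(2q) into J modulo X, by [theta_wedges]; the factors x_i
    are then cancelled one by one. *)
Lemma ideal_rep_generic X t (p : A) : X0 \subset X -> (q <= t)%N -> p \is t.-homog ->
  exists x, kill X (p - ideal_rep x) = 0.
Proof.
move=> X0X qt hp; have [XT|] := eqVneq X setT.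
  (* The zero chain, written as a product so that [thetaZ] applies. *)
  exists (fun=> 0 * 0); rewrite /ideal_rep thetaZ mul0r subr0 XT (killT _ hp) //.
  exact: leq_trans qt.
rewrite eqEsubset subsetT /= => /subsetPn[i _ iX].
have X0iX : X0 \subset i |: X by apply: subset_trans X0X (subsetUr _ _).
have [Psi HPsi] := kill_right_inverse i X0X.
have tri : forall k l : 'I_q, (l < k)%N -> (kill X ('X_i : A) ^+ 2) *+ (k == l) = 0.
  by move=> k l lk; rewrite -val_eqE /= (gtn_eqF lk).
have := theta_wedges HPsi tri; under eq_bigr do rewrite eqxx mulr1n.
rewrite prodr_const card_ord => E.
have {E} : exists x, kill X ('X_i ^+ (2 * q) * p - ideal_rep x) = 0.
  exists (fun S => p * wedges Psi (enum 'I_q) S).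
  have {}E : kill X (ideal_rep (wedges Psi (enum 'I_q))) = (kill X 'X_i ^+ 2) ^+ q.
    rewrite -E /ideal_rep rmorph_theta; apply: eq_theta => S.
    exact: rmorph_wedges.
  rewrite /ideal_rep thetaZ mulrC -mulrBr rmorphM rmorphB rmorphXn exprM /= -/(ideal_rep _).
  by rewrite E subrr mulr0.
elim: (2 * q)%N => [|j IH] [x hx]; first by exists x; move: hx; rewrite mul1r.
apply: IH; apply: (@ideal_rep_var_injective i X (j + t) _ x) => //.
- by rewrite (leq_trans qt) // leq_addl.
- by apply: dhomogM => //; rewrite -{2}[j]mul1n; apply: dhomogMn; apply: dhomogX_U.
by rewrite mulrA -exprS.
Qed.

End LinearEagonNorthcott.

(** * Top coefficients of polynomials *)

Section PolyTop.
Variable R : nzRingType.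

Lemma coefM_top (p g : {poly R}) a b : (size p <= a.+1)%N -> (size g <= b.+1)%N ->
  (p * g)`_(a + b) = p`_a * g`_b.
Proof.
move=> /leq_sizeP hp /leq_sizeP hg; rewrite coefM.
have ha : (a < (a + b).+1)%N by rewrite ltnS leq_addr.
rewrite (bigD1 (Ordinal ha)) //= addKn big1 ?addr0 // => j ja.
case: (ltngtP j a) => [lt|lt|e].
- by rewrite (hg (a + b - j)%N) ?mulr0 //; lia.
- by rewrite hp ?mul0r.
by case/eqP: ja; apply: val_inj.
Qed.

Lemma size_mul_bound (p g : {poly R}) a b c : (size p <= a.+1)%N -> (size g <= b)%N ->
  (a + b <= c)%N -> (size (p * g)%R <= c)%N.
Proof.
move=> hp hg hc; apply: leq_trans (size_polyMleq _ _) _.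
apply: leq_trans hc; move: hp hg; lia.
Qed.

Lemma size_sub_top (p g : {poly R}) m : (size p <= m.+1)%N -> (size g <= m.+1)%N ->
  p`_m = g`_m -> (size (p - g)%R <= m)%N.
Proof.
move=> /leq_sizeP hp /leq_sizeP hg e; apply/leq_sizeP => j.
rewrite leq_eqVlt coefB => /predU1P[<-|lt]; first by rewrite e subrr.
by rewrite hp // hg // subrr.
Qed.

Lemma size_sum_le (I : finType) (P : pred I) (F : I -> {poly R}) m :
  (forall i, P i -> (size (F i) <= m)%N) -> (size (\sum_(i | P i) F i)%R <= m)%N.
Proof.
move=> h; apply: leq_trans (size_sum _ _ _) _.
by apply/bigmax_leqP.
Qed.

End PolyTop.

(** * Syzygies of variables *)

Section KoszulVariables.
Variables (K : fieldType) (r : nat).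
Local Notation A := {mpoly K[r]}.

Lemma kill_seq_ideal (s : seq 'I_r) (p : A) : uniq s -> kill [set i in s] p = 0 ->
  exists h : 'I_r -> A, p = \sum_(m <- s) h m * 'X_m.
Proof.
elim: s p => [|k s IH] p /=.
  move=> _; rewrite (_ : [set i in [::]] = set0) ?kill0; last by apply/setP=> i; rewrite !inE.
  by move=> ->; exists (fun=> 0); rewrite big_nil.
case/andP=> ks us; rewrite (_ : [set i in k :: s] = k |: [set i in s]); last first.
  by apply/setP=> i; rewrite !inE.
case/killU1_divides => g /(IH _ us)[h Hh].
exists (fun m => if m == k then g else h m); rewrite big_cons eqxx.
rewrite (eq_big_seq (fun m => h m * 'X_m)) => [|m ms]; last first.
  by case: eqVneq ms => // ->; rewrite (negbTE ks).
by rewrite -Hh; ring.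
Qed.

(** x_k is regular modulo the remaining variables, so rho k is a combination of them; subtracting
    the Koszul relations with the same coefficients removes the variable k from the syzygy. *)
Lemma koszul_variables (s : seq 'I_r) (rho : 'I_r -> A) : uniq s ->
  \sum_(l <- s) rho l * 'X_l = 0 ->
  exists g : 'I_r -> 'I_r -> A, [/\ forall l m, g l m = - g m l, forall l, g l l = 0 &
    forall l, l \in s -> rho l = \sum_(m <- s) g l m * 'X_m].
Proof.
elim: s rho => [|k s IH] rho /=.
  by exists (fun _ _ => 0); split=> // l m; rewrite oppr0.
case/andP=> ks us; rewrite big_cons => E.
have [h Hh] : exists h, rho k = \sum_(m <- s) h m * 'X_m.
  apply: kill_seq_ideal => //; apply: (@kill_reg _ _ k); first by rewrite inE.
  have -> : 'X_k * rho k = - \sum_(l <- s) rho l * 'X_l.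
    by apply/eqP; rewrite -addr_eq0 mulrC E.
  rewrite rmorphN rmorph_sum big1_seq ?oppr0 // => l /= ls.
  by rewrite rmorphM /= killX inE ls mulr0.
have [|g [gN g0 Hg]] := IH (fun l => rho l + 'X_k * h l) us.
  under eq_bigr do rewrite mulrDl.
  rewrite big_split /= -[RHS]E Hh addrC; congr (_ + _).
  by rewrite mulr_suml; apply: eq_bigr => l _; ring.
exists (fun l m => if l == k then (if m == k then 0 else h m)
                   else if m == k then - h l else g l m); split=> [l m|l|l].
- by case: (l == k); case: (m == k); rewrite ?oppr0 ?opprK.
- by case: (l == k).
rewrite inE big_cons eqxx => /predU1P[->|ls].
  rewrite eqxx mul0r add0r Hh; apply: eq_big_seq => m ms.
  by case: eqVneq ms => // ->; rewrite (negbTE ks).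
have -> : (l == k) = false by case: eqVneq ls => // ->; rewrite (negbTE ks).
rewrite (eq_big_seq (fun m => g l m * 'X_m)) => [|m ms]; last first.
  by case: eqVneq ms => // ->; rewrite (negbTE ks).
by rewrite -Hg //; ring.
Qed.

End KoszulVariables.

(** * Moving lines *)

Section Evaluation.
Variables (K : fieldType) (n : nat) (f : 'I_n.+1 -> {poly K}).
Local Notation A := {mpoly K[n.+1]}.

Definition evf (p : A) : {poly K} := mmap (@polyC K) f p.
HB.instance Definition _ :=
  GRing.RMorphism.copy evf (mmap (polyC : {rmorphism K -> {poly K}}) f).

Lemma evfX l : evf 'X_l = f l.
Proof. by rewrite /evf mmapX mmap1U. Qed.

Lemma evfC c : evf c%:MP = c%:P.
Proof. exact: mmapC. Qed.

Definition Ev (y : {poly A}) : {poly K} := (map_poly evf y).['X].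
HB.instance Definition _ := GRing.RMorphism.copy Ev (horner_eval 'X \o map_poly evf).

Definition embed : {poly K} -> {poly A} := map_poly (@mpolyC n.+1 K).
HB.instance Definition _ := GRing.RMorphism.on embed.

Lemma EvX : Ev 'X = 'X.
Proof. by rewrite /Ev map_polyX hornerX. Qed.

Lemma EvC p : Ev p%:P = evf p.
Proof. by rewrite /Ev map_polyC hornerC. Qed.

Lemma Ev_embed p : Ev (embed p) = p.
Proof.
rewrite /Ev /embed -map_poly_comp (eq_map_poly (_ : evf \o _ =1 polyC)).
  by rewrite -/(comp_poly _ _) comp_polyXr.
by move=> c; exact: evfC.
Qed.

Lemma poly_expand (R : comNzRingType) (y : {poly R}) :
  y = \sum_(k < size y) (y`_k)%:P * 'X^k.
Proof. by rewrite -{1}[y]coefK poly_def; under eq_bigr do rewrite -mul_polyC. Qed.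

Lemma Ev_expand y : Ev y = \sum_(k < size y) evf y`_k * 'X^k.
Proof.
rewrite {1}[y]poly_expand rmorph_sum; apply: eq_bigr => k _.
by rewrite rmorphM rmorphXn /= EvX EvC.
Qed.

End Evaluation.

Section BoundedCombination.
Variables (K : fieldType) (n m d q : nat) (mu : 'I_m -> nat).
Variables (f u : 'I_n -> {poly K}) (s : 'I_m -> 'I_n -> {poly K}).
Hypothesis size_f : forall l, (size (f l) <= d.+1)%N.
Hypothesis size_s : forall i l, (size (s i l) <= (mu i).+1)%N.
Hypothesis syz : forall i, \sum_l s i l * f l = 0.
Hypothesis uf1 : \sum_l u l * f l = 1.
Hypothesis mu_le_q : forall i, (mu i <= q)%N.
Hypothesis lead_span : forall b : 'I_n -> K, \sum_l b l * (f l)`_d = 0 ->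
  exists g : 'I_m -> K, forall l, b l = \sum_i g i * (s i l)`_(mu i).

(* The top coefficients of a combination of too large size are syzygies of the leading
   coefficients of the f l, hence can be removed by the s i. *)
Lemma bounded_combination B (p : {poly K}) : (q <= B)%N -> (size p <= B + d)%N ->
  exists b : 'I_n -> {poly K}, p = \sum_l b l * f l /\ forall l, (size (b l) <= B)%N.
Proof.
move=> qB sp; pose N := \max_l size (p * u l)%R.
have : exists b : 'I_n -> {poly K}, p = \sum_l b l * f l /\ forall l, (size (b l) <= B + N)%N.
  exists (fun l => p * u l); split; last first.
    move=> l; apply: leq_trans (leq_addl _ _).
    exact: (leq_bigmax (F := fun l => size (p * u l)%R) l).
  by under eq_bigr do rewrite -mulrA; rewrite -mulr_sumr uf1 mulr1.
clearbody N; elim: N => [|N IH] [b [Hb sb]]; first by exists b; split=> // l; rewrite -[B]addn0.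
apply: IH; have sb' l : (size (b l) <= (B + N).+1)%N by rewrite -addnS.
have [|g Hg] := lead_span (b := fun l => (b l)`_(B + N)).
  transitivity (p`_(B + N + d)).
    by rewrite Hb coef_sum; apply: eq_bigr => l _; rewrite (coefM_top (sb' l) (size_f l)).
  by rewrite nth_default // (leq_trans sp) // leq_add2r leq_addr.
have muB i : (mu i <= B + N)%N by rewrite (leq_trans (mu_le_q i)) // (leq_trans qB) ?leq_addr.
exists (fun l => b l - \sum_i g i *: ('X^(B + N - mu i) * s i l)); split=> [|l].
  under eq_bigr do rewrite mulrBl.
  rewrite sumrB -Hb; set R := (X in _ - X); suff -> : R = 0 by rewrite subr0.
  rewrite /R; under eq_bigr do rewrite mulr_suml.
  rewrite exchange_big big1 // => i _.
  transitivity (g i *: 'X^(B + N - mu i) * \sum_l s i l * f l); last by rewrite syz mulr0.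
  by rewrite mulr_sumr; apply: eq_bigr => l _; rewrite -!mul_polyC; ring.
apply: size_sub_top => //.
  apply: size_sum_le => i _; apply: leq_trans (size_scale_leq _ _) _.
  apply: leq_trans (size_polyMleq _ _) _; rewrite size_polyXn /=.
  by have := size_s i l; have := muB i; set z := size _; lia.
rewrite Hg coef_sum; apply: eq_bigr => i _.
by rewrite coefZ coefXnM ltnNge leq_subr /= subKn.
Qed.

End BoundedCombination.

Section CurveData.
Variables (K : fieldType) (n d q : nat) (mu : 'I_n -> nat).
Variables (f u : 'I_n.+1 -> {poly K}) (s : 'I_n -> 'I_n.+1 -> {poly K}).
Variables (a : 'I_n.+1 -> 'I_n -> {poly K}) (M : 'I_n.+1 -> 'I_n -> K).
Local Notation A := {mpoly K[n.+1]}.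
Local Notation lam i l := (s i l)`_(mu i).
Local Notation evf := (evf f).
Local Notation Ev := (Ev f).
Local Notation embed := (@embed K n).

Hypothesis size_f : forall l, (size (f l) <= d.+1)%N.
Hypothesis size_f0 : size (f ord0) = d.+1.
Hypothesis size_fS : forall l, l != ord0 -> (size (f l) <= d)%N.
Hypothesis size_s : forall i l, (size (s i l) <= (mu i).+1)%N.
Hypothesis syz : forall i, \sum_l s i l * f l = 0.
Hypothesis uf1 : \sum_l u l * f l = 1.
Hypothesis syz_gen : forall l m, (l == m)%:R - f l * u m = \sum_i a l i * s i m.
(** Only f_0 has degree d in these coordinates, so the leading coefficients of the syzygies vanish
    at the index 0, and M inverts the remaining n x n block. *)
Hypothesis lam0 : forall i, lam i ord0 = 0.
Hypothesis lamM : forall i j, \sum_l lam i l * M l j = (i == j)%:R.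
Hypothesis Mlam : forall l m, \sum_i M l i * lam i m = ((l == m) && (l != ord0))%:R.
Hypothesis mu_q : forall i j, i != j -> (mu i + mu j <= q)%N.
Hypothesis mu_le_q : forall i, (mu i <= q)%N.

Definition L i : {poly A} := \sum_l embed (s i l) * ('X_l)%:P.

Lemma coef_L i k : (L i)`_k = \sum_l (s i l)`_k *: 'X_l.
Proof.
rewrite coef_sum; apply: eq_bigr => l _.
by rewrite coefMC coef_map /= mul_mpolyC.
Qed.

Lemma size_L i : (size (L i) <= (mu i).+1)%N.
Proof.
apply/leq_sizeP => j hj; rewrite coef_L big1 // => l _.
by rewrite (leq_sizeP _ _ (size_s i l)) // scale0r.
Qed.

Lemma Ev_L i : Ev (L i) = 0.
Proof.
rewrite rmorph_sum -[RHS](syz i); apply: eq_bigr => l _.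
by rewrite rmorphM /= Ev_embed EvC evfX.
Qed.

Definition in_L (y : {poly A}) : Prop := exists g : 'I_n -> {poly A}, y = \sum_i g i * L i.

Lemma in_L0 : in_L 0.
Proof. by exists (fun=> 0); rewrite big1 // => i _; rewrite mul0r. Qed.

Lemma in_LD y z : in_L y -> in_L z -> in_L (y + z).
Proof.
case=> g -> [h ->]; exists (fun i => g i + h i); rewrite -big_split.
by apply: eq_bigr => i _; rewrite mulrDl.
Qed.

Lemma in_LM y z : in_L z -> in_L (y * z).
Proof.
case=> h ->; exists (fun i => y * h i); rewrite mulr_sumr.
by apply: eq_bigr => i _; rewrite mulrA.
Qed.

Lemma in_L_sum (I : finType) (P : pred I) (F : I -> {poly A}) :
  (forall i, P i -> in_L (F i)) -> in_L (\sum_(i | P i) F i).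
Proof. by move=> h; elim/big_ind: _ => //; [exact: in_L0 | exact: in_LD]. Qed.

(** As 1 - f u is a combination of syzygies, T_l = f_l tau modulo the L_i. Every form of degree t in
    the T_l is therefore its value times tau^t. *)
Definition tau : {poly A} := \sum_m embed (u m) * ('X_m)%:P.

Lemma var_mod_L l : in_L (('X_l)%:P - embed (f l) * tau).
Proof.
exists (fun i => embed (a l i)).
transitivity (\sum_m embed ((l == m)%:R - f l * u m) * ('X_m)%:P).
  rewrite /tau mulr_sumr [RHS](eq_bigr (fun m => embed (l == m)%:R * ('X_m)%:P -
    embed (f l) * (embed (u m) * ('X_m)%:P))) => [|m _].
    rewrite sumrB [X in _ = X - _](_ : _ = ('X_l)%:P) //.
    rewrite (bigD1 l) //= eqxx rmorph1 mul1r big1 ?addr0 // => m ml.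
    by rewrite eq_sym (negbTE ml) rmorph0 mul0r.
  by rewrite rmorphB rmorphM /= mulrBl mulrA.
under eq_bigr do rewrite syz_gen rmorph_sum mulr_suml.
rewrite exchange_big; apply: eq_bigr => i _; rewrite /L mulr_sumr.
by apply: eq_bigr => m _; rewrite rmorphM /= mulrA.
Qed.

Lemma monomial_mod_L m : in_L (('X_[m])%:P - embed (evf 'X_[m]) * tau ^+ mdeg m).
Proof.
have -> : ('X_[m] : A)%:P - embed (evf 'X_[m]) * tau ^+ mdeg m =
    \prod_l ('X_l)%:P ^+ m l - \prod_l (embed (f l) * tau) ^+ m l.
  congr (_ - _); first by rewrite mpolyXE_id rmorph_prod; apply: eq_bigr => l _; rewrite rmorphXn.
  rewrite mpolyXE_id !rmorph_prod mdegE.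
  elim: (index_enum _) => [|l t IH]; first by rewrite !big_nil mulr1.
  by rewrite !big_cons -IH exprD !rmorphXn /= evfX exprMn; ring.
elim: (index_enum _) => [|l t IH]; first by rewrite !big_nil subrr; exact: in_L0.
rewrite !big_cons; set X1 := \prod_(_ <- _) _ in IH *; set Y1 := \prod_(_ <- _) _ in IH *.
have H : in_L (('X_l)%:P ^+ m l - (embed (f l) * tau) ^+ m l).
  by rewrite subrXX mulrC; apply: in_LM; exact: var_mod_L.
have -> : ('X_l)%:P ^+ m l * X1 - (embed (f l) * tau) ^+ m l * Y1 =
  ('X_l)%:P ^+ m l * (X1 - Y1) + Y1 * (('X_l)%:P ^+ m l - (embed (f l) * tau) ^+ m l) by ring.
by apply: in_LD; apply: in_LM.
Qed.

Lemma homog_mod_L t (p : A) : p \is t.-homog -> in_L (p%:P - embed (evf p) * tau ^+ t).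
Proof.
move=> hp; have -> : p%:P - embed (evf p) * tau ^+ t =
    \sum_(m <- msupp p) ((p@_m)%:MP)%:P * (('X_[m])%:P - embed (evf 'X_[m]) * tau ^+ mdeg m).
  have Ep : evf p = \sum_(m <- msupp p) evf (p@_m *: 'X_[m]).
    by rewrite {1}[p]mpolyE; apply: rmorph_sum.
  have Cp : p%:P = \sum_(m <- msupp p) (p@_m *: 'X_[m])%:P.
    by rewrite {1}[p]mpolyE; apply: rmorph_sum.
  rewrite Ep Cp (rmorph_sum embed) mulr_suml -sumrB; apply: eq_big_seq => m mp.
  have /= -> := dhomog_mf hp mp.
  rewrite -mul_mpolyC !rmorphM /= evfC /embed map_polyC /=; ring.
by elim/big_ind: _ => [||m _]; [exact: in_L0 | exact: in_LD | apply: in_LM; exact: monomial_mod_L].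
Qed.

(** By [homog_mod_L] y is congruent to Ev y times tau^t. Homogeneity in the T_l matters: tau - 1 has
    value 0 as well. *)
Lemma Ev0_in_L t (y : {poly A}) : (forall k, y`_k \is t.-homog) -> Ev y = 0 -> in_L y.
Proof.
move=> hy y0.
have -> : y = y - embed (Ev y) * tau ^+ t by rewrite y0 rmorph0 mul0r subr0.
rewrite Ev_expand {1}[y]poly_expand rmorph_sum mulr_suml -sumrB; apply: in_L_sum => k _.
have -> : (y`_k)%:P * 'X^k - embed (evf y`_k * 'X^k) * tau ^+ t =
   'X^k * ((y`_k)%:P - embed (evf y`_k) * tau ^+ t).
  by rewrite rmorphM rmorphXn /= {2}/embed map_polyX; ring.
by apply: in_LM; apply: homog_mod_L.
Qed.

Definition lamT i : A := \sum_l lam i l *: 'X_l.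

(** Up to the change of basis M the leading forms of the L_i are the variables T_l with l <> 0, so
    [koszul_variables] can be transported. *)
Lemma koszul_lamT (p : 'I_n -> A) : \sum_i p i * lamT i = 0 ->
  exists c : 'I_n -> 'I_n -> A, [/\ forall i j, c i j = - c j i, forall i, c i i = 0 &
    forall i, p i = \sum_j c i j * lamT j].
Proof.
move=> E; pose rho l := \sum_i lam i l *: p i.
pose t := [seq l <- enum 'I_n.+1 | l != ord0].
have tE (R : nmodType) (F : 'I_n.+1 -> R) : \sum_(l <- t) F l = \sum_(l | l != ord0) F l.
  by rewrite big_filter big_enum_cond.
have [||g [gN g0 Hg]] := @koszul_variables K n.+1 t rho.
- by rewrite filter_uniq ?enum_uniq.
- rewrite tE -[RHS]E /lamT; under [RHS]eq_bigr do rewrite mulr_sumr.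
  rewrite [RHS]exchange_big [RHS](bigD1 ord0) //= [X in _ = X + _]big1 ?add0r => [|i _].
    apply: eq_bigr => l _; rewrite /rho mulr_suml; apply: eq_bigr => i _.
    by rewrite -scalerAl -scalerAr.
  by rewrite lam0 scale0r mulr0.
have {}Hg l : l != ord0 -> rho l = \sum_(m | m != ord0) g l m * 'X_m.
  by move=> l0; rewrite Hg ?tE // mem_filter l0 mem_enum.
have HX m : m != ord0 -> 'X_m = \sum_i M m i *: lamT i :> A.
  move=> m0; rewrite /lamT; under eq_bigr do rewrite scaler_sumr.
  rewrite exchange_big (bigD1 m) //= [X in _ + X]big1 ?addr0 => [|l lm].
    by under eq_bigr do rewrite scalerA; rewrite -scaler_suml Mlam eqxx m0 scale1r.
  by under eq_bigr do rewrite scalerA; rewrite -scaler_suml Mlam eq_sym (negbTE lm) scale0r.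
exists (fun i j => \sum_(l | l != ord0) \sum_(m | m != ord0) (M l i * M m j) *: g l m).
split=> [i j|i|i].
- rewrite exchange_big -sumrN; apply: eq_bigr => m _; rewrite -sumrN.
  by apply: eq_bigr => l _; rewrite gN scalerN mulrC.
- apply: (@sum_alternating _ _ _ _ (fun i j : 'I_n.+1 => (i < j)%N)) => [l m _ _ lm|l _|l m _ _ lm].
  + by rewrite -leqNgt ltn_neqAle lm.
  + by rewrite g0 scaler0.
  + by rewrite gN scalerN mulrC.
have -> : p i = \sum_l M l i *: rho l.
  rewrite /rho; under [RHS]eq_bigr do rewrite scaler_sumr.
  rewrite exchange_big (bigD1 i) //= [X in _ + X]big1 ?addr0 => [|j ji].
    rewrite (eq_bigr (fun l => (lam i l * M l i) *: p i)) => [|l _]; last by rewrite scalerA mulrC.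
    by rewrite -scaler_suml lamM eqxx scale1r.
  rewrite (eq_bigr (fun l => (lam j l * M l i) *: p j)) => [|l _]; last by rewrite scalerA mulrC.
  by rewrite -scaler_suml lamM (negbTE ji) scale0r.
rewrite (bigD1 ord0) //= {1}/rho big1 => [|j _]; last by rewrite lam0 scale0r.
rewrite scaler0 add0r.
under [RHS]eq_bigr do rewrite mulr_suml.
rewrite [RHS]exchange_big; apply: eq_bigr => l l0.
rewrite Hg // scaler_sumr; under [RHS]eq_bigr do rewrite mulr_suml.
rewrite [RHS]exchange_big; apply: eq_bigr => m m0.
rewrite HX // mulr_sumr scaler_sumr; apply: eq_bigr => j _.
by rewrite -scalerAr -scalerAl scalerA.
Qed.

(** The bound on mu_i + mu_j originates here. If the g_i are too large, their top coefficients form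
    a syzygy of the leading forms, hence a Koszul one; it is removed by relations between L_i and
    L_j with coefficients of degree q + N - mu_i - mu_j, which is non-negative even for N = 0. *)
Lemma in_L_bounded (y : {poly A}) : (size y <= q)%N -> in_L y ->
  exists g : 'I_n -> {poly A}, y = \sum_i g i * L i /\ forall i, (size (g i) <= q - mu i)%N.
Proof.
move=> sy [g0 Hg0].
pose N := \max_i (size (g0 i) + mu i)%N.
have : exists g : 'I_n -> {poly A}, y = \sum_i g i * L i /\
    forall i, (size (g i) <= q + N - mu i)%N.
  exists g0; split=> // i; rewrite leq_subRL; last by rewrite (leq_trans (mu_le_q i)) ?leq_addr.
  by rewrite addnC; apply: leq_trans (leq_addl _ _); apply: (leq_bigmax i).
clearbody N; elim: N {g0 Hg0} => [|N IH] [g [Hg sg]]; first by exists g; split=> // i; rewrite -[q]addn0.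
apply: IH; have mq i := leq_trans (mu_le_q i) (leq_addr N q).
have sg' i : (size (g i) <= (q + N - mu i).+1)%N by rewrite -subSn // -addnS.
pose p i := (g i)`_(q + N - mu i).
have [|c [cN c0 Hc]] := @koszul_lamT p.
  have := congr1 (fun z : {poly A} => z`_(q + N)) Hg.
  rewrite (leq_sizeP _ _ sy) ?leq_addr // coef_sum => E0; rewrite [RHS]E0; apply: eq_bigr => i _.
  rewrite -[in RHS](subnK (mq i)) coefM_top ?size_L //; congr (_ * _).
  by rewrite coef_L.
pose z i j : {poly A} := (c i j)%:P * 'X^(q + N - mu i - mu j).
exists (fun i => g i - \sum_j z i j * L j); split.
  rewrite {1}Hg; under [RHS]eq_bigr do rewrite mulrBl mulr_suml.
  rewrite sumrB (@sum_alternating _ _ _ _ (fun i j : 'I_n => (i < j)%N)) ?subr0 //.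
  - by move=> i j _ _ ij; rewrite -leqNgt ltn_neqAle ij.
  - by move=> i _; rewrite /z c0 !mul0r.
  by move=> i j _ _ ij; rewrite /z cN polyCN subnAC; ring.
move=> i; apply: size_sub_top => //.
  apply: size_sum_le => j _; have [->|ij] := eqVneq i j; first by rewrite /z c0 !mul0r size_poly0.
  rewrite /z -mulrA mul_polyC; apply: leq_trans (size_scale_leq _ _) _.
  rewrite mulrC; apply: leq_trans (size_polyMleq _ _) _; rewrite size_polyXn addnS /=.
  apply: leq_trans (leq_add (size_L j) (leqnn _)) _.
  by have := mu_q ij; lia.
rewrite -/(p i) Hc coef_sum; apply: eq_bigr => j _.
have [->|ij] := eqVneq i j; first by rewrite /z c0 !mul0r coef0.
rewrite /z -mulrA coefCM; congr (_ * _).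
have -> : (q + N - mu i = (q + N - mu i - mu j) + mu j)%N by have := mu_q ij; lia.
rewrite coefM_top ?size_L ?size_polyXn //; last by lia.
by rewrite coefXn addnK eqxx mul1r coef_L.
Qed.

Lemma lead_span (b : 'I_n.+1 -> K) : \sum_l b l * (f l)`_d = 0 ->
  exists g : 'I_n -> K, forall l, b l = \sum_i g i * lam i l.
Proof.
rewrite (bigD1 ord0) //= big1 => [|l l0]; last by rewrite (leq_sizeP _ _ (size_fS l0)) ?mulr0.
have f0 : (f ord0)`_d != 0.
  by have := lead_coef_eq0 (f ord0); rewrite lead_coefE size_f0 /= => ->; rewrite -size_poly_eq0 size_f0.
rewrite addr0 => /eqP; rewrite mulf_eq0 (negbTE f0) orbF => /eqP b0.
exists (fun i => \sum_l b l * M l i) => l; under eq_bigr do rewrite mulr_suml.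
rewrite exchange_big (bigD1 l) //= [X in _ + X]big1 ?addr0 => [|m ml].
  under eq_bigr do rewrite -mulrA.
  rewrite -mulr_sumr Mlam eqxx /=; case: eqVneq => [->|_]; last by rewrite mulr1.
  by rewrite b0 mul0r.
by under eq_bigr do rewrite -mulrA; rewrite -mulr_sumr Mlam (negbTE ml) mulr0.
Qed.

(** Each use of [bounded_combination] trades a factor f_l for T_l and lowers the size bound by d,
    from q + t d down to q. *)
Lemma lift_homog t (p : {poly K}) : (size p <= q + t * d)%N ->
  exists y : {poly A}, [/\ (size y <= q)%N, forall k, y`_k \is t.-homog & Ev y = p].
Proof.
elim: t p => [|t IH] p sp.
  exists (embed p); split; last exact: Ev_embed.
    by apply: leq_trans (size_poly _ _) _; rewrite -[q]addn0.
  by move=> k; rewrite coef_map /= dhomogE; apply/allP => m; rewrite msuppC; case: ifP => //= _;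
     rewrite inE => /eqP ->; rewrite /= mdeg0.
have [||b [Hb sb]] := bounded_combination size_f size_s syz uf1 mu_le_q lead_span (B := (q + t * d)%N) (p := p).
- exact: leq_addr.
- by move: sp; rewrite mulSn; lia.
have /fin_all_exists[y Hy] l := IH (b l) (sb l).
exists (\sum_l ('X_l)%:P * y l); split.
- apply: size_sum_le => l _; rewrite mul_polyC; apply: leq_trans (size_scale_leq _ _) _.
  by case: (Hy l).
- move=> k; rewrite coef_sum; apply: rpred_sum => l _; rewrite coefCM.
  by apply: dhomogXM; case: (Hy l).
rewrite rmorph_sum Hb; apply: eq_bigr => l _; rewrite rmorphM /= EvC evfX mulrC.
by case: (Hy l) => _ _ ->.
Qed.

Definition ncol : nat := #|{: 'I_n * 'I_q}|.

Definition col_index (c : 'I_ncol) : 'I_n * 'I_q := enum_val c.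

(* The x^a L_i with a + mu_i < q, padded with zero columns. *)
Definition col (c : 'I_n * 'I_q) : {poly A} :=
  if (c.2 + mu c.1 < q)%N then 'X^(c.2) * L c.1 else 0.

Definition Phi (k : 'I_q) (c : 'I_ncol) : A := (col (col_index c))`_k.

Lemma Phi_homog k c : Phi k c \is 1.-homog.
Proof.
rewrite /Phi /col; case: ifP => _; last by rewrite coef0 dhomog0.
rewrite coefXnM; case: ifP => _; first exact: dhomog0.
by rewrite coef_L; apply: rpred_sum => l _; apply: rpredZ; exact: dhomogX_U.
Qed.

Lemma Ev_col c : Ev (col c) = 0.
Proof. by rewrite /col; case: ifP => _; rewrite ?rmorph0 // rmorphM /= Ev_L mulr0. Qed.

Lemma size_col c : (size (col c) <= q)%N.
Proof.
rewrite /col; case: ifP => [lt|_]; last by rewrite size_poly0.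
rewrite mulrC; apply: leq_trans (size_polyMleq _ _) _; rewrite size_polyXn addnS /=.
by apply: leq_trans (leq_add (size_L _) (leqnn _)) _; rewrite addSn addnC.
Qed.

(** The entries of Psi are the coefficients of the g_i from [in_L_bounded]: the bound q - mu_i on
    their size says that only unpadded columns are used. *)
Lemma Ev0_image t (y : {poly A}) : (size y <= q)%N -> (forall k, y`_k \is t.-homog) ->
  Ev y = 0 -> exists Psi : 'I_ncol -> A, forall k : 'I_q, \sum_c Phi k c * Psi c = y`_k.
Proof.
move=> sy hy y0; have [g [Hg sg]] := in_L_bounded sy (Ev0_in_L hy y0).
exists (fun c => (g (col_index c).1)`_((col_index c).2)) => k.
rewrite (reindex (fun c : 'I_n * 'I_q => enum_rank c : 'I_ncol)) /=; last first.
  by apply: onW_bij; exists enum_val; [exact: enum_rankK | exact: enum_valK].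
rewrite (eq_bigr (fun c : 'I_n * 'I_q => (col c)`_k * (g c.1)`_c.2)) => [|c _]; last first.
  by rewrite /Phi /col_index enum_rankK.
rewrite Hg coef_sum -(pair_bigA _ (fun i (b : 'I_q) => (col (i, b))`_k * (g i)`_b)) /=.
apply: eq_bigr => i _.
have E : g i = \sum_(b < q) ((g i)`_b)%:P * 'X^b.
  rewrite {1}[g i]poly_expand (big_ord_widen q (fun b => ((g i)`_b)%:P * 'X^b)); last first.
    by rewrite (leq_trans (sg i)) ?leq_subr.
  rewrite [RHS](bigID (fun b : 'I_q => (b < size (g i))%N)) /= [X in _ + X]big1 ?addr0 // => b.
  by rewrite -leqNgt => hb; rewrite nth_default // mul0r.
transitivity ((\sum_(b < q) ((g i)`_b)%:P * 'X^b) * L i)`_k; last by rewrite -E.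
rewrite mulr_suml coef_sum; apply: eq_bigr => b _.
rewrite -mulrA coefCM mulrC /col /=; case: ltnP => // hb.
by rewrite (leq_sizeP _ _ (sg i)) ?mul0r ?mulr0 // leq_subLR addnC.
Qed.

End CurveData.

Section DependentRows.
Variables (R : comNzRingType) (q w : nat) (Phi : 'I_q -> 'I_w -> R) (al : 'I_q -> R).

(** Contraction along row 0 is a combination of contractions along the other rows, each of which
    already occurs in [theta]. *)
Lemma theta_dependent x S : (0 < q)%N -> (forall k, val k = 0%N -> al k = 1) ->
  (forall i, \sum_k al k * Phi k i = 0) -> theta Phi (enum 'I_q) x S = 0.
Proof.
move=> q0 al1 dep.
case E: (enum 'I_q) => [|k0 s]; first by have := size_enum_ord q; rewrite E => e; rewrite -e in q0.
have k00 : val k0 = 0%N.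
  have : nth 0%N [seq val i | i <- enum 'I_q] 0 = 0%N by rewrite val_enum_ord nth_iota.
  by rewrite E.
have us : uniq (k0 :: s) by rewrite -E enum_uniq.
have row0 : Phi k0 = fun i => \sum_(k | k != k0) (- al k) * Phi k i.
  apply: functional_extensionality => i; have := dep i.
  rewrite (bigD1 k0) //= al1 // mul1r => /eqP; rewrite addr_eq0 => /eqP ->.
  by rewrite -sumrN; apply: eq_bigr => k _; rewrite mulNr.
rewrite /theta /= -/(theta _ _ _) row0 contract_sum_coef big1 // => k kk0.
rewrite (contract_theta _ _ _ _) ?mulr0 //.
have : k \in enum 'I_q by rewrite mem_enum.
by rewrite E inE (negbTE kk0).
Qed.

End DependentRows.

Section EvaluationDegree.
Variables (K : fieldType) (n d : nat) (f : 'I_n.+1 -> {poly K}).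
Hypothesis size_f : forall l, (size (f l) <= d.+1)%N.

Lemma size_evf t (p : {mpoly K[n.+1]}) : p \is t.-homog -> (size (evf f p) <= (t * d).+1)%N.
Proof.
move=> hp; rewrite [p]mpolyE rmorph_sum; apply: leq_trans (size_sum _ _ _) _.
rewrite big_seq; elim/big_ind: _ => // [x y hx hy|m mp]; first by rewrite geq_max hx.
have /= <- := dhomog_mf hp mp.
rewrite -mul_mpolyC rmorphM /= evfC mul_polyC; apply: leq_trans (size_scale_leq _ _) _.
rewrite mpolyXE_id rmorph_prod mdegE.
elim: (index_enum _) => [|l s IH]; first by rewrite !big_nil size_poly1.
rewrite !big_cons; apply: leq_trans (size_polyMleq _ _) _.
rewrite rmorphXn /= evfX.
have h1 : (size (f l ^+ m l) <= (m l * d).+1)%N.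
  elim: (m l) => [|k IHk]; first by rewrite expr0 size_poly1.
  rewrite exprS; apply: leq_trans (size_polyMleq _ _) _.
  by have := size_f l; rewrite mulSn; lia.
by rewrite mulnDl; move: IH h1 => /=; lia.
Qed.

End EvaluationDegree.

Section Division.
Variables (K : fieldType) (d : nat) (h : {poly K}).
Hypothesis size_h : size h = d.+1.

Lemma size_quotient (b : {poly K}) N : (size (h * b)%R <= N + d)%N -> (size b <= N)%N.
Proof.
have [->|b0] := eqVneq b 0; first by rewrite size_poly0.
have h0 : h != 0 by rewrite -size_poly_eq0 size_h.
by rewrite size_mul // size_h addSn /= addnC leq_add2r.
Qed.

Lemma coprime_inverse (g : {poly K}) : coprimep g h -> exists w, h %| g * w - 1.
Proof.
move=> /Bezout_eq1_coprimepP[[w w'] /= E]; exists w.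
have -> : g * w - 1 = h * (- w') by rewrite -E; ring.
exact: dvdp_mulIl.
Qed.

(** b is the remainder of p w by h, with w an inverse of g modulo h; 2d <= N leaves room for the
    product g b. *)
Lemma coprime_division (g p : {poly K}) N : coprimep g h -> (size g <= d.+1)%N ->
  (size p <= N)%N -> (2 * d <= N)%N ->
  exists b b', [/\ p = g * b + h * b', (size b <= d)%N & (size b' <= N - d)%N].
Proof.
move=> /coprime_inverse[w hw] sg sp hN.
have h0 : h != 0 by rewrite -size_poly_eq0 size_h.
have sb : (size ((p * w) %% h)%R <= d)%N by rewrite -ltnS -size_h ltn_modp.
have /dvdpP[b' Hb'] : h %| p - g * ((p * w) %% h).
  have -> : p - g * ((p * w) %% h) = - p * (g * w - 1) + g * ((p * w) %/ h) * h.
    have -> : (p * w) %% h = p * w - (p * w) %/ h * h by rewrite {2}(divp_eq (p * w) h) addrC addKr.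
    by ring.
  by rewrite dvdp_addr ?dvdp_mulIr // dvdp_mull.
exists ((p * w) %% h), b'; split=> //; first by rewrite mulrC [h * _]mulrC -Hb'; ring.
apply: size_quotient; rewrite subnK; last by apply: leq_trans hN; rewrite mul2n -addnn leq_addr.
rewrite mulrC -Hb'; apply: leq_trans (size_polyD _ _) _; rewrite geq_max sp size_polyN.
apply: leq_trans (size_polyMleq _ _) (leq_trans _ hN).
by have := leq_add sg sb; rewrite addSn mul2n -addnn; case: (_ + _)%N.
Qed.

End Division.

(** * Conditions (I) and (S) in general position *)

Section GeneralPosition.
Variables (K : fieldType) (n d q : nat) (mu : 'I_n -> nat).
Variables (f u : 'I_n.+1 -> {poly K}) (s : 'I_n -> 'I_n.+1 -> {poly K}).
Variables (a : 'I_n.+1 -> 'I_n -> {poly K}) (M : 'I_n.+1 -> 'I_n -> K).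
Local Notation A := {mpoly K[n.+1]}.
Local Notation lam i l := (s i l)`_(mu i).
Local Notation evf := (evf f).
Local Notation Ev := (Ev f).

Hypothesis size_f : forall l, (size (f l) <= d.+1)%N.
Hypothesis size_f0 : size (f ord0) = d.+1.
Hypothesis size_fS : forall l, l != ord0 -> (size (f l) <= d)%N.
Hypothesis size_s : forall i l, (size (s i l) <= (mu i).+1)%N.
Hypothesis syz : forall i, \sum_l s i l * f l = 0.
Hypothesis uf1 : \sum_l u l * f l = 1.
Hypothesis syz_gen : forall l m, (l == m)%:R - f l * u m = \sum_i a l i * s i m.
Hypothesis lam0 : forall i, lam i ord0 = 0.
Hypothesis lamM : forall i j, \sum_l lam i l * M l j = (i == j)%:R.
Hypothesis Mlam : forall l m, \sum_i M l i * lam i m = ((l == m) && (l != ord0))%:R.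
Hypothesis mu_q : forall i j, i != j -> (mu i + mu j <= q)%N.
Hypothesis mu_le_q : forall i, (mu i <= q)%N.

Variables (i1 : 'I_n.+1) (e : nat) (P Q : A) (c : {poly K}).
Hypothesis i1_neq0 : i1 != ord0.
Hypothesis q_gt0 : (0 < q)%N.
Hypothesis d_gt0 : (0 < d)%N.
Hypothesis coprime_f1 : coprimep (f i1) (f ord0).
Hypothesis P_homog : P \is e.-homog.
Hypothesis Q_homog : Q \is e.-homog.
Hypothesis evP : evf P = 'X * c.
Hypothesis evQ : evf Q = c.
Hypothesis c_neq0 : c != 0.
Hypothesis coprime_c : coprimep c (f ord0).

Local Notation h := (f ord0).
Local Notation kl := (@kill K n.+1 [set ord0]).
Local Notation Phi := (@Phi K n q mu s).
Local Notation rep := (ideal_rep Phi).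

Let lift := @lift_homog K n d q mu f u s M size_f size_f0 size_fS size_s syz uf1 Mlam mu_le_q.
Let image := @Ev0_image K n d q mu f u s a M size_f0 size_s syz_gen lam0 lamM Mlam mu_q mu_le_q.

(** After T_l -> f_l the rows of Phi are dependent with coefficients 1, x, ..., x^(q-1), since every
    column is the coefficient vector of a polynomial of value 0. *)
Lemma evf_rep x : evf (rep x) = 0.
Proof.
rewrite /ideal_rep rmorph_theta.
apply: (@theta_dependent _ _ _ _ (fun k => 'X^k)) => // [k -> //|i].
rewrite -[RHS](Ev_col mu syz (col_index i)) Ev_expand.
rewrite (big_ord_widen q (fun k => evf (col mu s (col_index i))`_k * 'X^k)); last exact: size_col.
rewrite [RHS]big_mkcond; apply: eq_bigr => k _ /=; rewrite mulrC /Phi.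
by case: ltnP => // hk; rewrite nth_default // rmorph0 mul0r.
Qed.

Lemma coef_polyC_homog t (p : A) k : p \is t.-homog -> (p%:P : {poly A})`_k \is t.-homog.
Proof. by move=> hp; rewrite coefC; case: ifP => // _; exact: dhomog0. Qed.

(** Divide f_i^2 x^l as f_i1 b + h b' and lift b, b' to y, y'. Then T_i^2 x^l - T_i1 y - T_0 y' has
    value 0, hence is a combination of columns, and modulo T_0, T_i1 only T_i^2 x^l is left. The
    square supplies the room 2d that [coprime_division] demands. *)
Lemma right_inverse_two_vars i : exists Psi : 'I_q -> 'I_(ncol n q) -> A,
  forall k l, kill [set ord0; i1] (\sum_j Phi k j * Psi l j) =
    kill [set ord0; i1] ('X_i ^+ 2 *+ (k == l)).
Proof.
suff /fin_all_exists[Psi HPsi] (l : 'I_q) : exists Psi : 'I_(ncol n q) -> A,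
  forall k, kill [set ord0; i1] (\sum_j Phi k j * Psi j) =
    kill [set ord0; i1] ('X_i ^+ 2 *+ (k == l)).
  by exists Psi => k l; apply: HPsi.
have sp : (size (f i ^+ 2 * 'X^l)%R <= q + 2 * d)%N.
  rewrite mulrC; apply: leq_trans (size_polyMleq _ _) _; rewrite size_polyXn addSn /=.
  apply: leq_trans (leq_add (leqnn _) (size_polyMleq _ _)) _.
  by have := size_f i; have := ltn_ord l; lia.
have [|b [b' [Eb sb sb']]] := coprime_division size_f0 coprime_f1 (size_f i1) sp; first exact: leq_addl.
have [|y [sy hy Ey]] := @lift 1%N b; first by rewrite mul1n (leq_trans sb) ?leq_addl.
have [|y' [sy' hy' Ey']] := @lift 1%N b'; first by move: sb'; lia.
pose z : {poly A} := ('X_i ^+ 2)%:P * 'X^l - ('X_i1)%:P * y - ('X_ord0)%:P * y'.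
have szC (p : A) (x : {poly A}) : (size x <= q)%N -> (size (p%:P * x)%R <= q)%N.
  by move=> sx; rewrite mul_polyC; apply: leq_trans (size_scale_leq _ _) _.
have [|||Psi HPsi] := @image 2%N z.
- apply: leq_trans (size_polyD _ _) _; rewrite geq_max size_polyN szC // andbT.
  apply: leq_trans (size_polyD _ _) _; rewrite geq_max size_polyN !szC //.
  by rewrite size_polyXn.
- move=> k; rewrite !coefB !coefCM; apply: rpredB; last exact: dhomogXM.
  apply: rpredB; last exact: dhomogXM.
  rewrite coefXn; case: eqP => _; last by rewrite mulr0 dhomog0.
  by rewrite mulr1 expr2; apply: dhomogXM; exact: dhomogX_U.
- rewrite /z !rmorphB !rmorphM /= !EvC !rmorphXn /= !evfX EvX Ey Ey' Eb; ring.
exists Psi => k; rewrite HPsi !coefB !coefCM !rmorphB /=.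
rewrite [kill _ ('X_i1 * _)]rmorphM [kill _ ('X_ord0 * _)]rmorphM /= !killX !inE !eqxx orbT.
by rewrite !mul0r !subr0 coefXn mulr_natr.
Qed.

(** Membership in J + (T_0), which will be shown to contain every form of degree at least q whose
    value is divisible by h. *)
Definition J0 (p : A) : Prop := exists x, kill [set ord0] (p - rep x) = 0.

Lemma J0D p p' : J0 p -> J0 p' -> J0 (p + p').
Proof.
case=> x hx [x' hx']; exists (fun S => x S + x' S).
rewrite /ideal_rep thetaD -/(rep x) -/(rep x').
by rewrite opprD addrACA rmorphD /= hx hx' addr0.
Qed.

Lemma J0M b p : J0 p -> J0 (b * p).
Proof.
case=> x hx; exists (fun S => b * x S).
by rewrite /ideal_rep thetaZ -/(rep x) -mulrBr rmorphM /= hx mulr0.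
Qed.

Lemma J0_cancel t p : (q <= t)%N -> p \is t.-homog -> J0 ('X_i1 * p) -> J0 p.
Proof.
move=> qt hp [x hx].
have i1X : i1 \notin [set ord0] by rewrite inE.
have sub : [set ord0; i1] \subset i1 |: [set ord0] by rewrite setUC.
exact: (ideal_rep_var_injective (@Phi_homog K n q mu s) right_inverse_two_vars i1X sub qt hp hx).
Qed.

Lemma J0_cancel_exp k t p : (q <= t)%N -> p \is t.-homog -> J0 ('X_i1 ^+ k * p) -> J0 p.
Proof.
move=> qt hp; elim: k => [|k IH]; first by rewrite mul1r.
rewrite exprS -mulrA => hJ; apply: IH; apply: (@J0_cancel (k + t)) hJ.
  by rewrite (leq_trans qt) ?leq_addl.
by apply: dhomogM => //; rewrite -{2}[k]mul1n; apply: dhomogMn; apply: dhomogX_U.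
Qed.

Lemma J0_triangular (g : 'I_q -> 'I_q -> A) :
  (forall k l : 'I_q, (l < k)%N -> g k l = 0) ->
  (forall l, exists Psi : 'I_(ncol n q) -> A,
     forall k, kill [set ord0] (\sum_j Phi k j * Psi j) = kill [set ord0] (g k l)) ->
  J0 (\prod_k g k k).
Proof.
move=> tri /fin_all_exists[Psi HPsi].
exists (wedges Psi (enum 'I_q)).
have HP k l : \sum_j (kl \o Phi k) j * (kl \o Psi l) j = kl (g k l).
  by rewrite -HPsi rmorph_sum; apply: eq_bigr => j _; rewrite rmorphM.
have htri (k l : 'I_q) : (l < k)%N -> kl (g k l) = 0 by move=> lk; rewrite tri // rmorph0.
have E := @theta_wedges _ _ _ (fun k => kl \o Phi k) (fun l => kl \o Psi l)
  (fun k l => kl (g k l)) HP htri.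
rewrite rmorphB rmorph_prod /= -E /ideal_rep rmorph_theta.
apply/eqP; rewrite subr_eq0; apply/eqP; apply: eq_theta => S.
by apply/esym; apply: rmorph_wedges.
Qed.

(** Lifting b to y' makes y - T_0 y' a polynomial of value 0, and T_0 y' disappears modulo T_0. *)
Lemma column_image t (y : {poly A}) (b : {poly K}) : (size y <= q)%N ->
  (forall k, y`_k \is t.+1.-homog) -> Ev y = h * b -> (size b <= q + t * d)%N ->
  exists Psi : 'I_(ncol n q) -> A,
    forall k : 'I_q, kill [set ord0] (\sum_j Phi k j * Psi j) = kill [set ord0] y`_k.
Proof.
move=> sy hy Ey sb; have [y' [sy' hy' Ey']] := lift sb.
have [|||Psi HPsi] := @image t.+1 (y - ('X_ord0)%:P * y').
- apply: leq_trans (size_polyD _ _) _; rewrite geq_max sy size_polyN mul_polyC.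
  exact: leq_trans (size_scale_leq _ _) _.
- by move=> k; rewrite coefB coefCM; apply: rpredB; [exact: hy | exact: dhomogXM].
- by rewrite rmorphB rmorphM /= EvC evfX Ey Ey' subrr.
exists Psi => k; rewrite HPsi coefB coefCM rmorphB rmorphM /= killX inE eqxx mul0r.
by rewrite subr0.
Qed.

Lemma e_gt0 : (0 < e)%N.
Proof.
have := size_evf size_f P_homog; rewrite evP mulrC size_mulX // lt0n.
by case: eqP => // ->; rewrite mul0n !ltnS leqn0 size_poly_eq0 (negbTE c_neq0).
Qed.

Lemma size_quotient_evf t (F : A) b : F \is t.+1.-homog -> evf F = h * b ->
  (size b <= t * d + 1)%N.
Proof.
move=> hF EF; apply: (size_quotient size_f0); rewrite -EF.
by apply: leq_trans (size_evf size_f hF) _; rewrite mulSn; lia.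
Qed.

Lemma size_polyC_mulXn (p : A) (l : 'I_q) : (size (p%:P * 'X^l)%R <= q)%N.
Proof.
rewrite mul_polyC; apply: leq_trans (size_scale_leq _ _) _.
by rewrite size_polyXn.
Qed.

(** The first column is F, the others are Q x^l - P x^(l-1), of value c x^l - x c x^(l-1) = 0. The
    matrix is triangular with diagonal F, Q, ..., Q. *)
Lemma J0_conductor t (F : A) b : F \is t.+1.-homog -> evf F = h * b -> J0 (Q ^+ q.-1 * F).
Proof.
move=> hF EF; have sb := size_quotient_evf hF EF.
pose k0 := Ordinal q_gt0.
pose g (k l : 'I_q) : A := if l == k0 then (if k == l then F else 0)
  else if k == l then Q else if k.+1 == l then - P else 0.
have -> : Q ^+ q.-1 * F = \prod_k g k k.
  rewrite (bigD1 k0) //= {1}/g !eqxx mulrC; congr (_ * _).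
  rewrite (eq_bigr (fun=> Q)) => [|k /negbTE kk0]; last by rewrite /g kk0 eqxx.
  by rewrite prodr_const; congr (_ ^+ _); rewrite -[in LHS](card_ord q) -(cardC1 k0).
apply: J0_triangular => [k l lk|l].
  rewrite /g; have -> : (k == l) = false by rewrite -val_eqE /= gtn_eqF.
  have -> : (k.+1 == l) = false by rewrite gtn_eqF // ltnW.
  by case: ifP.
have [lk0|lk0] := eqVneq l k0.
  have [||||Psi HPsi] := @column_image t F%:P b.
  - by apply: leq_trans (size_polyC_leq1 _) _.
  - by move=> k; apply: coef_polyC_homog.
  - by rewrite EvC.
  - by move: sb; lia.
  exists Psi => k; rewrite HPsi coefC /g lk0 eqxx -val_eqE /=.
  by case: eqP.
have l0 : (0 < l)%N by rewrite lt0n; apply: contraNneq lk0 => l0; apply/eqP/val_inj.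
pose l1 : 'I_q := Ordinal (leq_ltn_trans (leq_pred l) (ltn_ord l)).
have [||||Psi HPsi] := @column_image e.-1 (Q%:P * 'X^l - P%:P * 'X^l1) 0.
- by apply: leq_trans (size_polyD _ _) _; rewrite geq_max size_polyN !size_polyC_mulXn.
- move=> k; rewrite prednK ?e_gt0 // coefB !coefCM !coefXn.
  by apply: rpredB; case: eqP => _; rewrite ?mulr1 ?mulr0 ?dhomog0.
- rewrite mulr0 rmorphB !rmorphM !rmorphXn /= !EvC EvX evP evQ.
  by rewrite -[in X in X - _](prednK l0) exprS; ring.
- by rewrite size_poly0.
exists Psi => k; rewrite HPsi coefB !coefCM !coefXn /g (negbTE lk0) -val_eqE /=.
have [kl|kl] := eqVneq (k : nat) l.
  rewrite mulr1 (_ : (_ == _) = false) ?mulr0 ?subr0 //.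
  by rewrite kl gtn_eqF // prednK.
rewrite mulr0 sub0r -(prednK l0) eqSS /=.
by case: eqP => _; rewrite ?mulr1 // mulr0 oppr0.
Qed.

(** All the columns F x^l have values h b x^l, with b x^l within the bound of [column_image]. *)
Lemma J0_power t (F : A) b : F \is t.+1.-homog -> evf F = h * b -> J0 (F ^+ q).
Proof.
move=> hF EF; have sb := size_quotient_evf hF EF.
have -> : F ^+ q = \prod_(k < q) (F *+ (k == k)).
  by rewrite (eq_bigr (fun=> F)) => [|k _]; rewrite ?eqxx // prodr_const card_ord.
apply: (@J0_triangular (fun k l => F *+ (k == l))) => [k l lk|l].
  by rewrite -val_eqE /= gtn_eqF.
have [||||Psi HPsi] := @column_image t (F%:P * 'X^l) (b * 'X^l).
- exact: size_polyC_mulXn.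
- by move=> k; rewrite coefCM coefXn; case: eqP => _; rewrite ?mulr1 // mulr0 dhomog0.
- by rewrite rmorphM rmorphXn /= EvC EvX EF mulrA.
- rewrite mulrC; apply: leq_trans (size_polyMleq _ _) _; rewrite size_polyXn addSn /=.
  by have := leq_add (ltn_ord l) sb; rewrite addSn addnA addn1 ltnS.
by exists Psi => k; rewrite HPsi coefCM coefXn mulr_natr.
Qed.

(* b = b'(x,1) with b' reduced mod h is hit by b'(P,Q), since (P,Q) evaluates to c(x,1). *)
Lemma eval_surjective_mod_h D (b : {poly K}) : (d <= D)%N ->
  exists Y : A, Y \is (e * D).-homog /\ h %| b - evf Y.
Proof.
move=> dD; have [w hw] := coprime_inverse coprime_c.
have h0 : h != 0 by rewrite -size_poly_eq0 size_f0.
set b' := (b * w ^+ D) %% h.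
have sb : (size b' <= D)%N by rewrite (leq_trans _ dD) // -ltnS -size_f0 ltn_modp.
exists (\sum_(i < D) b'`_i *: (P ^+ i * Q ^+ (D - i))); split.
  apply: rpred_sum => i _; apply: rpredZ.
  have -> : (e * D = e * i + e * (D - i))%N by rewrite -mulnDr subnKC // ltnW.
  by apply: dhomogM; apply: dhomogMn.
have -> : evf (\sum_(i < D) b'`_i *: (P ^+ i * Q ^+ (D - i))) = c ^+ D * b'.
  rewrite rmorph_sum [in RHS](poly_expand b') (big_ord_widen D (fun k => (b'`_k)%:P * 'X^k)) //.
  rewrite [in RHS]big_mkcond mulr_sumr; apply: eq_bigr => i _ /=.
  rewrite -mul_mpolyC !rmorphM !rmorphXn /= evP evQ evfC.
  case: ltnP => hi; last by rewrite nth_default // mul0r mulr0.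
  have -> : c ^+ D = c ^+ i * c ^+ (D - i) by rewrite -exprD subnKC // ltnW.
  by rewrite exprMn; ring.
have hwD : h %| c ^+ D * w ^+ D - 1.
  by rewrite -exprMn -[1](expr1n _ D) subrXX; apply: dvdp_mulr.
have -> : b - c ^+ D * b' = - b * (c ^+ D * w ^+ D - 1) + c ^+ D * ((b * w ^+ D) %/ h) * h.
  have -> : b' = b * w ^+ D - (b * w ^+ D) %/ h * h.
    by rewrite /b' {2}(divp_eq (b * w ^+ D) h) addrC addKr.
  by ring.
by rewrite dvdp_addr ?dvdp_mulIr // dvdp_mull.
Qed.

Lemma evf_pihomog_rep t x : (q <= t)%N -> evf (pihomog mdeg t (rep x)) = 0.
Proof.
move=> qt; have := pihomog_theta (@Phi_homog K n q mu s) (t - q) (enum 'I_q) x set0.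
rewrite size_enum_ord subnKC // => ->; exact: evf_rep.
Qed.

Lemma J0_evf t (F : A) b : (q <= t.+1)%N -> F \is t.+1.-homog -> evf F = h * b -> J0 F ->
  exists E : A, E \is t.-homog /\ evf E = b.
Proof.
move=> qt hF EF [x hx].
have [g] := kill1_split ord0 (F - rep x); rewrite hx add0r => Hg.
exists (pihomog mdeg t g); split; first exact: pihomogP.
have h0 : h != 0 by rewrite -size_poly_eq0 size_f0.
apply: (mulfI h0); rewrite -EF -evfX -rmorphM -pihomogX -Hg pihomogB rmorphB /=.
by rewrite evf_pihomog_rep // subr0 pihomog_dE.
Qed.

(** T_i1^k differs from Q^(q-1) Y by a form F' whose value is divisible by h. Hence T_i1^(kq) F is
    the sum of F F'^q and a multiple of Q^(q-1) F, both in J + (T_0), and the power of T_i1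
    cancels. *)
Theorem quotient_h_in_image t (F : A) b : (q <= t.+1)%N -> F \is t.+1.-homog -> evf F = h * b ->
  exists E : A, E \is t.-homog /\ evf E = b.
Proof.
move=> qt hF EF; apply: (J0_evf qt hF EF).
have [w hw] := coprime_inverse coprime_c.
(* N is the degree of the form Y given by [eval_surjective_mod_h], and k that of Q^(q-1) Y. *)
pose N := (e * d)%N; pose k := (e * q.-1 + N)%N.
have [Y [hY /dvdpP[y Ey]]] := eval_surjective_mod_h (f i1 ^+ k * w ^+ q.-1) (leqnn d).
pose F' := 'X_i1 ^+ k - Q ^+ q.-1 * Y.
have hF' : F' \is k.-homog.
  apply: rpredB; first by rewrite -{2}[k]mul1n; apply: dhomogMn; exact: dhomogX_U.
  by apply: dhomogM => //; apply: dhomogMn.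
have [b' Eb'] : exists b', evf F' = h * b'.
  have : h %| evf F'.
    rewrite rmorphB rmorphM !rmorphXn /= evfX evQ.
    have hwq : h %| c ^+ q.-1 * w ^+ q.-1 - 1.
      by rewrite -exprMn -[1](expr1n _ q.-1) subrXX; apply: dvdp_mulr.
    have -> : f i1 ^+ k - c ^+ q.-1 * evf Y =
      c ^+ q.-1 * (f i1 ^+ k * w ^+ q.-1 - evf Y) - f i1 ^+ k * (c ^+ q.-1 * w ^+ q.-1 - 1) by ring.
    by rewrite Ey dvdp_sub // dvdp_mull ?dvdp_mulIr.
  by case/dvdpP=> b' ->; exists b'; rewrite mulrC.
have N_gt0 : (0 < N)%N by rewrite muln_gt0 e_gt0.
have k_gt0 : (0 < k)%N by rewrite addn_gt0 N_gt0 orbT.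
rewrite -(prednK k_gt0) in hF'.
apply: (@J0_cancel_exp (k * q) t.+1) => //; rewrite exprM.
have E : ('X_i1 : A) ^+ k - F' = Q ^+ q.-1 * Y by rewrite /F'; ring.
have := subrXX ('X_i1 ^+ k : A) F' q; set Z := \sum_(_ < _) _; rewrite E => EZ.
have -> : ('X_i1 ^+ k) ^+ q * F = F * F' ^+ q + (Y * Z) * (Q ^+ q.-1 * F).
  have -> : ('X_i1 ^+ k) ^+ q = F' ^+ q + Q ^+ q.-1 * Y * Z by rewrite -EZ; ring.
  by ring.
by apply: J0D; apply: J0M; [apply: J0_power hF' Eb' | apply: J0_conductor hF EF].
Qed.

(** J has value 0 and T_0 has value h; as these and T_i1 generate everything in degrees at least q,
    a factor f_i1 splits off modulo h at each step. *)
Lemma image_mod_h_descent t k (p : A) : (q <= t.+1)%N -> p \is (t + k).-homog ->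
  exists p' : A, p' \is t.-homog /\ h %| evf p - f i1 ^+ k * evf p'.
Proof.
move=> qt; elim: k p => [|k IH] p hp.
  by exists p; rewrite -[t]addn0 mul1r subrr dvdp0.
rewrite addnS in hp.
have qtk : (q <= (t + k).+1)%N by rewrite (leq_trans qt) // ltnS leq_addr.
have sub : [set ord0; i1] \subset [set ord0; i1] by [].
have [x hx] := ideal_rep_generic (@Phi_homog K n q mu s) q_gt0 right_inverse_two_vars sub qtk hp.
rewrite setUC in hx; have [g hg] := killU1_divides hx.
have [g0] := kill1_split ord0 (p - rep x - 'X_i1 * g); rewrite hg add0r => Hg0.
have [p' [hp' dp']] := IH (pihomog mdeg (t + k) g) (pihomogP _ _ _).
exists p'; split=> //.
have Ep : evf p = f i1 * evf (pihomog mdeg (t + k) g) + h * evf (pihomog mdeg (t + k) g0).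
  have := congr1 (fun z => evf (pihomog mdeg (t + k).+1 z)) Hg0.
  rewrite /= !pihomogB !pihomogX !rmorphB !rmorphM /= !evfX evf_pihomog_rep // subr0 pihomog_dE //.
  by move=> <-; ring.
have -> : evf p - f i1 ^+ k.+1 * evf p' =
    f i1 * (evf (pihomog mdeg (t + k) g) - f i1 ^+ k * evf p') +
    evf (pihomog mdeg (t + k) g0) * h by rewrite Ep exprS; ring.
by rewrite dvdp_addr ?dvdp_mulIr // dvdp_mull.
Qed.

(** Surjectivity modulo h is available in degree e D only, so b is multiplied by f_i1^k, hit there,
    and brought down to degree t + 1; then f_i1^k cancels, being coprime to h. The choice D = d + t
    + 1 ensures D >= d and e D >= t + 1. *)
Theorem image_plus_h t (b : {poly K}) : (q <= t.+2)%N -> (size b <= (t.+1 * d).+1)%N ->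
  exists (b' : {poly K}) (p : A), [/\ (size b' <= (t * d).+1)%N, p \is t.+1.-homog &
    b = h * b' + evf p].
Proof.
move=> qt sb; pose D := (d + t.+1)%N; pose k := (e * D - t.+1)%N.
have tk : (t.+1 + k = e * D)%N.
  rewrite subnKC // (leq_trans (leq_addl d t.+1)) //.
  by rewrite -/D leq_pmull // e_gt0.
have [p [hp dp]] := eval_surjective_mod_h (f i1 ^+ k * b) (leq_addr t.+1 d).
rewrite -/D -tk in hp; have [p' [hp' dp']] := image_mod_h_descent qt hp.
have : h %| f i1 ^+ k * (b - evf p').
  have -> : f i1 ^+ k * (b - evf p') = (f i1 ^+ k * b - evf p) + (evf p - f i1 ^+ k * evf p') by ring.
  exact: dvdp_add.
rewrite Gauss_dvdpr; last by apply: coprimep_expr; rewrite coprimep_sym.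
case/dvdpP=> b' Eb'; exists b', p'; split=> //; last by rewrite mulrC -Eb'; ring.
apply: (size_quotient size_f0); rewrite mulrC -Eb'.
apply: leq_trans (size_polyD _ _) _; rewrite geq_max size_polyN.
have -> : ((t * d).+1 + d = (t.+1 * d).+1)%N by rewrite mulSn addSn addnC.
by rewrite sb size_evf.
Qed.

End GeneralPosition.

Definition infinite_field (K : fieldType) : Prop :=
  forall m, exists T : seq K, uniq T /\ size T = m.

(** * Choice of coordinates *)

Section GeneralCombination.
Variable K : fieldType.
Hypothesis K_inf : infinite_field K.
Implicit Types (c p g z : {poly K}).

(* For distinct x the divisors gcd(c, p + x g) of c are pairwise coprime. *)
Lemma coprime_combination c p g m (T : seq K) : c != 0 ->
  (forall z, z %| c -> z %| p -> z %| g -> z %= 1) ->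
  uniq T -> (size c + m <= size T)%N ->
  exists T' : seq K, [/\ uniq T', (m < size T')%N, {subset T' <= T} &
    forall x, x \in T' -> coprimep c (p + x *: g)].
Proof.
move=> c0 cpg uT sT.
pose bad := [seq x <- T | ~~ coprimep c (p + x *: g)].
exists [seq x <- T | coprimep c (p + x *: g)]; split.
- exact: filter_uniq.
- have E : (size [seq x <- T | coprimep c (p + x *: g)] + size bad)%N = size T.
    by rewrite !size_filter; apply: count_predC.
  suff lt : (size bad < size c)%N.
    rewrite -(ltn_add2r (size bad)) E; apply: leq_trans sT.
    by rewrite addnC ltn_add2r.
  have [] : \prod_(x <- bad) gcdp c (p + x *: g) %| c /\
      (size bad < size (\prod_(x <- bad) gcdp c (p + x *: g))%R)%N.
    have : uniq bad by apply: filter_uniq.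
    have : all (fun x => ~~ coprimep c (p + x *: g)) bad by apply: filter_all.
    clear E; elim: bad => [|x s IH] /=; first by rewrite big_nil dvd1p size_poly1.
    case/andP=> hx hs /andP[xs us]; have [d1 d2] := IH hs us.
    rewrite big_cons; split.
      rewrite Gauss_dvdp ?dvdp_gcdl //; apply/coprimepP => z z1 z2.
      have : coprimep (gcdp c (p + x *: g)) (\prod_(y <- s) gcdp c (p + y *: g)).
        elim: (s) xs => [|y s' IH']; first by rewrite big_nil coprimep1.
        rewrite inE negb_or big_cons coprimepMr => /andP[xy /IH' ->]; rewrite andbT.
        apply/coprimepP => z'; rewrite !dvdp_gcd => /andP[zc zx] /andP[_ zy].
        have zg : z' %| g.
          have : z' %| (p + x *: g) - (p + y *: g) by apply: dvdp_sub.
          have -> : (p + x *: g) - (p + y *: g) = (x - y) *: g.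
            by rewrite scalerBl; ring.
          by rewrite dvdpZr // subr_eq0.
        apply: cpg => //; rewrite -(dvdp_addl _ (_ : z' %| x *: g)) //.
        by rewrite -mul_polyC dvdp_mull.
      by move/coprimepP; apply.
    have g0 : gcdp c (p + x *: g) != 0 by rewrite gcdp_eq0 (negbTE c0).
    have P0 : \prod_(y <- s) gcdp c (p + y *: g) != 0.
      by rewrite prodf_seq_neq0; apply/allP => y _; rewrite gcdp_eq0 (negbTE c0).
    have sg : (1 < size (gcdp c (p + x *: g)%R))%N.
      by rewrite ltn_neqAle eq_sym hx lt0n size_poly_eq0.
    have arith (i j k : nat) : (1 < i -> k < j -> k.+1 < (i + j).-1)%N by lia.
    by rewrite size_mul //; apply: arith.
  by move=> d1 d2; apply: leq_trans d2 _; exact: dvdp_leq.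
- by move=> x; rewrite mem_filter => /andP[].
- by move=> x; rewrite mem_filter => /andP[].
Qed.

(** Division by the common factor e of c, p and g reduces to [coprime_combination]. Two good values
    of x are kept, because the top coefficient can vanish for one of them. *)
Lemma combine_two c p g d : c != 0 -> exists x,
  (forall z, z %| c -> z %| p + x *: g -> z %| p /\ z %| g) /\
  (p`_d != 0 \/ g`_d != 0 -> (p + x *: g)`_d != 0).
Proof.
move=> c0; pose e := gcdp c (gcdp p g).
have e0 : e != 0 by rewrite gcdp_eq0 (negbTE c0).
have [ec ep eg] : [/\ e %| c, e %| p & e %| g].
  split; first exact: dvdp_gcdl.
    by apply: dvdp_trans (dvdp_gcdr _ _) (dvdp_gcdl _ _).
  by apply: dvdp_trans (dvdp_gcdr _ _) (dvdp_gcdr _ _).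
have [c1 Ec] := dvdpP _ _ ec; have [p1 Ep] := dvdpP _ _ ep; have [g1 Eg] := dvdpP _ _ eg.
have c10 : c1 != 0 by apply: contraNneq c0 => c10; rewrite Ec c10 mul0r.
have cop z : z %| c1 -> z %| p1 -> z %| g1 -> z %= 1.
  move=> zc zp zg; have : z * e %| e.
    by rewrite {2}/e !dvdp_gcd Ec Ep Eg !dvdp_mul.
  by rewrite -{2}[e]mul1r dvdp_mul2r // dvdp1 size_poly_eq1.
have [T [uT sT]] := K_inf (size c1 + 1).
have [|T' [uT' sT' _ HT']] := coprime_combination c10 cop uT (m := 1); first by rewrite sT.
have [x xT' hx] : exists2 x, x \in T' & (p`_d != 0 \/ g`_d != 0 -> (p + x *: g)`_d != 0).
  case: T' uT' sT' {HT'} => [|x [|y s]] //= /andP[xs _] _.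
  have [gd|gd] := eqVneq g`_d 0.
    by exists x; rewrite ?mem_head // => -[pd|/eqP //]; rewrite coefD coefZ gd mulr0 addr0.
  have [px|px] := eqVneq (p + x *: g)`_d 0; last by exists x; rewrite ?mem_head.
  exists y; first by rewrite !inE eqxx orbT.
  move=> _; apply/eqP => py; move: xs; rewrite inE negb_or => /andP[/eqP xy _]; apply: xy.
  move: px py; rewrite !coefD !coefZ => px py; apply: (mulIf gd).
  by apply: (addrI p`_d); rewrite px py.
exists x; split=> // z zc zx.
have /Bezout_eq1_coprimepP[[v v'] /= E] := HT' _ xT'.
have ze : z %| e.
  have -> : e = v * c + v' * (p + x *: g).
    rewrite Ec Ep Eg -[LHS]mul1r -E -!mul_polyC; ring.
  by apply: dvdp_add; apply: dvdp_mull.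
by split; apply: dvdp_trans ze _.
Qed.

Lemma combine_seq (I : eqType) (t : seq I) (F : I -> {poly K}) c p d : c != 0 -> uniq t ->
  exists x : I -> K,
  (forall z, z %| c -> z %| p + \sum_(l <- t) x l *: F l ->
     z %| p /\ forall l, l \in t -> z %| F l) /\
  (p`_d != 0 \/ (exists2 l, l \in t & (F l)`_d != 0) ->
     (p + \sum_(l <- t) x l *: F l)`_d != 0).
Proof.
move=> c0; elim: t p => [|l t IH] p /=.
  move=> _; exists (fun=> 0); split; first by move=> z _; rewrite big_nil addr0.
  by rewrite big_nil addr0 => -[|[]].
case/andP=> lt ut; have [y [y1 y2]] := combine_two p (F l) d c0.
have [x [x1 x2]] := IH (p + y *: F l) ut.
exists (fun j => if j == l then y else x j).
rewrite big_cons eqxx addrA (eq_big_seq (fun j => x j *: F j)) => [|j jt]; last first.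
  by case: eqVneq jt => // ->; rewrite (negbTE lt).
split.
  move=> z zc /(x1 z zc)[/(y1 z zc)[zp zl] zt]; split=> // j.
  by rewrite inE => /predU1P[->|/zt].
move=> H; apply: x2; case: H => [pd|[j]]; first by left; apply: y2; left.
rewrite inE => /predU1P[->|jt] jd; first by left; apply: y2; right.
by right; exists j.
Qed.

End GeneralCombination.

Section LinearChange.
Variables (K : fieldType) (n : nat).
Local Notation A := {mpoly K[n.+1]}.
Implicit Types (f : 'I_n.+1 -> {poly K}) (g : 'M[K]_n.+1).

Definition lin g f l : {poly K} := \sum_m g l m *: f m.

Definition in_image f t (b : {poly K}) : Prop := exists p : A, p \is t.-homog /\ evf f p = b.

Lemma lin_lin g g' f l : lin g (lin g' f) l = lin (g *m g') f l.
Proof.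
rewrite /lin; under eq_bigr do rewrite scaler_sumr.
rewrite exchange_big; apply: eq_bigr => m _.
rewrite mxE scaler_suml; apply: eq_bigr => j _; exact: scalerA.
Qed.

Lemma lin1 f l : lin 1%:M f l = f l.
Proof.
rewrite /lin (bigD1 l) //= mxE eqxx scale1r big1 ?addr0 // => m ml.
by rewrite mxE eq_sym (negbTE ml) scale0r.
Qed.

Lemma evf_ext f f' : f =1 f' -> evf f =1 evf f'.
Proof. by move=> e p; apply: eq_bigr => m _; congr (_ * _); apply: mmap1_eq. Qed.

Lemma in_image_ext f f' t b : f =1 f' -> in_image f t b -> in_image f' t b.
Proof. by move=> e [p [hp <-]]; exists p; split=> //; apply: evf_ext => l; rewrite e. Qed.

Lemma in_image_lin g f t b : in_image (lin g f) t b -> in_image f t b.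
Proof.
case=> p [hp <-]; pose v : n.+1.-tuple A := [tuple \sum_m g l m *: 'X_m | l < n.+1].
exists (p \mPo v); split.
  rewrite -[t]mul1n; apply: dhomog_comp => // l; rewrite tnth_mktuple.
  by apply: rpred_sum => m _; apply: rpredZ; exact: dhomogX_U.
apply: (@mpoly_rmorphism_ext K n.+1 _
  (GRing.RMorphism.clone _ _ (evf f \o comp_mpoly v) _) (evf (lin g f))).
  by move=> c /=; rewrite comp_mpolyC !evfC.
move=> l /=; rewrite comp_mpolyXU -tnth_nth tnth_mktuple evfX rmorph_sum.
by apply: eq_bigr => m _; rewrite -mul_mpolyC rmorphM /= evfC evfX mul_polyC.
Qed.

Lemma in_image_linV g f t b : g \in unitmx -> in_image f t b -> in_image (lin g f) t b.
Proof.
move=> ug hb; apply: (@in_image_lin (invmx g)); apply: in_image_ext hb => l.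
by rewrite lin_lin mulVmx // lin1.
Qed.

End LinearChange.

Section Coordinates.
Variables (K : fieldType) (n d q : nat) (mu : 'I_n -> nat) (f : 'I_n.+1 -> {poly K}).
Variables (S : 'M[{poly K}]_(n, n.+1)) (U : 'rV[{poly K}]_n.+1) (T : 'M[{poly K}]_(n.+1, n)).
Variables (e : nat) (c : {poly K}).
Local Notation F := (\col_l f l).

Hypothesis K_inf : infinite_field K.
Hypothesis size_f : forall l, (size (f l) <= d.+1)%N.
Hypothesis top_f : exists l, (f l)`_d != 0.
Hypothesis size_S : forall i l, (size (S i l) <= (mu i).+1)%N.
Hypothesis SF : S *m F = 0.
Hypothesis UF : U *m F = 1%:M.
Hypothesis TS : T *m S = 1%:M - F *m U.
Hypothesis lead_free : row_free (\matrix_(i, l) (S i l)`_(mu i)).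
Hypothesis mu_q : forall i j, i != j -> (mu i + mu j <= q)%N.
Hypothesis mu_le_q : forall i, (mu i <= q)%N.
Hypothesis q_gt0 : (0 < q)%N.
Hypothesis d_gt0 : (0 < d)%N.
Hypothesis n_gt0 : (0 < n)%N.
Hypothesis xc_image : in_image f e ('X * c).
Hypothesis c_image : in_image f e c.
Hypothesis c_neq0 : c != 0.

Let i1 : 'I_n.+1 := lift ord0 (Ordinal n_gt0).

Let common_divisor z : (forall l, z %| f l) -> z %= 1.
Proof.
move=> zf; rewrite -size_poly_eq1 -dvdp1; have /matrixP/(_ ord0 ord0) := UF.
rewrite !mxE eqxx mulr1n => <-; elim/big_ind: _ => [|x y|l _]; first exact: dvdp0.
  exact: dvdp_add.
by rewrite mxE dvdp_mull.
Qed.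

(** The unitriangular [g1] replaces f_0 by h, of full degree and coprime to c, and f_i1 by h',
    coprime to h. Then [g2] subtracts multiples of h to cancel the other coefficients of degree d,
    which preserves coprimality with h. *)
Lemma general_coordinates : exists g : 'M[K]_n.+1, [/\ g \in unitmx,
  size (lin g f ord0) = d.+1, forall l, l != ord0 -> (size (lin g f l) <= d)%N,
  coprimep (lin g f i1) (lin g f ord0) & coprimep c (lin g f ord0)].
Proof.
have sumE (P : pred 'I_n.+1) (G : 'I_n.+1 -> {poly K}) :
    \sum_(l <- [seq l <- enum 'I_n.+1 | P l]) G l = \sum_(l | P l) G l.
  by rewrite big_filter big_enum_cond.
pose t := [seq l <- enum 'I_n.+1 | l != ord0].
pose t' := [seq l <- enum 'I_n.+1 | (l != ord0) && (l != i1)].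
have [x [x1 x2]] := combine_seq K_inf f (f ord0) d c_neq0 (filter_uniq (fun l => l != ord0) (enum_uniq 'I_n.+1)).
rewrite -/t sumE in x1 x2; set h := f ord0 + _ in x1 x2.
have hd : h`_d != 0.
  apply: x2; have [l fl] := top_f; have [l0|l0] := eqVneq l ord0; first by left; rewrite -l0.
  by right; exists l => //; rewrite mem_filter l0 mem_enum.
have h0 : h != 0 by apply: contraNneq hd => ->; rewrite coef0.
have [x' [x'1 _]] := combine_seq K_inf f (f i1) d h0
  (filter_uniq (fun l => (l != ord0) && (l != i1)) (enum_uniq 'I_n.+1)).
rewrite -/t' sumE in x'1; set h' := f i1 + _ in x'1.
have coph z : z %| c -> z %| h -> z %= 1.
  move=> zc /(x1 z zc)[z0 zt]; apply: common_divisor => l.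
  by have [->//|l0] := eqVneq l ord0; apply: zt; rewrite mem_filter l0 mem_enum.
have coph' z : z %| h -> z %| h' -> z %= 1.
  move=> zh /(x'1 z zh)[z1 zt].
  have zl l : l != ord0 -> z %| f l.
    have [->//|l1 l0] := eqVneq l i1.
    by apply: zt; rewrite mem_filter l0 l1 mem_enum.
  apply: common_divisor => l; have [->|/zl //] := eqVneq l ord0.
  (* f_0 does not occur in h', but it is recovered from h and the other f_l. *)
  have -> : f ord0 = h - \sum_(l | l != ord0) x l *: f l by rewrite /h; ring.
  apply: dvdp_sub => //; elim/big_ind: _ => [|y z'|m m0]; first exact: dvdp0.
    exact: dvdp_add.
  by rewrite -mul_polyC dvdp_mull // zl.
pose g1 : 'M[K]_n.+1 := \matrix_(l, m)
  if l == ord0 then (if m == ord0 then 1 else x m)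
  else if l == i1 then (if m == i1 then 1 else if m == ord0 then 0 else x' m)
  else (l == m)%:R.
have i10 : i1 != ord0 by [].
have g10 : lin g1 f ord0 = h.
  rewrite /lin (bigD1 ord0) //= mxE !eqxx scale1r; congr (_ + _).
  by apply: eq_bigr => m m0; rewrite mxE eqxx (negbTE m0).
have g11 : lin g1 f i1 = h'.
  rewrite /lin (bigD1 i1) //= mxE (negbTE i10) !eqxx scale1r; congr (_ + _).
  rewrite (bigD1 ord0) ?[_ == i1]eq_sym //= mxE (negbTE i10) eqxx [ord0 == _]eq_sym (negbTE i10) eqxx.
  rewrite scale0r add0r; apply: eq_big => [m|m /andP[m1 m0]]; first by rewrite andbC.
  by rewrite mxE (negbTE i10) eqxx (negbTE m0) (negbTE m1).
pose ga l := (lin g1 f l)`_d / h`_d.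
pose g2 : 'M[K]_n.+1 := \matrix_(l, m) ((l == m)%:R - (if (m == ord0) && (l != ord0) then ga l else 0)).
have g20 f' : lin g2 f' ord0 = f' ord0.
  rewrite /lin (bigD1 ord0) //= mxE !eqxx andbF subr0 scale1r big1 ?addr0 // => m m0.
  by rewrite mxE (negbTE m0) eq_sym (negbTE m0) subr0 scale0r.
have g2l f' l : l != ord0 -> lin g2 f' l = f' l - ga l *: f' ord0.
  move=> l0; rewrite /lin (bigD1 ord0) //= (bigD1 l) //= !mxE !eqxx !(negbTE l0) /=.
  rewrite subr0 scale1r sub0r big1 ?addr0 => [|m /andP[m0 ml]]; first by rewrite scaleNr addrC.
  by rewrite mxE (negbTE m0) eq_sym (negbTE ml) subr0 scale0r.
have g1U : g1 \in unitmx.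
  rewrite unitmxE -det_tr det_trig; last first.
    apply/is_trig_mxP => m l ml; rewrite !mxE.
    have l0 : l != ord0 by rewrite -lt0n; apply: leq_ltn_trans ml.
    have lm : (l == m) = false by rewrite -val_eqE /= gtn_eqF.
    rewrite (negbTE l0) lm; case: eqVneq => // l1.
    have -> : m = ord0 by apply: val_inj; move: ml; rewrite l1 /= /bump; case: (m : nat).
    by rewrite eq_sym (negbTE i10) eqxx.
  rewrite big1 ?unitr1 // => l _; rewrite !mxE eqxx.
  by case: (l == ord0); case: (l == i1).
have g2U : g2 \in unitmx.
  rewrite unitmxE det_trig; last first.
    apply/is_trig_mxP => l m lm; rewrite !mxE.
    have m0 : m != ord0 by rewrite -lt0n; apply: leq_ltn_trans lm.
    by rewrite (negbTE m0) subr0 -val_eqE /= ltn_eqF.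
  rewrite big1 ?unitr1 // => l _; rewrite !mxE eqxx.
  by case: (l == ord0); rewrite subr0.
have Eg l : lin (g2 *m g1) f l = lin g2 (lin g1 f) l by rewrite lin_lin.
have sz (y : 'I_n.+1 -> K) (P : pred 'I_n.+1) : (size (\sum_(l | P l) y l *: f l)%R <= d.+1)%N.
  by apply: size_sum_le => l _; apply: leq_trans (size_scale_leq _ _) _.
have E0 : lin (g2 *m g1) f ord0 = h by rewrite Eg g20.
exists (g2 *m g1); split.
- by rewrite unitmx_mul g2U g1U.
- rewrite E0; apply/eqP; rewrite eqn_leq; apply/andP; split.
    by rewrite -g10; apply: sz.
  by rewrite ltnNge; apply: contra hd => /leq_sizeP ->.
- move=> l l0; rewrite Eg g2l // g10; apply: size_sub_top; first exact: sz.
    by apply: leq_trans (size_scale_leq _ _) _; rewrite -g10; apply: sz.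
  by rewrite coefZ divfK.
- rewrite E0 Eg g2l // g10 g11; apply/coprimepP => z z1 zh; apply: coph' => //.
  have -> : h' = (h' - ga i1 *: h) + ga i1 *: h by ring.
  by apply: dvdp_add => //; rewrite -mul_polyC dvdp_mull.
- by rewrite E0; apply/coprimepP.
Qed.

(** (I) and (S) return to the original coordinates because the spaces N_t do not change under linear
    substitutions. The coefficients v and v' are kept since the Koszul homotopies of h and h' wedge
    with them. *)
Theorem image_structure : exists v v' : 'I_n.+1 -> K,
  let h : {poly K} := \sum_l v l *: f l in let h' : {poly K} := \sum_l v' l *: f l in
  [/\ size h = d.+1, coprimep h' h,
    forall t (b : {poly K}), (q <= t.+1)%N -> in_image f t.+1 (h * b) -> in_image f t b &
    forall t (b : {poly K}), (q <= t.+2)%N -> (size b <= (t.+1 * d).+1)%N ->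
      exists b' p : {poly K}, [/\ (size b' <= (t * d).+1)%N, in_image f t.+1 p & b = h * b' + p]].
Proof.
have [g [gU sz0 szS cop copc]] := general_coordinates.
exists (g ord0), (g i1); rewrite -/(lin g f ord0) -/(lin g f i1) /=.
pose G : 'M[{poly K}]_n.+1 := map_mx polyC g.
pose Gi : 'M[{poly K}]_n.+1 := map_mx polyC (invmx g).
have GGi : G *m Gi = 1%:M by rewrite -map_mxM mulmxV // map_mx1.
have GiG : Gi *m G = 1%:M by rewrite -map_mxM mulVmx // map_mx1.
pose f' := lin g f.
have GF : G *m F = \col_l f' l.
  apply/matrixP => l j; rewrite !mxE; apply: eq_bigr => m _.
  by rewrite !mxE mul_polyC.
pose S' := S *m Gi; pose U' := U *m Gi; pose T' := G *m T.
have SF' : S' *m (\col_l f' l) = 0 by rewrite -GF mulmxA -(mulmxA S) GiG mulmx1.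
have UF' : U' *m (\col_l f' l) = 1%:M by rewrite -GF mulmxA -(mulmxA U) GiG mulmx1.
have TS' : T' *m S' = 1%:M - (\col_l f' l) *m U'.
  rewrite /T' /S' mulmxA -(mulmxA G) TS mulmxBr mulmx1 mulmxBl GGi -GF.
  by rewrite /U' !mulmxA.
have size_f' l : (size (f' l) <= d.+1)%N.
  by apply: size_sum_le => m _; apply: leq_trans (size_scale_leq _ _) _.
have S'E i l : S' i l = \sum_m (invmx g m l) *: S i m.
  by rewrite mxE; apply: eq_bigr => m _; rewrite mxE mulrC mul_polyC.
have size_S' i l : (size (S' i l) <= (mu i).+1)%N.
  by rewrite S'E; apply: size_sum_le => m _; apply: leq_trans (size_scale_leq _ _) _.
pose La := \matrix_(i, l) (S i l)`_(mu i).
have lamE i l : (S' i l)`_(mu i) = (La *m invmx g) i l.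
  rewrite S'E coef_sum mxE; apply: eq_bigr => m _; rewrite coefZ mxE; exact: mulrC.
have syz' i : \sum_l S' i l * f' l = 0.
  have /matrixP/(_ i ord0) := SF'; rewrite mxE [RHS]mxE => E; rewrite -[RHS]E.
  by apply: eq_bigr => l _; congr (_ * _); rewrite mxE.
have lam0 i : (S' i ord0)`_(mu i) = 0.
  (* In this degree the syzygy involves only the leading coefficient of f_0. *)
  have := congr1 (fun p : {poly K} => p`_(mu i + d)) (syz' i).
  rewrite coef0 coef_sum (bigD1 ord0) //= coefM_top // big1 => [|l l0]; last first.
    by rewrite coefM_top // (leq_sizeP _ _ (szS l l0)) ?mulr0.
  move/eqP; rewrite addr0 mulf_eq0 => /orP[/eqP //|].
  have := lead_coef_eq0 (f' ord0); rewrite lead_coefE sz0 /= => ->.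
  by rewrite -size_poly_eq0 sz0.
have /row_freeP[B HB] : row_free (La *m invmx g).
  by rewrite row_free_unit_mul || rewrite /row_free mxrankMfree // row_free_unit unitmx_inv.
pose M l i := if l == ord0 then 0 else B l i.
have lamM i j : \sum_l (S' i l)`_(mu i) * M l j = (i == j)%:R.
  have /matrixP/(_ i j) := HB; rewrite !mxE => <-; apply: eq_bigr => l _.
  rewrite /M lamE; case: eqVneq => [->|//]; by rewrite -lamE lam0 !mul0r.
have Mlam l m : \sum_i M l i * (S' i m)`_(mu i) = ((l == m) && (l != ord0))%:R.
  have [->|l0] := eqVneq l ord0.
    by rewrite andbF big1 // => i _; rewrite /M eqxx mul0r.
  rewrite andbT; have [->|m0] := eqVneq m ord0.
    by rewrite (negbTE l0) big1 // => i _; rewrite lam0 mulr0.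
  (* Without its zero column the leading matrix is square, so a right inverse is also a left
     inverse. *)
  pose C := \matrix_(i, j) (S' i (lift ord0 j))`_(mu i).
  pose D := \matrix_(j, i) B (lift ord0 j) i.
  have CD : C *m D = 1%:M.
    apply/matrixP => i j; rewrite mxE [RHS]mxE -(lamM i j) big_ord_recl lam0 mul0r add0r.
    by apply: eq_bigr => k _; rewrite !mxE /M.
  have /matrixP := mulmx1C CD.
  have [l' ->|] := unliftP ord0 l; last by move/eqP; rewrite (negbTE l0).
  have [m' ->|] := unliftP ord0 m; last by move/eqP; rewrite (negbTE m0).
  move=> /(_ l' m'); rewrite !mxE (inj_eq lift_inj) => <-.
  by apply: eq_bigr => i _; rewrite !mxE /M.
have uf1 : \sum_l U' ord0 l * f' l = 1.
  have /matrixP/(_ ord0 ord0) := UF'; rewrite mxE [RHS]mxE eqxx => E; rewrite -[RHS]E.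
  by apply: eq_bigr => l _; congr (_ * _); rewrite mxE.
have syz_gen l m : (l == m)%:R - f' l * U' ord0 m = \sum_i T' l i * S' i m.
  have /matrixP/(_ l m) := TS'; rewrite [LHS]mxE => ->.
  rewrite [RHS]mxE; congr (_ + _); first by rewrite mxE.
  by rewrite [RHS]mxE [in RHS]mxE big_ord1; congr (- (_ * _)); rewrite mxE.
have [P [hP EP]] := in_image_linV gU xc_image.
have [Q [hQ EQ]] := in_image_linV gU c_image.
have i10 : i1 != ord0 by [].
have core1 := @quotient_h_in_image K n d q mu f' (U' ord0) (fun i l => S' i l)
  (fun l i => T' l i) M size_f' sz0 szS size_S' syz' uf1 syz_gen lam0 lamM Mlam mu_q mu_le_q
  i1 e P Q c i10 q_gt0 d_gt0 cop hP hQ EP EQ c_neq0 copc.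
have core2 := @image_plus_h K n d q mu f' (U' ord0) (fun i l => S' i l)
  (fun l i => T' l i) M size_f' sz0 szS size_S' syz' uf1 syz_gen lam0 lamM Mlam mu_q mu_le_q
  i1 e P Q c i10 q_gt0 d_gt0 cop hP hQ EP EQ c_neq0 copc.
split=> //.
- move=> t b qt hb; have [p [hp Ep]] := in_image_linV gU hb.
  have [E [hE EE]] := core1 t p b qt hp Ep.
  by apply: (@in_image_lin _ _ g); exists E.
- move=> t b qt sb; have [b' [p [sb' hp Eb]]] := core2 t b qt sb.
  exists b', (evf f' p); split=> //.
  by apply: (@in_image_lin _ _ g); exists p.
Qed.

End Coordinates.

Section ImageRing.
Variables (K : fieldType) (n : nat) (f : 'I_n.+1 -> {poly K}).

Lemma in_image0 t : in_image f t 0.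
Proof. by exists 0; split; [exact: dhomog0 | exact: rmorph0]. Qed.

Lemma in_imageD t x y : in_image f t x -> in_image f t y -> in_image f t (x + y).
Proof.
by case=> p [hp <-] [p' [hp' <-]]; exists (p + p'); split; [exact: rpredD | exact: rmorphD].
Qed.

Lemma in_imageZ t (c : K) x : in_image f t x -> in_image f t (c%:P * x).
Proof.
case=> p [hp <-]; exists (c%:MP * p); split; first by rewrite mul_mpolyC; exact: rpredZ.
by rewrite rmorphM /= evfC.
Qed.

Lemma in_imageB t x y : in_image f t x -> in_image f t y -> in_image f t (x - y).
Proof.
move=> hx hy; have -> : x - y = x + (- 1)%:P * y by rewrite polyCN mulN1r.
by apply: in_imageD => //; apply: in_imageZ.
Qed.

Lemma in_image_var t l x : in_image f t x -> in_image f t.+1 (f l * x).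
Proof.
case=> p [hp <-]; exists ('X_l * p); split; first exact: dhomogXM.
by rewrite rmorphM /= evfX.
Qed.

Lemma in_image_sum t (I : finType) (P : pred I) (F : I -> {poly K}) :
  (forall i, P i -> in_image f t (F i)) -> in_image f t (\sum_(i | P i) F i).
Proof. by move=> h; elim/big_ind: _ => //; [exact: in_image0 | exact: in_imageD]. Qed.

Lemma ksg_polyC (S : {set 'I_n.+1}) l : ksg {poly K} S l = (ksg K S l)%:P.
Proof. by rewrite /ksg -polyC1 -polyCN rmorphXn. Qed.

Lemma in_image_contract t c (S : {set 'I_n.+1}) :
  (forall S' : {set 'I_n.+1}, #|S'| = #|S|.+1 -> in_image f t (c S')) -> in_image f t.+1 (contract f c S).
Proof.
move=> hc; apply: in_image_sum => l lS; rewrite -mulrA ksg_polyC; apply: in_imageZ.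
by apply: in_image_var; apply: hc; rewrite cardsU1 lS.
Qed.

Lemma in_image_wedge t (v : 'I_n.+1 -> K) c (S : {set 'I_n.+1}) :
  (forall S' : {set 'I_n.+1}, #|S'|.+1 = #|S| -> in_image f t (c S')) ->
  in_image f t (wedge (fun l => (v l)%:P) c S).
Proof.
move=> hc; apply: in_image_sum => l lS; rewrite -mulrA ksg_polyC; do 2!apply: in_imageZ.
by apply: hc; rewrite [RHS](cardsD1 l) lS.
Qed.

Lemma size_wedge (v : 'I_n.+1 -> K) (c : {set 'I_n.+1} -> {poly K}) (S : {set 'I_n.+1}) m :
  (forall S', (size (c S') <= m)%N) -> (size (wedge (fun l => (v l)%:P) c S) <= m)%N.
Proof.
move=> hc; apply: size_sum_le => l _; rewrite ksg_polyC -mulrA !mul_polyC.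
by do 2!(apply: leq_trans (size_scale_leq _ _) _).
Qed.

End ImageRing.

(** * Koszul homology of the coordinate ring *)

Section KoszulChase.
Variables (K : fieldType) (n d q : nat) (f : 'I_n.+1 -> {poly K}) (v v' : 'I_n.+1 -> K).
Local Notation h := (\sum_l v l *: f l).
Local Notation h' := (\sum_l v' l *: f l).
Local Notation e := (fun l => (v l)%:P).
Local Notation e' := (fun l => (v' l)%:P).
Hypothesis size_f : forall l, (size (f l) <= d.+1)%N.
Hypothesis size_h : size h = d.+1.
Hypothesis cop_h : coprimep h' h.
Hypothesis quot_h : forall t (b : {poly K}), (q <= t.+1)%N ->
  in_image f t.+1 (h * b) -> in_image f t b.
Hypothesis plus_h : forall t (b : {poly K}), (q <= t.+2)%N -> (size b <= (t.+1 * d).+1)%N ->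
  exists b' p : {poly K}, [/\ (size b' <= (t * d).+1)%N, in_image f t.+1 p & b = h * b' + p].

Let homotopy c S : contract f (wedge e c) S + wedge e (contract f c) S = h * c S.
Proof.
by rewrite wedge_contract; congr (_ * _); apply: eq_bigr => l _; rewrite mulrC mul_polyC.
Qed.

Let homotopy' c S : contract f (wedge e' c) S + wedge e' (contract f c) S = h' * c S.
Proof.
by rewrite wedge_contract; congr (_ * _); apply: eq_bigr => l _; rewrite mulrC mul_polyC.
Qed.

Let h_neq0 : h != 0.
Proof. by rewrite -size_poly_eq0 size_h. Qed.

(** Write c = h' c' + h c1 with c' of size at most d. Since h divides [contract f c'], the homotopy
    of h' turns h' c' into a boundary plus a multiple of h; what remains is h times a cycle, a
    boundary by the homotopy of h. The condition on t ensures d <= t d + 1, as c' enters the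
    answer. *)
Lemma koszul_form_exact t (c : {set 'I_n.+1} -> {poly K}) : ((0 < t)%N || (d <= 1)%N) ->
  (forall S, (size (c S) <= (t.+1 * d).+1)%N) -> (forall S, contract f c S = 0) ->
  exists b : {set 'I_n.+1} -> {poly K}, (forall S, (size (b S) <= (t * d).+1)%N) /\ forall S, c S = contract f b S.
Proof.
move=> td sc dc.
have dtd : (d <= (t * d).+1)%N.
  by case/orP: td => [t0|d1]; [rewrite leqW // leq_pmull | rewrite (leq_trans d1)].
have size_h' : (size h' <= d.+1)%N.
  by apply: size_sum_le => l _; apply: leq_trans (size_scale_leq _ _) _.
have /fin_all_exists[x Hx] S : exists x : {poly K} * {poly K},
    [/\ c S = h' * x.1 + h * x.2, (size x.1 <= d)%N & (size x.2 <= (t * d).+1)%N].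
  have [||b [b' [E sb sb']]] := coprime_division size_h cop_h size_h' (N := ((t * d).+1 + d)%N) _ _ (p := c S).
  - by have := sc S; rewrite mulSn addSn addnC.
  - by rewrite mul2n -addnn leq_add2r.
  by exists (b, b'); split=> //; move: sb'; rewrite addnK.
pose c' S := (x S).1; pose c1 S := (x S).2.
have Ec S : c S = h' * c' S + h * c1 S by case: (Hx S).
have dEc S : h' * contract f c' S + h * contract f c1 S = 0.
  rewrite -!contractZ -contractD -[RHS](dc S); apply: eq_contract => S'.
  by rewrite Ec.
have /fin_all_exists[k Hk] S : exists k, contract f c' S = h * k.
  have : h %| contract f c' S.
    rewrite -(Gauss_dvdpr _ (_ : coprimep h h')); last by rewrite coprimep_sym.
    have /eqP := dEc S; rewrite addr_eq0 => /eqP ->.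
    by rewrite -mulrN dvdp_mulIl.
  by case/dvdpP=> k ->; exists k; rewrite mulrC.
pose c2 S := c1 S + wedge e' k S.
have Ec2 S : c S = contract f (wedge e' c') S + h * c2 S.
  rewrite Ec -homotopy' /c2 mulrDr (eq_wedge _ Hk) wedgeZ; ring.
have dc2 S : contract f c2 S = 0.
  apply: (mulfI h_neq0); rewrite mulr0 -contractZ -[RHS](dc S).
  rewrite (eq_contract _ Ec2) contractD contract_contract add0r.
  by [].
exists (fun S => wedge e' c' S + wedge e c2 S); split=> S.
  have sk S' : (size (k S') <= d)%N.
    apply: (size_quotient size_h); rewrite -Hk; apply: size_sum_le => l _.
    rewrite ksg_polyC -mulrA mul_polyC; apply: leq_trans (size_scale_leq _ _) _.
    apply: leq_trans (size_polyMleq _ _) _.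
    have [_ hc' _] := Hx (l |: S'); have := leq_add (size_f l) hc'.
    by rewrite addSn; case: (_ + _)%N.
  apply: leq_trans (size_polyD _ _) _; rewrite geq_max; apply/andP; split.
    by apply: size_wedge => S'; case: (Hx S') => _ hc' _; apply: leq_trans hc' _.
  apply: size_wedge => S'; apply: leq_trans (size_polyD _ _) _; rewrite geq_max.
  apply/andP; split; first by case: (Hx S').
  by apply: size_wedge => S''; apply: leq_trans (sk S'') _.
rewrite contractD Ec2 -homotopy (_ : wedge e (contract f c2) S = 0) ?addr0 //.
by rewrite -(wedge0 e S); apply: eq_wedge.
Qed.

(** Write the primitive of c by forms as h b' + p, by (S). Then h [contract f b'] is c minus a
    boundary from the image, so (I) puts [contract f b'] in the image, and h b' may be replaced by
    its wedge with v: the two differ by a boundary. *)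
Lemma koszul_image_exact t i (c : {set 'I_n.+1} -> {poly K}) :
  (q <= t.+1)%N -> ((0 < t)%N || (d <= 1)%N) ->
  (forall S : {set 'I_n.+1}, #|S| = i -> in_image f t.+1 (c S)) ->
  (forall S : {set 'I_n.+1}, #|S|.+1 = i -> contract f c S = 0) ->
  exists b : {set 'I_n.+1} -> {poly K}, (forall S : {set 'I_n.+1}, #|S| = i.+1 -> in_image f t (b S)) /\
    forall S : {set 'I_n.+1}, #|S| = i -> c S = contract f b S.
Proof.
move=> qt td hc dc.
pose c0 (S : {set 'I_n.+1}) : {poly K} := if #|S| == i then c S else 0.
have [||b0 [sb0 Eb0]] := @koszul_form_exact t c0 td.
- move=> S; rewrite /c0; case: eqP => [/hc[p [hp <-]]|_]; last by rewrite size_poly0.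
  exact: size_evf.
- move=> S; have [Si|Si] := eqVneq #|S|.+1 i.
    rewrite -[RHS](dc S Si); apply: contract_card => S' cS'.
    by rewrite /c0 cS' Si eqxx.
  rewrite -[RHS](contract0 f S); apply: contract_card => S' cS'.
  by rewrite /c0 cS' (negbTE Si).
(* In degree 0 the forms are the constants, all of them in the image; (S) starts with degree 1. *)
case: t qt td hc sb0 => [|t] qt td hc sb0.
  exists b0; split=> [S _|S Si]; last by rewrite -Eb0 /c0 Si eqxx.
  have /size1_polyC -> : (size (b0 S) <= 1)%N by have := sb0 S; rewrite mul0n.
  rewrite -[_%:P]mulr1; apply: in_imageZ.
  by exists 1; split; [exact: dhomog1 | exact: rmorph1].
have /fin_all_exists[x Hx] S : exists x : {poly K} * {poly K},
    [/\ (size x.1 <= (t * d).+1)%N, in_image f t.+1 x.2 & b0 S = h * x.1 + x.2].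
  by have [b' [p [? ? ?]]] := plus_h qt (sb0 S); exists (b', p).
pose b' S := (x S).1; pose p S := (x S).2.
have hp S : in_image f t.+1 (p S) by case: (Hx S).
have Eb S : b0 S = h * b' S + p S by case: (Hx S).
have hb' (S : {set 'I_n.+1}) : #|S| = i -> in_image f t.+1 (contract f b' S).
  move=> Si; apply: (quot_h qt).
  have -> : h * contract f b' S = c S - contract f p S.
    have := Eb0 S; rewrite /c0 Si eqxx => ->; rewrite (eq_contract _ Eb) contractD contractZ; ring.
  apply: in_imageB; first exact: hc.
  by apply: in_image_contract => S' _.
exists (fun S => p S + wedge e (contract f b') S); split=> S Si.
  apply: in_imageD => //; apply: in_image_wedge => S' cS'.
  by apply: hb'; apply/eqP; rewrite -eqSS cS' Si.
have := Eb0 S; rewrite /c0 Si eqxx => ->; rewrite (eq_contract _ Eb) !contractD addrC.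
congr (_ + _).
rewrite (@eq_contract _ _ _ (wedge e (contract f b')) (fun S => h * b' S - contract f (wedge e b') S)).
  by rewrite contractB contract_contract subr0.
by move=> S'; rewrite -homotopy; ring.
Qed.

End KoszulChase.

(** * Base change to k(t) *)

Section RationalFunctions.
Variable k : fieldType.
Local Notation K := {fraction {poly k}}.
Local Notation "x %:F" := (@FracField.tofrac _ x).

Lemma frac_quotient (x : K) : exists p : {poly k} * {poly k}, (p.2 != 0) && (x == p.1%:F / p.2%:F).
Proof.
elim/quotW: x => r; exists (frac r); rewrite denom_ratioP /=.
have d0 : (\d_r)%:F != 0 by rewrite tofrac_eq0 denom_ratioP.
apply/eqP; apply: (mulIf d0); rewrite divfK //.
unlock FracField.tofrac; rewrite -[LHS]FracField.pi_mul; apply/eqmodP.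
rewrite /= FracField.equivfE /FracField.mulf !numden_Ratio ?(mulf_neq0, oner_neq0, denom_ratioP) //.
by rewrite !mulr1 mulrC.
Qed.

(* The k-linear projection of k(t) = k[t] + {proper fractions} onto the constants. *)
Definition retract (x : K) : k :=
  let p := xchoose (frac_quotient x) in (p.1 %/ p.2)`_0.

Lemma retractE (p g : {poly k}) : g != 0 -> retract (p%:F / g%:F) = (p %/ g)`_0.
Proof.
move=> g0; rewrite /retract; have /andP[/=] := xchooseP (frac_quotient (p%:F / g%:F)).
move: (xchoose _) => [p' g'] /= g'0 /eqP E.
suff E' : p * g' = p' * g.
  by rewrite -(divp_pmul2r p' g0 g'0) -E' [g' * g]mulrC divp_pmul2r.
apply/eqP; rewrite -tofrac_eq !tofracM.
have h : g%:F != 0 by rewrite tofrac_eq0.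
have h' : g'%:F != 0 by rewrite tofrac_eq0.
by rewrite -{1}(divfK h p%:F) E mulrAC divfK.
Qed.

Definition const_frac (a : k) : K := (a%:P)%:F.
HB.instance Definition _ := GRing.RMorphism.copy const_frac (@FracField.tofrac _ \o polyC).

Lemma retractD x y : retract (x + y) = retract x + retract y.
Proof.
have [[p g] /= /andP[g0 /eqP ->]] := frac_quotient x.
have [[p' g'] /= /andP[g'0 /eqP ->]] := frac_quotient y.
have h : g%:F != 0 by rewrite tofrac_eq0.
have h' : g'%:F != 0 by rewrite tofrac_eq0.
have gg' : g * g' != 0 by rewrite mulf_neq0.
rewrite (addf_div _ _ h h') -(tofracM p g') -(tofracM p' g) -(tofracM g g') -tofracD.
rewrite (retractE _ gg') (retractE _ g0) (retractE _ g'0).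
by rewrite divpD coefD divp_pmul2r // [g * g']mulrC divp_pmul2r.
Qed.

Lemma retractM a x : retract (const_frac a * x) = a * retract x.
Proof.
have [[p g] /= /andP[g0 /eqP ->]] := frac_quotient x.
by rewrite mulrA /const_frac -(tofracM a%:P p) (retractE _ g0) (retractE _ g0) mul_polyC divpZl coefZ.
Qed.

Lemma retract1 : retract 1 = 1.
Proof.
have -> : 1 = 1%:F / 1%:F :> K by rewrite tofrac1 divr1.
by rewrite retractE ?oner_neq0 // divp1 coef1.
Qed.

Lemma frac_infinite : infinite_field K.
Proof.
move=> m; exists [seq ('X^i)%:F | i <- iota 0 m]; split; last by rewrite size_map size_iota.
rewrite map_inj_uniq ?iota_uniq // => i j /eqP; rewrite tofrac_eq => /eqP.
by move/(congr1 (fun p : {poly k} => size p)); rewrite !size_polyXn => -[].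
Qed.

End RationalFunctions.

Section Descent.
Variables (k K : fieldType) (j : {rmorphism k -> K}) (pr : K -> k).
Hypothesis prD : {morph pr : x y / x + y}.
Hypothesis prM : forall a x, pr (j a * x) = a * pr x.
Hypothesis pr1 : pr 1 = 1.
Variables (n : nat) (f : 'I_n.+1 -> {poly k}).
Local Notation fK := (fun l => map_poly j (f l)).

Let pr0 : pr 0 = 0.
Proof. by apply: (addrI (pr 0)); rewrite -prD !addr0. Qed.

Definition ppr (y : {poly K}) : {poly k} := \poly_(i < size y) pr y`_i.

Lemma coef_ppr y i : (ppr y)`_i = pr y`_i.
Proof. by rewrite coef_poly; case: ltnP => // hi; rewrite nth_default // pr0. Qed.

Lemma pprD : {morph ppr : x y / x + y}.
Proof. by move=> x y; apply/polyP => i; rewrite coefD !coef_ppr coefD prD. Qed.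

Lemma ppr0 : ppr 0 = 0.
Proof. by apply/polyP => i; rewrite coef_ppr !coef0 pr0. Qed.

Lemma ppr_sum (I : Type) (s : seq I) (P : pred I) (F : I -> {poly K}) :
  ppr (\sum_(i <- s | P i) F i) = \sum_(i <- s | P i) ppr (F i).
Proof. exact: (big_morph ppr pprD ppr0). Qed.

(** Linearity over k[x], and not only over k, makes the retraction commute with the Koszul
    differential of the f_l. *)
Lemma pprM g y : ppr (map_poly j g * y) = g * ppr y.
Proof.
apply/polyP => i; rewrite coef_ppr !coefM.
rewrite (big_morph pr prD pr0); apply: eq_bigr => l _.
by rewrite coef_map prM coef_ppr.
Qed.

Lemma ppr_map g : ppr (map_poly j g) = g.
Proof.
by apply/polyP => i; rewrite coef_ppr coef_map; have := prM g`_i 1; rewrite mulr1 pr1 mulr1.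
Qed.

Definition mpr (p : {mpoly K[n.+1]}) : {mpoly k[n.+1]} :=
  \sum_(m <- msupp p) pr p@_m *: 'X_[m].

Lemma mpr_homog t p : p \is t.-homog -> mpr p \is t.-homog.
Proof.
move=> hp; rewrite /mpr big_seq; apply: rpred_sum => m mp; apply: rpredZ.
by rewrite dhomogX /= (dhomog_mf hp mp).
Qed.

Lemma evf_map_monomial m : evf fK 'X_[m] = map_poly j (evf f 'X_[m]).
Proof.
rewrite [in LHS]mpolyXE_id [in RHS]mpolyXE_id !rmorph_prod; apply: eq_bigr => l _.
by rewrite !rmorphXn /= !evfX.
Qed.

Lemma evf_mpr p : evf f (mpr p) = ppr (evf fK p).
Proof.
rewrite [in RHS](mpolyE p) (rmorph_sum (evf fK)) ppr_sum /mpr (rmorph_sum (evf f)).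
apply: eq_bigr => m _; rewrite -!mul_mpolyC !rmorphM /= !evfC evf_map_monomial [X in ppr X]mulrC pprM mulrC.
congr (_ * _); apply/polyP => i; rewrite coef_ppr !coefC.
by case: eqP => // _; rewrite pr0.
Qed.

Lemma in_image_descent t y : in_image fK t y -> in_image f t (ppr y).
Proof. by case=> p [hp <-]; exists (mpr p); split; [exact: mpr_homog | exact: evf_mpr]. Qed.

Lemma in_image_extend t x : in_image f t x -> in_image fK t (map_poly j x).
Proof.
case=> p [hp <-]; exists (\sum_(m <- msupp p) j p@_m *: 'X_[m]); split.
  rewrite big_seq; apply: rpred_sum => m mp; apply: rpredZ.
  by rewrite dhomogX /= (dhomog_mf hp mp).
rewrite [in RHS](mpolyE p) (rmorph_sum (evf f)) !rmorph_sum; apply: eq_bigr => m _ /=.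
by rewrite -!mul_mpolyC !rmorphM /= !evfC evf_map_monomial map_polyC.
Qed.

Lemma ppr_contract (c : {set 'I_n.+1} -> {poly K}) S :
  ppr (contract fK c S) = contract f (fun S => ppr (c S)) S.
Proof.
rewrite ppr_sum; apply: eq_bigr => l _.
have -> : ksg {poly K} S l = map_poly j (ksg {poly k} S l).
  by rewrite /ksg rmorphXn rmorphN1.
by rewrite -rmorphM pprM.
Qed.

Lemma map_contract (c : {set 'I_n.+1} -> {poly k}) S :
  map_poly j (contract f c S) = contract fK (fun S => map_poly j (c S)) S.
Proof. exact: (rmorph_contract (map_poly j)). Qed.

End Descent.

Section KoszulOverField.
Variables (k : fieldType) (n d q : nat) (mu : 'I_n -> nat) (f : 'I_n.+1 -> {poly k}).
Variables (S : 'M[{poly k}]_(n, n.+1)) (U : 'rV[{poly k}]_n.+1) (T : 'M[{poly k}]_(n.+1, n)).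
Variables (e : nat) (c : {poly k}).
Local Notation F := (\col_l f l).

Hypothesis size_f : forall l, (size (f l) <= d.+1)%N.
Hypothesis top_f : exists l, (f l)`_d != 0.
Hypothesis size_S : forall i l, (size (S i l) <= (mu i).+1)%N.
Hypothesis SF : S *m F = 0.
Hypothesis UF : U *m F = 1%:M.
Hypothesis TS : T *m S = 1%:M - F *m U.
Hypothesis lead_free : row_free (\matrix_(i, l) (S i l)`_(mu i)).
Hypothesis mu_q : forall i i', i != i' -> (mu i + mu i' <= q)%N.
Hypothesis mu_le_q : forall i, (mu i <= q)%N.
Hypothesis q_gt0 : (0 < q)%N.
Hypothesis d_gt0 : (0 < d)%N.
Hypothesis n_gt0 : (0 < n)%N.
Hypothesis xc_image : in_image f e ('X * c).
Hypothesis c_image : in_image f e c.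
Hypothesis c_neq0 : c != 0.

Theorem koszul_image t i (x : {set 'I_n.+1} -> {poly k}) :
  (q <= t.+1)%N -> ((0 < t)%N || (d <= 1)%N) ->
  (forall S : {set 'I_n.+1}, #|S| = i -> in_image f t.+1 (x S)) ->
  (forall S : {set 'I_n.+1}, #|S|.+1 = i -> contract f x S = 0) ->
  exists b : {set 'I_n.+1} -> {poly k},
    (forall S : {set 'I_n.+1}, #|S| = i.+1 -> in_image f t (b S)) /\
    forall S : {set 'I_n.+1}, #|S| = i -> x S = contract f b S.
Proof.
move=> qt td hx dx; pose j : {rmorphism k -> {fraction {poly k}}} := @const_frac k.
pose fK l := map_poly j (f l); pose J := map_mx (map_poly j).
have FK : \col_l fK l = J _ _ F by apply/matrixP => l m; rewrite !mxE.
have JM m m' m'' (X : 'M_(m, m')) (Y : 'M_(m', m'')) : J _ _ (X *m Y) = J _ _ X *m J _ _ Y.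
  exact: map_mxM.
have size_fK l : (size (fK l) <= d.+1)%N by rewrite size_map_poly.
have top_fK : exists l, (fK l)`_d != 0.
  by have [l hl] := top_f; exists l; rewrite coef_map fmorph_eq0.
have size_SK a l : (size (J _ _ S a l) <= (mu a).+1)%N by rewrite mxE size_map_poly.
have SFK : J _ _ S *m \col_l fK l = 0 by rewrite FK -JM SF; exact: map_mx0.
have UFK : J _ _ U *m \col_l fK l = 1%:M by rewrite FK -JM UF; exact: map_mx1.
have TSK : J _ _ T *m J _ _ S = 1%:M - \col_l fK l *m J _ _ U.
  by rewrite FK -!JM TS /J map_mxB map_mx1.
have leadK : row_free (\matrix_(a, l) (J _ _ S a l)`_(mu a)).
  rewrite (_ : \matrix_(a, l) _ = map_mx j (\matrix_(a, l) (S a l)`_(mu a))).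
    by rewrite row_free_map.
  by apply/matrixP => a l; rewrite !mxE coef_map.
have xcK : in_image fK e ('X * map_poly j c).
  by have := in_image_extend j xc_image; rewrite rmorphM /= map_polyX.
have cK : in_image fK e (map_poly j c) by exact: in_image_extend.
have cK0 : map_poly j c != 0 by rewrite map_poly_eq0.
have [v [v' [sh cop quot plus]]] := image_structure (@frac_infinite k) size_fK top_fK size_SK
  SFK UFK TSK leadK mu_q mu_le_q q_gt0 d_gt0 n_gt0 xcK cK cK0.
have [||b [hb Eb]] := koszul_image_exact size_fK sh cop quot plus qt td
  (i := i) (c := fun S => map_poly j (x S)).
- by move=> S' hS; apply: in_image_extend; apply: hx.
- by move=> S' hS; rewrite -map_contract dx // rmorph0.
have prD := @retractD k; have prM := @retractM k; have pr1 := @retract1 k.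
exists (fun S => ppr (@retract k) (b S)); split=> S' hS.
  exact: (in_image_descent prD prM (hb S' hS)).
by rewrite -(ppr_contract prD prM) -Eb // (ppr_map prD prM pr1).
Qed.

End KoszulOverField.

(** * From binary forms to matrices of polynomials *)

Section Dehomogenise.
Variable k : fieldType.
Local Notation B := {mpoly k[2]}.
Implicit Types (p g : B) (x y : {poly k}).

Definition deh_var (i : 'I_2) : {poly k} := if i == ord0 then 'X else 1.
Definition deh p : {poly k} := mmap (@polyC k) deh_var p.
HB.instance Definition _ :=
  GRing.RMorphism.copy deh (mmap (polyC : {rmorphism k -> {poly k}}) deh_var).

(** Coefficients beyond degree e are dropped, which makes it a linear map on all of k[x]. *)
Definition homogenise e x : B := \sum_(i < e.+1) x`_i *: ('X_ord0 ^+ i * 'X_ord_max ^+ (e - i)).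

Lemma deh_X0 : deh 'X_ord0 = 'X.
Proof. by rewrite /deh mmapX mmap1U. Qed.

Lemma deh_X1 : deh 'X_ord_max = 1.
Proof. by rewrite /deh mmapX mmap1U. Qed.

Lemma dehC c : deh c%:MP = c%:P.
Proof. exact: mmapC. Qed.

Lemma dehZ c p : deh (c *: p) = c *: deh p.
Proof. by rewrite -mul_mpolyC rmorphM /= dehC mul_polyC. Qed.

Lemma dhomogX_exp i e : ('X_i ^+ e : B) \is e.-homog.
Proof. by rewrite -[X in X.-homog]mul1n; apply: dhomogMn; exact: dhomogX_U. Qed.

Lemma homogenise_homog e x : homogenise e x \is e.-homog.
Proof.
apply: rpred_sum => i _; apply: rpredZ.
have := dhomogM (dhomogX_exp ord0 i) (dhomogX_exp ord_max (e - i)).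
by rewrite subnKC // -ltnS.
Qed.

Lemma homogeniseK e x : (size x <= e.+1)%N -> deh (homogenise e x) = x.
Proof.
move=> sx; rewrite rmorph_sum /=.
transitivity (\sum_(i < e.+1) x`_i *: 'X^i).
  apply: eq_bigr => i _.
  by rewrite dehZ rmorphM /= !rmorphXn /= deh_X0 deh_X1 expr1n mulr1.
rewrite -poly_def; apply/polyP => i; rewrite coef_poly; case: ltnP => // h.
by rewrite nth_default // (leq_trans sx).
Qed.

Lemma homogenise_is_linear e : linear (homogenise e).
Proof.
move=> a x y; rewrite /homogenise scaler_sumr -big_split; apply: eq_bigr => i _.
by rewrite coefD coefZ scalerDl scalerA.
Qed.
HB.instance Definition _ e :=
  GRing.isLinear.Build k {poly k} B *:%R (homogenise e) (homogenise_is_linear e).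

Lemma dehK e p : p \is e.-homog -> homogenise e (deh p) = p.
Proof.
move=> hp; transitivity (homogenise e (deh (\sum_(m <- msupp p) p@_m *: 'X_[m]))); first by rewrite -mpolyE.
rewrite (raddf_sum deh) /= (raddf_sum (homogenise e)) [RHS]mpolyE !big_seq; apply: eq_bigr => m mp /=.
rewrite dehZ linearZ /=; congr (_ *: _).
have E : (m ord0 + m ord_max)%N = e.
  by rewrite -(dhomog_mf hp mp) /= mdegE big_ord_recl big_ord1; congr (_ + m _)%N; apply: val_inj.
have -> : deh 'X_[m] = 'X^(m ord0).
  rewrite /deh mmapX /mmap1 big_ord_recl big_ord1 /deh_var eqxx /= expr1n mulr1 //.
have h : (m ord0 < e.+1)%N by rewrite -E ltnS leq_addr.
rewrite /homogenise (bigD1 (Ordinal h)) //= coefXn eqxx scale1r big1 => [|i ih]; last first.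
  by move: ih; rewrite -val_eqE /= coefXn => /negbTE ->; rewrite scale0r.
rewrite addr0 -E addKn [RHS]mpolyXE_id big_ord_recl big_ord1 /=; congr (_ * _).
by congr ('X__ ^+ (m _)); apply: val_inj.
Qed.

Lemma deh_inj e p g : p \is e.-homog -> g \is e.-homog -> deh p = deh g -> p = g.
Proof. by move=> hp hg E; rewrite -(dehK hp) -(dehK hg) E. Qed.

Lemma size_deh e p : p \is e.-homog -> (size (deh p) <= e.+1)%N.
Proof.
move=> hp; rewrite [p]mpolyE (raddf_sum deh) big_seq.
apply: (big_rec (fun x : {poly k} => size x <= e.+1)%N) => [|m x mp sx]; first by rewrite size_poly0.
apply: leq_trans (size_polyD _ _) _; rewrite geq_max sx andbT /= dehZ.
apply: leq_trans (size_scale_leq _ _) _.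
rewrite /deh mmapX /mmap1 big_ord_recl big_ord1 /deh_var eqxx /= expr1n mulr1 size_polyXn ltnS.
by rewrite -(dhomog_mf hp mp) /= mdegE big_ord_recl leq_addr.
Qed.

End Dehomogenise.

Lemma gcd_combination (K : fieldType) (I : finType) (F : I -> {poly K}) :
  exists g (u : I -> {poly K}), (forall l, g %| F l) /\ g = \sum_l u l * F l.
Proof.
suff [g [u [gF E]]] : exists g (u : I -> {poly K}),
    (forall l, l \in enum I -> g %| F l) /\ g = \sum_l u l * F l.
  by exists g, u; split=> // l; apply: gF; rewrite mem_enum.
elim: (enum I) => [|i s [g [u [gF E]]]].
  by exists 0, (fun=> 0); split=> //; rewrite big1 // => l _; rewrite mul0r.
have [[a b] /= hab] := Bezoutp (F i) g.
have gd z : gcdp (F i) g %| z -> a * F i + b * g %| z by rewrite (eqp_dvdl _ hab).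
exists (a * F i + b * g), (fun l => b * u l + (if l == i then a else 0)); split=> [l|].
  rewrite inE => /predU1P[->|/gF gl]; apply: gd; first exact: dvdp_gcdl.
  exact: dvdp_trans (dvdp_gcdr _ _) gl.
under [RHS]eq_bigr do rewrite mulrDl.
rewrite big_split /= [LHS]addrC; congr (_ + _).
  by rewrite E mulr_sumr; apply: eq_bigr => l _; rewrite mulrA.
by rewrite (bigD1 i) //= eqxx big1 ?addr0 // => l /negbTE ->; rewrite mul0r.
Qed.

Section MatrixData.
Variables (k : fieldType) (n d : nat) (f : 'I_n.+1 -> {mpoly k[2]}) (mu : 'I_n -> nat).
Variable s : 'I_n -> 'I_n.+1 -> {mpoly k[2]}.
Hypothesis f_homog : forall l, f l \is d.-homog.
Hypothesis no_factor : no_common_factor f.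
Hypothesis s_homog : forall i l, s i l \is (mu i).-homog.
Hypothesis s_syz : forall i, \sum_l s i l * f l = 0.
Hypothesis s_gen : forall g : 'I_n.+1 -> {mpoly k[2]}, \sum_l g l * f l = 0 ->
  exists a : 'I_n -> {mpoly k[2]}, forall l, g l = \sum_i a i * s i l.
Hypothesis s_free : forall a : 'I_n -> {mpoly k[2]},
  (forall l, \sum_i a i * s i l = 0) -> forall i, a i = 0.

Definition affine_f l : {poly k} := deh (f l).
Definition syz_mx : 'M[{poly k}]_(n, n.+1) := \matrix_(i, l) deh (s i l).
Local Notation F := (\col_l affine_f l).
Local Notation S := syz_mx.

Lemma size_affine_f l : (size (affine_f l) <= d.+1)%N.
Proof. exact: size_deh. Qed.

Lemma size_syz_mx i l : (size (S i l) <= (mu i).+1)%N.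
Proof. by rewrite mxE; apply: size_deh. Qed.

Lemma syz_mxP : S *m F = 0.
Proof.
apply/matrixP => i z; rewrite !mxE -[RHS](rmorph0 (@deh k)) -(s_syz i) rmorph_sum /=.
by apply: eq_bigr => l _; rewrite !mxE rmorphM.
Qed.

(** Otherwise y would divide every f_l. *)
Lemma affine_f_top : exists l, (affine_f l)`_d != 0.
Proof.
have [/existsP //|/existsPn H] := boolP [exists l, (affine_f l)`_d != 0]; exfalso.
have sz l : (size (affine_f l) <= d)%N.
  apply/leq_sizeP => i; rewrite leq_eqVlt => /predU1P[<-|lt]; first by apply/eqP; move: (H l); rewrite negbK.
  by rewrite nth_default // (leq_trans (size_affine_f l)).
suff /no_factor : forall l, exists h, f l = 'X_ord_max * h.
  by rewrite msizeX mdeg1.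
case: d sz f_homog => [|d'] sz hf l.
  exists 0; rewrite mulr0; apply: (deh_inj (hf l)); first exact: dhomog0.
  by rewrite rmorph0; apply/eqP; rewrite -size_poly_eq0 -leqn0; exact: sz.
exists (homogenise d' (affine_f l)); apply: (deh_inj (hf l)).
  by apply: dhomogXM; exact: homogenise_homog.
by rewrite rmorphM /= deh_X1 mul1r homogeniseK.
Qed.

Lemma affine_f_unit : exists U : 'rV[{poly k}]_n.+1, U *m F = 1%:M.
Proof.
have [g [u [gf E]]] := gcd_combination affine_f.
have [g0|g0] := eqVneq g 0.
  have /no_factor : forall l, exists h, f l = 'X_ord0 * h.
    move=> l; exists 0; rewrite mulr0; apply: (deh_inj (f_homog l)); first exact: dhomog0.
    by have := gf l; rewrite g0 dvd0p => /eqP; rewrite rmorph0.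
  by rewrite msizeX mdeg1.
have /eqP sg : size g == 1%N; last first.
  have /eqP/size_poly1P[c c0 Ec] := sg.
  exists (\row_l (c^-1%:P * u l)); apply/matrixP => i z; rewrite !mxE !ord1 eqxx.
  transitivity (c^-1%:P * g); last by rewrite Ec -polyCM mulVf.
  by rewrite E mulr_sumr; apply: eq_bigr => l _; rewrite !mxE mulrA.
move: (size_poly_eq0 g); rewrite (negbTE g0).
case sg : (size g) => [|e] // _; rewrite eqSS -leqn0 leqNgt; apply/negP => e0.
have /no_factor : forall l, exists h, f l = homogenise e g * h.
  move=> l; have [fl0|fl0] := eqVneq (affine_f l) 0.
    exists 0; rewrite mulr0; apply: (deh_inj (f_homog l)); first exact: dhomog0.
    by rewrite rmorph0.
  have [h Eh] := dvdpP _ _ (gf l).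
  have h0 : h != 0 by apply: contraNneq fl0 => h0; rewrite Eh h0 mul0r.
  have sh : (size h + e <= d.+1)%N.
    by have := size_affine_f l; rewrite Eh size_mul // sg addnS.
  have h1 : (0 < size h)%N by rewrite lt0n size_poly_eq0.
  have Ed : d = (e + (d - e))%N by lia.
  exists (homogenise (d - e) h); apply: (deh_inj (f_homog l)).
    by rewrite Ed addKn; apply: dhomogM; exact: homogenise_homog.
  rewrite rmorphM /= !homogeniseK ?sg // 1?mulrC //; lia.
move=> /msize1_polyC /(congr1 (@deh k)); rewrite dehC homogeniseK ?sg // => Eg.
by have := size_polyC_leq1 (homogenise e g)@_0; rewrite -Eg sg ltnS leqNgt e0.
Qed.

Lemma syzygy_generated (v : 'I_n.+1 -> {poly k}) : \sum_l v l * affine_f l = 0 ->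
  exists a : 'I_n -> {poly k}, forall l, v l = \sum_i a i * S i l.
Proof.
move=> E; pose M := \max_l size (v l).
have sv l : (size (v l) <= M.+1)%N by rewrite leqW // leq_bigmax.
have [|a Ha] := s_gen (g := fun l => homogenise M (v l)).
  apply: (@deh_inj _ (M + d)); first 2 last.
  - rewrite rmorph0 rmorph_sum /= -[RHS]E; apply: eq_bigr => l _.
    by rewrite rmorphM /= homogeniseK.
  - by apply: rpred_sum => l _; apply: dhomogM => //; exact: homogenise_homog.
  exact: dhomog0.
exists (fun i => deh (a i)) => l; rewrite -[LHS](homogeniseK (sv l)) Ha rmorph_sum /=.
by apply: eq_bigr => i _; rewrite mxE rmorphM.
Qed.

Lemma syz_mx_complement (U : 'rV[{poly k}]_n.+1) : U *m F = 1%:M ->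
  exists T : 'M[{poly k}]_(n.+1, n), T *m S = 1%:M - F *m U.
Proof.
move=> UF; have /fin_all_exists[a Ha] l0 : exists a : 'I_n -> {poly k},
    forall l, (1%:M - F *m U) l0 l = \sum_i a i * S i l.
  apply: syzygy_generated.
  transitivity (((1%:M - F *m U) *m F) l0 0).
    by rewrite mxE; apply: eq_bigr => l _; rewrite [F _ _]mxE.
  by rewrite mulmxBl mul1mx -mulmxA UF mulmx1 subrr mxE.
exists (\matrix_(l, i) a l i); apply/matrixP => l0 l; rewrite Ha mxE.
by apply: eq_bigr => i _; rewrite mxE.
Qed.

(** If the leading rows satisfy a relation c, the sum of the c_i x^(M+1-mu_i) s_i loses its top
    degree, so its form of degree M + 1 is y times a syzygy, say y times the sum of the a_i s_i.
    Freeness gives y a_i = c_i x^(M+1-mu_i), and evaluation at (1, 0) gives c_i = 0. *)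
Lemma lead_syz_free : row_free (\matrix_(i, l) (S i l)`_(mu i)).
Proof.
apply: inj_row_free => c E; apply/rowP => i0; rewrite [RHS]mxE.
pose M := \sum_i mu i.
have muM i : (mu i <= M)%N by rewrite /M (bigD1 i) //= leq_addr.
pose w l := \sum_i c 0 i *: ('X^(M.+1 - mu i) * S i l).
have sw l : (size (w l) <= M.+1)%N.
  apply/leq_sizeP => j; rewrite leq_eqVlt => /predU1P[<-|lt].
    have El : \sum_i c 0 i * (S i l)`_(mu i) = 0.
      transitivity ((c *m \matrix_(i, l) (S i l)`_(mu i)) 0 l); last by rewrite E mxE.
      by rewrite mxE; apply: eq_bigr => i _; rewrite [in RHS]mxE.
    rewrite -[RHS]El.
    rewrite /w coef_sum; apply: eq_bigr => i _.
    rewrite coefZ coefXnM ltnNge leq_subr /= subKn //.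
    exact: leqW.
  rewrite nth_default //; apply: leq_trans lt.
  apply: size_sum_le => i _; apply: leq_trans (size_scale_leq _ _) _.
  apply: leq_trans (size_polyMleq _ _) _; rewrite size_polyXn /=.
  have := size_syz_mx i l; have := muM i.
  set z := size _; lia.
have [|a Ha] := s_gen (g := fun l => homogenise M (w l)).
  apply: (@deh_inj _ (M + d)); first 2 last.
  - rewrite rmorph0 rmorph_sum /=.
    transitivity (\sum_i (c 0 i *: 'X^(M.+1 - mu i)) * (S *m F) i 0).
      transitivity (\sum_i \sum_l c 0 i *: 'X^(M.+1 - mu i) * (S i l * affine_f l)).
        rewrite exchange_big; apply: eq_bigr => l _; rewrite rmorphM /= homogeniseK //.
        rewrite /w mulr_suml; apply: eq_bigr => i _.
        by rewrite -!mul_polyC -/(affine_f l); ring.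
      by apply: eq_bigr => i _; rewrite [in RHS]mxE mulr_sumr; apply: eq_bigr => l _; rewrite !mxE.
    by rewrite big1 // => i _; rewrite syz_mxP mxE mulr0.
  - by apply: rpred_sum => l _; apply: dhomogM => //; exact: homogenise_homog.
  exact: dhomog0.
have /s_free/(_ i0) : forall l, \sum_i ('X_ord_max * a i - c 0 i *: 'X_ord0 ^+ (M.+1 - mu i)) * s i l = 0.
  move=> l; transitivity ('X_ord_max * homogenise M (w l) - \sum_i c 0 i *: 'X_ord0 ^+ (M.+1 - mu i) * s i l).
    rewrite Ha mulr_sumr -sumrB; apply: eq_bigr => i _; rewrite mulrBl mulrA //.
  apply/eqP; rewrite subr_eq0; apply/eqP; apply: (@deh_inj _ M.+1).
  - by apply: dhomogXM; exact: homogenise_homog.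
  - apply: rpred_sum => i _; rewrite -scalerAl; apply: rpredZ.
    have := dhomogM (dhomogX_exp k ord0 (M.+1 - mu i)) (s_homog i l).
    by rewrite subnK // leqW.
  rewrite rmorphM /= deh_X1 mul1r homogeniseK // rmorph_sum /w; apply: eq_bigr => i _.
  by rewrite -scalerAl /= dehZ rmorphM /= rmorphXn /= deh_X0 mxE.
move/(congr1 (meval (fun i : 'I_2 => (i == ord0)%:R))).
rewrite mevalB mevalM mevalXU mul0r mevalZ rmorphXn /= mevalXU eqxx expr1n mulr1 meval0 sub0r.
by move/eqP; rewrite oppr_eq0 => /eqP.
Qed.

Lemma evf_affine p : evf affine_f p = deh (p \mPo [tuple f l | l < n.+1]).
Proof.
apply: (mpoly_rmorphism_ext (f := evf affine_f)
  (g := @deh k \o comp_mpoly [tuple f l | l < n.+1])) => [c|i] /=.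
  by rewrite evfC comp_mpolyC dehC.
by rewrite evfX comp_mpolyXU -tnth_nth tnth_mktuple.
Qed.

Lemma comp_homog e p : p \is e.-homog -> p \mPo [tuple f l | l < n.+1] \is (d * e).-homog.
Proof. by apply: dhomog_comp => i; rewrite tnth_mktuple. Qed.

Lemma curve_idealE e p : p \is e.-homog -> curve_ideal f p <-> evf affine_f p = 0.
Proof.
move=> hp; rewrite evf_affine /curve_ideal; split=> [->|E]; first exact: rmorph0.
by apply: (deh_inj (comp_homog hp)); [exact: dhomog0 | rewrite E rmorph0].
Qed.

Lemma birational_affine : birational f -> exists e (c : {poly k}),
  [/\ in_image affine_f e ('X * c), in_image affine_f e c & c != 0].
Proof.
case=> e [P [Q [hP [hQ [Q0 E]]]]]; exists e, (evf affine_f Q); split.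
- exists P; split=> //; rewrite !evf_affine.
  move/(congr1 (@deh k)): E; rewrite !rmorphM /=.
  rewrite (_ : inord 0 = ord0); last by apply: val_inj; rewrite /= inordK.
  rewrite (_ : inord 1 = ord_max); last by apply: val_inj; rewrite /= inordK.
  by rewrite deh_X0 deh_X1 mul1r.
- by exists Q.
apply: contra Q0 => /eqP /(curve_idealE hQ); rewrite /curve_ideal => ->; exact: eqxx.
Qed.

End MatrixData.

(** * Maximal minors of the syzygy matrix *)

Section DegreeSum.
Variables (k : fieldType) (n d : nat) (mu : 'I_n -> nat) (f : 'I_n.+1 -> {poly k}).
Variables (S : 'M[{poly k}]_(n, n.+1)) (U : 'rV[{poly k}]_n.+1) (T : 'M[{poly k}]_(n.+1, n)).
Local Notation F := (\col_l f l).

Lemma det_top (B : 'M[{poly k}]_n) : (forall i j, (size (B i j) <= (mu i).+1)%N) ->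
  (size (\det B) <= (\sum_i mu i).+1)%N /\
  (\det B)`_(\sum_i mu i) = \det (\matrix_(i, j) (B i j)`_(mu i)).
Proof.
move=> sB; pose m := \sum_i mu i.
have P (p : {perm 'I_n}) : (size (\prod_i B i (p i))%R <= m.+1)%N /\
    (\prod_i B i (p i))`_m = \prod_i (B i (p i))`_(mu i).
  rewrite /m; elim: (index_enum _) => [|i s [IH1 IH2]].
    by rewrite !big_nil size_poly1 coef1.
  rewrite !big_cons; split; last by rewrite (coefM_top (sB _ _) IH1) IH2.
  by apply: size_mul_bound (sB _ _) IH1 _; rewrite addnS.
split.
  apply: size_sum_le => p _; rewrite -signr_odd; case: (odd _).
    by rewrite expr1 mulN1r size_polyN; case: (P p).
  by rewrite expr0 mul1r; case: (P p).
rewrite coef_sum; apply: eq_bigr => p _; rewrite -polyC1 -polyCN -rmorphXn /= coefCM.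
congr (_ * _); case: (P p) => _ ->; apply: eq_bigr => i _; by rewrite mxE.
Qed.

Lemma cofactor_col_mx (R : comNzRingType) (w : 'rV[R]_n.+1) (L : 'M[R]_(n, n.+1)) l :
  cofactor (col_mx w L : 'M_n.+1) 0 l = (-1) ^+ l * \det (col' l L).
Proof.
congr (_ * \det _); apply/matrixP => i j; rewrite !mxE.
case: splitP => [i' /= e|i' /= e]; first by have := ltn_ord i'; rewrite -e.
by congr (L _ _); apply: val_inj; case: e.
Qed.

(** A row w outside the row space completes L to an invertible matrix, whose determinant is expanded
    along w. *)
Lemma row_free_minor (L : 'M[k]_(n, n.+1)) : row_free L -> exists l, \det (col' l L) != 0.
Proof.
move=> fL; apply/existsP; apply: contraT => /existsPn H.
pose w := nz_row (L^C)%MS.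
have rC : \rank (L^C)%MS = 1%N by rewrite mxrank_compl (eqP fL) subSnn.
have w0 : w != 0 by rewrite nz_row_eq0 -mxrank_eq0 rC.
have wL : (w :&: L)%MS = 0.
  apply/eqP; rewrite -submx0; apply: submx_trans (capmxS (nz_row_sub _) (submx_refl L)) _.
  by rewrite capmxC capmx_compl submx0.
have : row_free (col_mx w L : 'M_(1 + n, n.+1)).
  have := mxrank_sum_cap w L; rewrite wL mxrank0 addn0 rank_rV w0 (eqP fL) => E.
  by rewrite /row_free -addsmxE E.
rewrite row_free_unit unitmxE (expand_det_row _ 0) big1 ?unitr0 // => l _.
by rewrite cofactor_col_mx; move: (H l); rewrite negbK => /eqP ->; rewrite !mulr0.
Qed.

Hypothesis size_f : forall l, (size (f l) <= d.+1)%N.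
Hypothesis top_f : exists l, (f l)`_d != 0.
Hypothesis size_S : forall i l, (size (S i l) <= (mu i).+1)%N.
Hypothesis SF : S *m F = 0.
Hypothesis UF : U *m F = 1%:M.
Hypothesis TS : T *m S = 1%:M - F *m U.
Hypothesis lead_free : row_free (\matrix_(i, l) (S i l)`_(mu i)).

(* The square matrix obtained by stacking U on S is invertible and maps F to the first unit
   vector, so that F is proportional to the maximal minors of S. *)
Lemma size_maximal_minor l : size (f l) = size (\det (col' l S)).
Proof.
pose M : 'M[{poly k}]_n.+1 := col_mx U S.
pose N : 'M[{poly k}]_n.+1 := row_mx F T.
have NM : N *m M = 1%:M by rewrite [LHS](mul_row_col F T U S) TS addrC subrK.
have dM : size (\det M) = 1%N.
  have /(congr1 determinant) := NM; rewrite det_mulmx det1 => E.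
  have : \det M \is a GRing.unit by apply/unitrPr; exists (\det N); rewrite mulrC.
  by rewrite poly_unitE => /andP[/eqP].
pose V : 'cV[{poly k}]_n.+1 := col_mx (1%:M : 'M_1) (0 : 'M_(n, 1)).
have MF : M *m F = V by rewrite [LHS](mul_col_mx U S F) UF SF.
have V0 : V ord0 0 = 1.
  by rewrite mxE; case: splitP => [i|i /= //] _; rewrite mxE !ord1 eqxx.
have VS i : V (lift ord0 i) 0 = 0.
  rewrite mxE; case: splitP => [i' /= e|i' _]; last by rewrite mxE.
  by have := ltn_ord i'; rewrite -e.
have E : \det M * f l = cofactor M 0 l.
  transitivity ((\adj M *m (M *m F)) l 0).
    by rewrite mulmxA mul_adj_mx mul_scalar_mx !mxE.
  rewrite MF mxE big_ord_recl V0 big1 => [|i _]; last by rewrite VS mulr0.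
  by rewrite addr0 mulr1 mxE.
have -> : size (f l) = size (\det M * f l)%R.
  have /eqP/size_poly1P[c c0 ->] := dM; by rewrite mul_polyC size_scale.
rewrite E cofactor_col_mx -signr_odd.
by case: (odd _); rewrite ?expr1 ?mulN1r ?size_polyN // expr0 mul1r.
Qed.

(** The coefficient of a maximal minor in degree sum mu_i is a minor of the leading matrix, and one
    of these is non-zero; conversely some f_l has degree exactly d. *)
Lemma sum_degrees : (\sum_i mu i)%N = d.
Proof.
have sC l i j : (size (col' l S i j) <= (mu i).+1)%N by rewrite mxE.
apply/eqP; rewrite eqn_leq; apply/andP; split.
  have [l hl] := row_free_minor lead_free.
  rewrite -ltnS; apply: leq_trans (size_f l); rewrite size_maximal_minor.
  have [_ E] := det_top (sC l).
  rewrite ltnNge; apply/negP => /leq_sizeP/(_ _ (leqnn _)); rewrite E => /eqP.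
  apply/negP; move: hl; congr (\det _ != 0); apply/matrixP => i j; by rewrite !mxE.
have [l hl] := top_f; rewrite -ltnS.
have [h _] := det_top (sC l); apply: leq_trans h; rewrite -size_maximal_minor.
by rewrite ltnNge; apply/negP => /leq_sizeP/(_ _ (leqnn _)) e; rewrite e eqxx in hl.
Qed.

End DegreeSum.

(** * Regularity *)

Section KoszulPolynomialRing.
Variables (k : fieldType) (r : nat).
Local Notation A := {mpoly k[r]}.
Implicit Types (X : {set 'I_r}) (c : {set 'I_r} -> A).
Local Notation T := (fun l : 'I_r => 'X_l : A).

Lemma contract_homog u c S : (forall S', c S' \is u.-homog) -> contract T c S \is u.+1.-homog.
Proof.
move=> hc; apply: rpred_sum => l _; rewrite /ksg -signr_odd -mulrA.
have h := dhomogXM l (hc (l |: S)).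
by case: (odd _); rewrite ?expr1 ?expr0 ?mulN1r ?mul1r ?rpredN.
Qed.

Lemma wedge_delta_homog u c i S : (forall S', c S' \is u.-homog) ->
  wedge (fun l => (l == i)%:R) c S \is u.-homog.
Proof.
move=> hc; apply: rpred_sum => l _; rewrite /ksg -signr_odd -mulrA.
have h : (l == i)%:R * c (S :\ l) \is u.-homog.
  by case: (l == i); rewrite ?mul1r // mul0r dhomog0.
by case: (odd _); rewrite ?expr1 ?expr0 ?mulN1r ?mul1r ?rpredN.
Qed.

Lemma kill_contract0 X c S : (forall S, kill X (c S) = 0) -> kill X (contract T c S) = 0.
Proof. by move=> hc; rewrite rmorph_sum big1 // => l _; rewrite rmorphM /= hc mulr0. Qed.

(* Induction on the complement of X: modulo i |: X, the cycle c is a boundary up to 'X_i * c1,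
   and 'X_i * c1 is the boundary of e_i /\ c1 since 'X_i is regular modulo X. *)
Lemma koszul_kill_exact X u c : (forall S, c S \is u.+1.-homog) ->
  (forall S, kill X (contract T c S) = 0) ->
  exists b, (forall S, b S \is u.-homog) /\ forall S, kill X (c S - contract T b S) = 0.
Proof.
move: {2}#|~: X| (leqnn #|~: X|) => m; elim: m X c => [|m IH] X c hX hc dc.
  have XT : X = setT.
    by move: hX; rewrite leqn0 cards_eq0 -[X in X = _]setCK => /eqP ->; rewrite setC0.
  exists (fun=> 0); split=> S; first exact: dhomog0.
  by rewrite contract0 subr0 XT (killT (d := u.+1)).
have [XT|[i iX]] := set_0Vmem (~: X).
  by apply: IH => //; rewrite XT cards0.
rewrite inE in iX.
have [||b [hb Eb]] := IH (i |: X) c _ hc.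
- by move: hX; rewrite (cardsD1 i) inE iX setCU setIC -setDE.
- by move=> S; apply: kill_sub (dc S); exact: subsetUr.
have /fin_all_exists[g Hg] S := killU1_divides (Eb S).
pose c1 S := pihomog mdeg u (g S).
have hc1 S : c1 S \is u.-homog by exact: pihomogP.
have Hc1 S : kill X (c S - contract T b S - 'X_i * c1 S) = 0.
  have <- : pihomog mdeg u.+1 (c S - contract T b S - 'X_i * g S) = c S - contract T b S - 'X_i * c1 S.
    rewrite raddfB /= pihomogX pihomog_dE //.
    by apply: rpredB; [exact: hc | exact: contract_homog].
  by rewrite kill_pihomog Hg raddf0.
have dc1 S : kill X (contract T c1 S) = 0.
  apply: (kill_reg iX); rewrite -contractZ.
  rewrite (@eq_contract _ _ _ _ (fun S => (c S - contract T b S) - (c S - contract T b S - 'X_i * c1 S))); last first.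
    by move=> S'; ring.
  by rewrite contractB rmorphB /= contractB contract_contract subr0 dc kill_contract0 // subr0.
exists (fun S => b S + wedge (fun l => (l == i)%:R) c1 S); split=> S.
  by apply: rpredD; [exact: hb | exact: wedge_delta_homog].
have E := wedge_contract T (fun l => (l == i)%:R) c1 S.
rewrite contractD; move/(congr1 (kill X)): E; rewrite rmorphD /=.
have -> : kill X (wedge (fun l => (l == i)%:R) (contract T c1) S) = 0.
  by rewrite rmorph_sum big1 // => l _; rewrite rmorphM /= dc1 mulr0.
rewrite addr0 (bigD1 i) //= eqxx mulr1 big1 ?addr0 => [E|l /negbTE ->]; last by rewrite mulr0.
rewrite opprD addrA rmorphB /= E -rmorphB; exact: Hc1.
Qed.

Lemma koszul_exact i u c : (forall S : {set 'I_r}, #|S| = i -> c S \is u.+1.-homog) ->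
  (forall S : {set 'I_r}, #|S|.+1 = i -> contract T c S = 0) ->
  exists b : {set 'I_r} -> A, (forall S, b S \is u.-homog) /\
    forall S : {set 'I_r}, #|S| = i -> c S = contract T b S.
Proof.
move=> hc dc; pose c0 (S : {set _}) := if #|S| == i then c S else 0.
have [|S|b [hb Eb]] := @koszul_kill_exact set0 u c0.
- by move=> S; rewrite /c0; case: eqP => [/hc//|_]; exact: dhomog0.
- rewrite kill0; have [Si|Si] := eqVneq #|S|.+1 i.
    rewrite -[RHS](dc S Si); apply: contract_card => S' cS'.
    by rewrite /c0 cS' Si eqxx.
  rewrite -[RHS](contract0 T S); apply: contract_card => S' cS'.
  by rewrite /c0 cS' (negbTE Si).
exists b; split=> // S Si; have := Eb S; rewrite kill0 /c0 Si eqxx.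
by move/eqP; rewrite subr_eq0 => /eqP.
Qed.

End KoszulPolynomialRing.

Section RegularityFromExactness.
Variables (k : fieldType) (n q d : nat) (f : 'I_n.+1 -> {poly k}).
Local Notation A := {mpoly k[n.+1]}.
Local Notation T := (fun l : 'I_n.+1 => 'X_l : A).
Variable I : A -> Prop.
Hypothesis I_evf : forall t p, p \is t.-homog -> I p <-> evf f p = 0.
Hypothesis q_gt0 : (0 < q)%N.
Hypothesis q_d : (1 < q)%N || (d <= 1)%N.
Hypothesis image_exact : forall t i (x : {set 'I_n.+1} -> {poly k}),
  (q <= t.+1)%N -> ((0 < t)%N || (d <= 1)%N) ->
  (forall S : {set 'I_n.+1}, #|S| = i -> in_image f t.+1 (x S)) ->
  (forall S : {set 'I_n.+1}, #|S|.+1 = i -> contract f x S = 0) ->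
  exists b : {set 'I_n.+1} -> {poly k},
    (forall S : {set 'I_n.+1}, #|S| = i.+1 -> in_image f t (b S)) /\
    forall S : {set 'I_n.+1}, #|S| = i -> x S = contract f b S.

Lemma kdiff_contract (c : {set 'I_n.+1} -> A) S : kdiff c S = contract T c S.
Proof. by []. Qed.

Lemma evf_contract (c : {set 'I_n.+1} -> A) S : evf f (contract T c S) = contract f (fun S => evf f (c S)) S.
Proof.
rewrite (rmorph_contract (evf f)) /=; apply: eq_bigr => l _; congr (_ * _ * _).
exact: evfX.
Qed.

Lemma quotient_cycle_boundary t i (c : {set 'I_n.+1} -> A) : (q <= t.+1)%N ->
  (forall S : {set 'I_n.+1}, #|S| = i -> c S \is t.+1.-homog) ->
  (forall S : {set 'I_n.+1}, #|S|.+1 = i -> evf f (contract T c S) = 0) ->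
  exists b : {set 'I_n.+1} -> A, (forall S, b S \is t.-homog) /\
    forall S : {set 'I_n.+1}, #|S| = i -> evf f (c S - contract T b S) = 0.
Proof.
move=> qt hc dc.
have td : (0 < t)%N || (d <= 1)%N.
  by case/orP: q_d => [q1|->]; [rewrite -ltnS (leq_trans q1) | rewrite orbT].
have [||b [hb Eb]] := image_exact (i := i) (x := fun S => evf f (c S)) qt td.
- by move=> S Si; exists (c S); split=> //; exact: hc.
- by move=> S Si; rewrite -evf_contract dc.
have /fin_all_exists[p Hp] (S : {set 'I_n.+1}) : exists p : A,
    p \is t.-homog /\ (#|S| = i.+1 -> evf f p = b S).
  have [/hb[p [hp Ep]]|Si] := eqVneq #|S| i.+1; first by exists p.
  by exists 0; split; [exact: dhomog0 | move/eqP; rewrite (negbTE Si)].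
exists p; split=> [S|S Si]; first by case: (Hp S).
rewrite rmorphB /= evf_contract Eb // (_ : contract f b S = contract f (fun S => evf f (p S)) S) ?subrr //.
by apply: contract_card => S' cS'; case: (Hp S') => _ -> //; rewrite cS' Si.
Qed.

(** The comparison of Tor_i(I) with Tor_(i+1)(A/I) on chains: a cycle c in I is the boundary of some
    b over A, and b is a cycle modulo I, hence a boundary there up to a chain in I, which has
    boundary c. Passing from c to b costs one degree, so the bound is q and not q - 1. *)
Theorem reg_le_ideal : reg_le I (@zero_ideal k n.+1) q.
Proof.
move=> i j [c [hc [dc nb]]]; rewrite leNgt; apply/negP => qj; apply: nb.
case: (intP (j - i%:Z)) qj hc => [|u|u] qj hc; try by exfalso; move: qj q_gt0; lia.
have qu : (q <= u)%N by move: qj; lia.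
have [||b [hb Eb]] := @koszul_exact k n.+1 i u c.
- by move=> S /hc[].
- exact: dc.
case: u qu qj hc hb => [|t] qt qj hc hb; first by rewrite leqn0 in qt; have := q_gt0; rewrite (eqP qt).
have [||e [he Ee]] := @quotient_cycle_boundary t i.+1 b qt.
- by move=> S _; exact: hb.
- move=> S [Si]; rewrite -Eb //; have [IS hS] := hc S Si.
  exact/(I_evf hS).
exists (fun S => b S - contract T e S); split=> [S Si|S Si].
  have h : b S - contract T e S \is t.+1.-homog by apply: rpredB; [exact: hb | exact: contract_homog].
  split; first by apply/(I_evf h); exact: Ee.
  by rewrite (_ : _ - 1 = t.+1%:Z) //; lia.
by rewrite /zero_ideal kdiff_contract contractB contract_contract subr0 -Eb // subrr.
Qed.

Theorem reg_le_quotient : reg_le (@unit_ideal k n.+1) I (q%:Z - 1).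
Proof.
move=> i j [c [hc [dc nb]]]; rewrite leNgt; apply/negP => qj; apply: nb.
case: (intP (j - i%:Z)) qj hc dc => [|t|t] qj hc dc; try by exfalso; move: qj q_gt0; lia.
have qt : (q <= t.+1)%N by move: qj; lia.
have hc' (S : {set 'I_n.+1}) : #|S| = i -> c S \is t.+1.-homog by case/hc.
pose c0 (S : {set _}) := if #|S| == i then c S else 0.
have hc0 S : c0 S \is t.+1.-homog.
  by rewrite /c0; case: eqP => [/hc'//|_]; exact: dhomog0.
have c0c (S : {set 'I_n.+1}) : #|S|.+1 = i -> kdiff c S = contract T c0 S.
  move=> Si; apply: contract_card => S' cS'.
  by rewrite /c0 cS' Si eqxx.
have [|b [hb Eb]] := @quotient_cycle_boundary t i c qt hc'.
  move=> S Si; have := dc S Si; rewrite -kdiff_contract c0c //.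
  by move/(I_evf (contract_homog S hc0)).
exists b; split=> [S Si|S Si].
  split=> //.
  by rewrite [homogZ _ _]/(homogZ _ (t.+1%:Z - 1)) (_ : t.+1%:Z - 1 = t%:Z); [exact: hb | lia].
have h : c S - contract T b S \is t.+1.-homog by apply: rpredB; [exact: hc' | exact: contract_homog].
by apply/(I_evf h); exact: Eb.
Qed.

End RegularityFromExactness.

(** * The degree of the curve *)

Section HilbertFunction.
Variables (k : fieldType) (n d q : nat) (mu : 'I_n -> nat) (f : 'I_n.+1 -> {poly k}).
Variables (S : 'M[{poly k}]_(n, n.+1)) (U : 'rV[{poly k}]_n.+1).
Local Notation F := (\col_l f l).
Local Notation A := {mpoly k[n.+1]}.
Hypothesis size_f : forall l, (size (f l) <= d.+1)%N.
Hypothesis top_f : exists l, (f l)`_d != 0.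
Hypothesis size_S : forall i l, (size (S i l) <= (mu i).+1)%N.
Hypothesis SF : S *m F = 0.
Hypothesis UF : U *m F = 1%:M.
Hypothesis lead_free : row_free (\matrix_(i, l) (S i l)`_(mu i)).
Hypothesis mu_le_q : forall i, (mu i <= q)%N.
Local Notation L := (\matrix_(i, l) (S i l)`_(mu i)).

Lemma syz_mxE i : \sum_l S i l * f l = 0.
Proof.
transitivity ((S *m F) i 0); last by rewrite SF mxE.
by rewrite mxE; apply: eq_bigr => l _; rewrite [F _ _]mxE.
Qed.

(** The row space of L lies in the hyperplane orthogonal to the coefficients of degree d, and both
    have dimension n. *)
Lemma lead_orthogonal (b : 'rV[k]_n.+1) : \sum_l b 0 l * (f l)`_d = 0 -> (b <= L)%MS.
Proof.
move=> E; pose phi : 'cV[k]_n.+1 := \col_l (f l)`_d.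
have phi0 : phi != 0.
  have [l hl] := top_f; apply: contraNneq hl => /(congr1 (fun M : 'cV_n.+1 => M l 0)).
  by rewrite !mxE => ->.
have Lker : (L <= kermx phi)%MS.
  apply/sub_kermxP/matrixP => i z; rewrite mxE [RHS]mxE.
  transitivity ((\sum_l S i l * f l)`_(mu i + d)); last by rewrite syz_mxE coef0.
  rewrite coef_sum; apply: eq_bigr => l _.
  by rewrite (coefM_top (size_S i l) (size_f l)) !mxE.
have rk : (\rank L == \rank (kermx phi)).
  rewrite mxrank_ker (eqP lead_free).
  have -> : \rank phi = 1%N; last by rewrite subSS subn0.
  by rewrite -mxrank_tr rank_rV trmx_eq0 phi0.
have kerL : (kermx phi <= L)%MS by rewrite -(mxrank_leqif_sup Lker).
apply: submx_trans kerL; apply/sub_kermxP/matrixP => i z.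
by rewrite mxE [RHS]mxE -[RHS]E !ord1; apply: eq_bigr => l _; rewrite [in LHS]mxE.
Qed.

Lemma lead_span_mx (b : 'I_n.+1 -> k) : \sum_l b l * (f l)`_d = 0 ->
  exists g : 'I_n -> k, forall l, b l = \sum_i g i * (S i l)`_(mu i).
Proof.
move=> E; have /submxP[g Hg] : (\row_l b l <= L)%MS.
  by apply: lead_orthogonal; rewrite -[RHS]E; apply: eq_bigr => l _; rewrite mxE.
exists (g 0) => l; transitivity ((g *m L) 0 l); first by rewrite -Hg mxE.
by rewrite mxE; apply: eq_bigr => i _; rewrite mxE.
Qed.

Lemma unit_rowE : \sum_l U 0 l * f l = 1.
Proof.
transitivity ((U *m F) 0 0); last by rewrite UF mxE.
by rewrite mxE; apply: eq_bigr => l _; rewrite [F _ _]mxE.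
Qed.

Lemma in_imageM t t' x y : in_image f t x -> in_image f t' y -> in_image f (t + t') (x * y).
Proof.
case=> p [hp <-] [p' [hp' <-]]; exists (p * p'); split; first exact: dhomogM.
by rewrite rmorphM.
Qed.

Lemma in_imageX t x i : in_image f t x -> in_image f (t * i) (x ^+ i).
Proof.
case=> p [hp <-]; exists (p ^+ i); split; first exact: dhomogMn.
by rewrite rmorphXn.
Qed.

Variables (e : nat) (c : {poly k}).
Hypothesis xc_image : in_image f e ('X * c).
Hypothesis c_image : in_image f e c.
Hypothesis c_neq0 : c != 0.

(** For t = 0 use c^q x^i = (x c)^i c^(q-i) with i <= q; afterwards [bounded_combination] extracts
    one factor f_l per degree. *)
Lemma conductor_image t (y : {poly k}) : (size y <= q + t * d)%N -> in_image f (e * q + t) (c ^+ q * y).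
Proof.
elim: t y => [|t IH] y sy.
  rewrite mul0n addn0 in sy; rewrite addn0 (poly_expand y) mulr_sumr; apply: in_image_sum => i _.
  rewrite mulrCA; apply: in_imageZ.
  have iq : (i <= q)%N by apply: leq_trans (ltnW (ltn_ord i)) sy.
  have := in_imageM (in_imageX i xc_image) (in_imageX (q - i) c_image).
  rewrite -mulnDr subnKC // exprMn -mulrA -exprD subnKC // mulrC //.
have [||b [-> sb]] := bounded_combination size_f size_S syz_mxE unit_rowE mu_le_q lead_span_mx
  (B := (q + t * d)%N) (p := y).
- exact: leq_addr.
- by move: sy; rewrite mulSn; lia.
rewrite mulr_sumr addnS; apply: in_image_sum => l _.
by rewrite mulrA mulrC; apply: in_image_var; apply: IH.
Qed.

Variable I : A -> Prop.
Hypothesis I_evf : forall t p, p \is t.-homog -> I p <-> evf f p = 0.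

Lemma indep_mod_evf t m (p : 'I_m -> A) : (forall i, p i \is t.-homog) ->
  indep_mod I p <-> forall a : 'I_m -> k, \sum_i a i *: evf f (p i) = 0 -> forall i, a i = 0.
Proof.
move=> hp; have E a : I (\sum_i a i *: p i) <-> \sum_i a i *: evf f (p i) = 0.
  rewrite (I_evf (t := t)) ?rmorph_sum; last by apply: rpred_sum => i _; apply: rpredZ; exact: hp.
  under eq_bigr do rewrite -mul_mpolyC rmorphM /= evfC mul_polyC.
  by [].
by split=> h a /E /h.
Qed.

Lemma hilb_fun_upper t m : hilb_fun I t m -> (m <= (t * d).+1)%N.
Proof.
case=> -[p [hp /(indep_mod_evf hp) ind]] _.
pose M : 'M[k]_(m, (t * d).+1) := \matrix_(i, j) (evf f (p i))`_j.
suff /eqP <- : row_free M by exact: rank_leq_col.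
apply: inj_row_free => v E; apply/rowP => i; rewrite [RHS]mxE; apply: (ind (fun i => v 0 i)).
apply/polyP => j; rewrite coef0 coef_sum.
have [jt|jt] := ltnP j (t * d).+1; last first.
  by rewrite big1 // => i' _; rewrite coefZ nth_default ?mulr0 // (leq_trans (size_evf size_f (hp i'))).
transitivity ((v *m M) 0 (Ordinal jt)); last by rewrite E mxE.
by rewrite mxE; apply: eq_bigr => i' _; rewrite coefZ mxE.
Qed.

(** Multiplication by c^q embeds the polynomials of size at most q + t d into the image. *)
Lemma hilb_fun_lower t m : hilb_fun I (e * q + t) m -> (q + t * d <= m)%N.
Proof.
case=> _ max; rewrite leqNgt; apply/negP => lt.
have /fin_all_exists[p Hp] (i : 'I_m.+1) : in_image f (e * q + t) (c ^+ q * 'X^i).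
  by apply: conductor_image; rewrite size_polyXn; apply: leq_trans (ltn_ord i) lt.
have hp i : p i \is (e * q + t).-homog by case: (Hp i).
apply: (max p hp); apply/(indep_mod_evf hp) => a E i.
have : c ^+ q * \sum_(i < m.+1) a i *: 'X^i = 0.
  rewrite -[RHS]E mulr_sumr; apply: eq_bigr => i' _; case: (Hp i') => _ ->.
  by rewrite scalerAr.
move/eqP; rewrite mulf_eq0 expf_eq0 (negbTE c_neq0) andbF /= => /eqP.
move/(congr1 (fun y : {poly k} => y`_i)); rewrite coef0 coef_sum (bigD1 i) //= coefZ coefXn eqxx mulr1.
rewrite big1 ?addr0 // => i' ii'; rewrite coefZ coefXn -[_ == _ :> nat]/(i == i').
by rewrite eq_sym (negbTE ii') mulr0.
Qed.

Lemma curve_degree_unique D : curve_degree I D -> D = d.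
Proof.
case=> t0 [c0 HD].
have H t : (t0 <= t)%N -> (q + t * d)%:Z <= D%:Z * (e * q + t)%:Z + c0 <= ((e * q + t) * d).+1%:Z.
  move=> ht; have [|m [hm <-]] := HD (e * q + t)%N; first by rewrite (leq_trans ht) ?leq_addl.
  by rewrite !lez_nat hilb_fun_lower // hilb_fun_upper.
move: H; set a := (e * q)%N => H.
have [lt|lt|//] := ltngtP D d; exfalso.
  (* Slopes D < d differ by at least 1, so this t outweighs the constant terms. *)
  have [t Et] : exists t, t = (t0 + D * a + `|c0|).+1%N by eexists.
  have /andP[h _] : (q + t * d)%:Z <= D%:Z * (a + t)%:Z + c0 <= ((a + t) * d).+1%:Z.
    by apply: H; rewrite Et -addnA leqW ?leq_addr.
  have h1 : (t * D.+1 <= t * d)%N by rewrite leq_mul2l lt orbT.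
  by nia.
have [t Et] : exists t, t = (t0 + a * d + `|c0|).+2%N by eexists.
have /andP[_ h] : (q + t * d)%:Z <= D%:Z * (a + t)%:Z + c0 <= ((a + t) * d).+1%:Z.
  by apply: H; rewrite Et -addnA 2?leqW ?leq_addr.
have h1 : (t * d.+1 <= t * D)%N by rewrite leq_mul2l lt orbT.
by nia.
Qed.

End HilbertFunction.

Section CurveRegularity.
Variables (k : fieldType) (n d : nat) (f : 'I_n.+1 -> {mpoly k[2]}) (mu : 'I_n -> nat).
Variable s : 'I_n -> 'I_n.+1 -> {mpoly k[2]}.
Hypothesis n_gt1 : (1 < n)%N.
Hypothesis d_gt0 : (0 < d)%N.
Hypothesis f_homog : forall l, f l \is d.-homog.
Hypothesis no_factor : no_common_factor f.
Hypothesis s_homog : forall i l, s i l \is (mu i).-homog.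
Hypothesis s_syz : forall i, \sum_l s i l * f l = 0.
Hypothesis s_gen : forall g : 'I_n.+1 -> {mpoly k[2]}, \sum_l g l * f l = 0 ->
  exists a : 'I_n -> {mpoly k[2]}, forall l, g l = \sum_i a i * s i l.
Hypothesis s_free : forall a : 'I_n -> {mpoly k[2]},
  (forall l, \sum_i a i * s i l = 0) -> forall i, a i = 0.
Hypothesis birat : birational f.

Local Notation q := (\max_(i < n) \max_(j < n | j != i) (mu i + mu j))%N.
Local Notation F := (affine_f f).
Local Notation S := (syz_mx s).

Let lead_free := lead_syz_free f_homog s_homog s_syz s_gen s_free.
Let sizeF := size_affine_f f_homog.
Let topF := affine_f_top f_homog no_factor.
Let sizeS := size_syz_mx s_homog.
Let SF := syz_mxP s_syz.

Lemma sum_mu : (\sum_i mu i)%N = d.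
Proof.
have [U UF] := affine_f_unit f_homog no_factor.
have [T TS] := syz_mx_complement f_homog s_gen UF.
exact: (sum_degrees sizeF topF sizeS SF UF TS lead_free).
Qed.

Lemma mu_pair_le i j : i != j -> (mu i + mu j <= q)%N.
Proof.
move=> ij; apply: leq_trans (leq_bigmax i).
by apply: (leq_bigmax_cond (F := fun j => (mu i + mu j)%N)); rewrite eq_sym.
Qed.

Lemma exists_other (i : 'I_n) : exists j, i != j.
Proof.
have n_gt0 : (0 < n)%N by apply: ltnW.
have [i0|i0] := eqVneq i (Ordinal n_gt0); last by exists (Ordinal n_gt0).
by exists (Ordinal n_gt1); rewrite i0.
Qed.

Lemma mu_le_max i : (mu i <= q)%N.
Proof.
have [j ij] := exists_other i.
by apply: leq_trans (mu_pair_le ij); rewrite leq_addr.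
Qed.

Lemma max_gt0 : (0 < q)%N.
Proof.
rewrite lt0n; apply/eqP => q0; move: d_gt0; rewrite -sum_mu big1 // => i _.
by apply/eqP; rewrite -leqn0 -q0 mu_le_max.
Qed.

(** If q <= 1, at most one mu_i is non-zero and it is 1. This provides the condition of
    [koszul_form_exact] at t = 0. *)
Lemma max_eq1 : (1 < q)%N || (d <= 1)%N.
Proof.
have [q1|//] := leqP q 1; rewrite -sum_mu.
have [/existsP[i i1]|/existsPn H] := boolP [exists i, (0 < mu i)%N].
  rewrite (bigD1 i) //= big1 ?addn0 => [|j ji].
    exact: leq_trans (mu_le_max i) q1.
  have := leq_trans (mu_pair_le ji) q1; move: i1; lia.
by rewrite big1 // => i _; have := H i; rewrite -leqNgt leqn0 => /eqP.
Qed.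

Let n_gt0 : (0 < n)%N.
Proof. exact: ltnW. Qed.

Lemma affine_image_exact t i (x : {set 'I_n.+1} -> {poly k}) :
  (q <= t.+1)%N -> ((0 < t)%N || (d <= 1)%N) ->
  (forall S : {set 'I_n.+1}, #|S| = i -> in_image F t.+1 (x S)) ->
  (forall S : {set 'I_n.+1}, #|S|.+1 = i -> contract F x S = 0) ->
  exists b : {set 'I_n.+1} -> {poly k},
    (forall S : {set 'I_n.+1}, #|S| = i.+1 -> in_image F t (b S)) /\
    forall S : {set 'I_n.+1}, #|S| = i -> x S = contract F b S.
Proof.
have [U UF] := affine_f_unit f_homog no_factor.
have [T TS] := syz_mx_complement f_homog s_gen UF.
have [e [c [xc c_im c0]]] := birational_affine f_homog birat.
exact: (koszul_image sizeF topF sizeS SF UF TS lead_free mu_pair_le mu_le_max max_gt0 d_gt0 n_gt0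
  xc c_im c0).
Qed.

Lemma curve_reg_ideal : reg_le (curve_ideal f) (@zero_ideal k n.+1) q.
Proof.
exact: (reg_le_ideal (curve_idealE f_homog) max_gt0 max_eq1 affine_image_exact).
Qed.

Lemma curve_degreeE D : curve_degree (curve_ideal f) D -> D = d.
Proof.
have [U UF] := affine_f_unit f_homog no_factor.
have [e [c [xc c_im c0]]] := birational_affine f_homog birat.
exact: (curve_degree_unique sizeF topF sizeS SF UF lead_free mu_le_max xc c_im c0
  (curve_idealE f_homog)).
Qed.

(* A syzygy of degree 0 is a linear relation between the f l. *)
Lemma mu_gt0 i : lin_indep f -> (0 < mu i)%N.
Proof.
move=> indep; rewrite lt0n; apply/eqP => mui.
have hs l : s i l = ((s i l)@_0)%:MP.
  apply: msize1_polyC; rewrite msizeE; apply/bigmax_leqP_seq => m ms _.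
  by have /= -> := dhomog_mf (s_homog i l) ms; rewrite mui.
have c0 : forall l, (s i l)@_0 = 0.
  apply: indep; rewrite -[RHS](s_syz i); apply: eq_bigr => l _.
  by rewrite -mul_mpolyC -hs.
have /s_free/(_ i)/eqP : forall l, \sum_j (j == i)%:R * s j l = 0.
  move=> l; rewrite big1 // => j _.
  by case: eqVneq => [->|_]; rewrite ?mul0r // hs c0 mpolyC0 mulr0.
by rewrite eqxx oner_eq0.
Qed.

(** All mu_i are positive with sum d, so those other than mu_i and mu_j take up at least n - 2. *)
Lemma max_le_degree : lin_indep f -> (q + n <= d + 2)%N.
Proof.
move=> indep; have E : d = (n + \sum_i (mu i).-1)%N.
  have {1}<- : (\sum_(i < n) 1)%N = n by rewrite sum1_card card_ord.
  rewrite -sum_mu -big_split; apply: eq_bigr => i _ /=.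
  by rewrite add1n prednK // mu_gt0.
have : (q <= d + 2 - n)%N.
  apply/bigmax_leqP => i _; apply/bigmax_leqP => j ji.
  move: E; rewrite (bigD1 i) //= (bigD1 j) //=.
  have := mu_gt0 i indep; have := mu_gt0 j indep; lia.
rewrite leq_subRL; last by rewrite E -addnA leq_addr.
by rewrite addnC.
Qed.

(** With r = n + 1 variables, q - 1 <= d + 1 - n = d - (r - 2), and r - 2 is the codimension. *)
Lemma curve_reg_quotient D : lin_indep f -> curve_degree (curve_ideal f) D ->
  reg_le (@unit_ideal k n.+1) (curve_ideal f) (D%:Z - (n.+1%:Z - 2)).
Proof.
move=> indep /curve_degreeE -> i j nz.
have := reg_le_quotient (curve_idealE f_homog) max_gt0 max_eq1 affine_image_exact nz.
have := max_le_degree indep; set Q := q; lia.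
Qed.

End CurveRegularity.

Theorem mainTheorem6 (k : fieldType) (r d : nat) (f : 'I_r -> {mpoly k[2]})
  (mu : 'I_(r-1) -> nat) :
  (3 <= r)%N -> (1 <= d)%N ->
  (forall l, f l \is d.-homog) ->
  no_common_factor f ->
  resolution_degrees f mu ->
  birational f ->
  (\sum_(i < r-1) mu i)%N = d /\
  reg_le (@curve_ideal k r f) (@zero_ideal k r)
    (\max_(i < r-1) \max_(j < r-1 | j != i) (mu i + mu j))%N%:Z /\
  (lin_indep f ->
   forall D : nat, curve_degree (@curve_ideal k r f) D ->
   reg_le (@unit_ideal k r) (@curve_ideal k r f) (D%:Z - (r%:Z - 2))).
Proof.
case: r f mu => [//|n] f; rewrite /resolution_degrees subn1 /=.
move=> mu n2 d0 hf nf [s [hs [syz [gen free]]]] bir; split.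
  exact: (sum_mu hf nf hs syz gen free).
split; first exact: (curve_reg_ideal n2 d0 hf nf hs syz gen free bir).
by move=> indep D; apply: (curve_reg_quotient n2 d0 hf nf hs syz gen free bir).
Qed.
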